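(* Let $k$ be an integer with $0\le k\le 7$, and let $G=(X,Y)$ be a bipartite graph satisfying the double Hall property. If $|X|=n>\max\{2k+1,\,k(k+1)\}$ and $\deg(y)\ge n-k$ for every $y\in Y$, then $G$ contains a cycle $C$ with $X\subseteq V(C)$.
   Context: All graphs are finite and simple. For a vertex set $S$, $\Lambda^2(S)$ denotes the set of vertices adjacent to at least two vertices of $S$. A bipartite graph $G=(X,Y)$ with $|X|\ge 2$ satisfies the double Hall property if $|\Lambda^2(S)|\ge |S|$ for every $S\subseteq X$ with $|S|\ge 2$. *)

(* Defs.v *)
From mathcomp Require Import all_boot.

Set Implicit Arguments.
Unset Strict Implicit.
Unset Printing Implicit Defensive.

Definition simple_graph (T : finType) (e : rel T) : Prop :=
  symmetric e /\ irreflexive e.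

Definition bipartition (T : finType) (e : rel T) (X Y : {set T}) : Prop :=
  [/\ X :|: Y = [set: T],
      [disjoint X & Y] &
      forall u v, e u v ->
        (u \in X) && (v \in Y) || (u \in Y) && (v \in X)].

Definition bipartite_graph (T : finType) (e : rel T) (X Y : {set T}) : Prop :=
  simple_graph e /\ bipartition e X Y.

Definition degree (T : finType) (e : rel T) (v : T) : nat :=
  #|[set u | e v u]|.

Definition Lambda2 (T : finType) (e : rel T) (S : {set T}) : {set T} :=
  [set v | 2 <= #|[set u in S | e v u]|].

Definition double_Hall (T : finType) (e : rel T) (X : {set T}) : Prop :=
  2 <= #|X| /\
  forall S : {set T}, S \subset X -> 2 <= #|S| -> #|S| <= #|Lambda2 e S|.

(* The library's [ucycle] also accepts the empty sequence and, on a symmetric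
   relation, a single edge traversed back and forth, hence the size bound. *)
Definition graph_cycle (T : finType) (e : rel T) (c : seq T) : Prop :=
  3 <= size c /\ ucycle e c.

(* Main.v *)
From Stdlib Require Import Classical.
Require Import Defs.
From mathcomp Require Import all_boot perm zify.

Set Implicit Arguments.
Unset Strict Implicit.
Unset Printing Implicit Defensive.

(** Counting non-edges shows that the set [low] of vertices of [X] of degree at
    most [k] has at most [k <= 7] elements.  An alternating-path argument gives
    vertex-disjoint cycles and paths with both ends outside [X] in which every
    vertex of [low] has degree two.  If cycles are present, some other such
    system covers fewer vertices by cycles; for at most seven vertices this is
    a finite case analysis, done by a checked table of certificates.  So [low]
    is covered by disjoint paths only.  Since every vertex outside [X] misses at
    most [k] vertices of [X], two such vertices have a common neighbour in any
    set of more than [2k] vertices of [X]: this joins the paths into one, which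
    is extended and closed to a cycle missing exactly [2k] vertices of [X].  The
    missing vertices have degree at least [k + 1], and they are inserted one by
    one by local exchanges along the cycle. *)

(** On subsets [A] of [low] double Hall enters through two bounds: at least [|A|] vertices with two
    neighbours in [A] when [|A| >= 2], and more than [|A|] vertices with one neighbour. The second
    is double Hall for [A] with one more vertex of [X]. Together they give [2|A|], the deficiency
    condition for assigning two edges to each vertex of [low] with every outside vertex used at most
    twice. The certificates use nothing else about the graph besides adjacency tests. The obstacle
    is that such an assignment may close into cycles, which cannot be linked to other components;
    the bound seven is the range of the table of shapes. The constants: two outside vertices are
    sure to have a common neighbour only among more than [2k] candidates, so the closed cycle leaves
    [2k] vertices out. Joining at most [|low|] paths needs [2|low| + 2k <= n], which follows from
    [n > k(k+1)] and [n > 2k+1] except for [k = 2], [|low| = 2], [n = 7]; the case [k = 2],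
    [|low| = 2] gets an explicit path. Insertion needs more than [k] and at least [2k - 1] vertices
    of [X] on the cycle, that is [3k < n] and [4k <= n + 1]. *)

Section System.

Variables (V : eqType) (r : rel V) (inX : pred V).

Definition ypath (p : seq V) :=
  if p is y :: q then [&& ~~ inX y, ~~ inX (last y q) & path r y q] else false.

(** Listing a cycle from a vertex of [X] fixes the pattern of memberships along it, as the coding by
    positions requires; [2 < size c] excludes a single edge run back and forth. *)
Definition xcycle (c : seq V) :=
  if c is x :: q then [&& inX x, 2 < size c & cycle r c] else false.

Definition path_system (cs ps : seq (seq V)) :=
  [&& uniq (flatten (cs ++ ps)), all xcycle cs & all ypath ps].

End System.

(** * Certificates

    Vertices are coded by their positions in the concatenation of the
    components of a system of cycles and paths; [nth false bs i] tells whether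
    the vertex of code [i] lies in [X].  One further code, equal to the number
    [m] of vertices of the system, is used for a vertex outside the system. *)

Definition joined (E : seq (nat * nat)) : rel nat :=
  fun i j => ((i, j) \in E) || ((j, i) \in E).

(* In the system, [s] gives up its neighbour [y] and takes [y'] instead. *)
Definition exchange (E : seq (nat * nat)) (x : nat * nat * nat) :=
  let: (s, y, y') := x in
  (s, y') :: [seq d <- E | (d != (s, y)) && (d != (y, s))].

(** A greedy walk from [i] that consumes the edges it uses, with [n] as fuel. When all degrees are
    at most two it traces a path from one of its ends, or a whole cycle from any of its vertices. *)
Fixpoint trail (n i : nat) (E : seq (nat * nat)) :=
  if n isn't n'.+1 then ([:: i], E) else
  let h := find (fun d => (d.1 == i) || (d.2 == i)) E in
  if drop h E isn't d :: E' then ([:: i], E) else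
  let: (q, E'') := trail n' (if d.1 == i then d.2 else d.1) (take h E ++ E') in
  (i :: q, E'').

Fixpoint trails (n : nat) (starts : seq nat) (E : seq (nat * nat)) :=
  if starts isn't i :: starts' then ([::], E) else
  if has (fun d => (d.1 == i) || (d.2 == i)) E then
    let: (q, E') := trail n i E in
    let: (ps, E'') := trails n starts' E' in (q :: ps, E'')
  else trails n starts' E.

(** Its output needs no correctness proof, since [check] verifies it. Paths are traced first, from
    their ends, so that in a system of cycles and paths the second pass sees cycles only; a trail
    around a cycle repeats its start, which [take] removes. *)
Definition components (bs : seq bool) (E : seq (nat * nat)) :=
  let ends := [seq i <- iota 0 (size bs) |
    ~~ nth false bs i && (count (fun d => (d.1 == i) || (d.2 == i)) E == 1)] in
  let: (ps, E') := trails (size E) ends E in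
  let: (cs, _) :=
    trails (size E) [seq i <- iota 0 (size bs) | nth false bs i] E' in
  ([seq take (size c).-1 c | c <- cs], ps).

(* A certificate is a decision tree over the unknown edges of the graph:
   - [Better ch]: performing the exchanges [ch] on the system leaves fewer
     vertices on cycles;
   - [HallGap A], [NbrGap A]: the non-edges assumed so far contradict the lower
     bound on the number of vertices with two neighbours, resp. one, in [A];
   - [SplitEdge s y]: is [s] adjacent to [y]?
   - [SplitLink a b]: is there a vertex outside the system adjacent to [a] and [b]?
   - [SplitNbr a]: is there a vertex outside the system adjacent to [a]? *)
Inductive cert :=
  | Better of seq (nat * nat * nat)
  | HallGap of seq nat
  | NbrGap of seq nat
  | SplitEdge of nat & nat & cert & cert
  | SplitLink of nat & nat & cert & cert
  | SplitNbr of nat & cert & cert.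

Section Check.

(* [mu] vertices lie on cycles, and [base] lists the edges of the system. *)
Variables (mu m : nat) (base : seq (nat * nat)).

(** [bs] gives the side of each coded vertex, [pos] and [neg] the adjacencies decided so far.
    [links] and [lone] record pairs without a common neighbour, resp. vertices without a neighbour,
    beyond the first [m] codes; this is why the gap cases count over [ys] alone. The test
    [size bs == m] lets a branch name at most one extra vertex. *)
Fixpoint check (bs : seq bool) (pos neg links : seq (nat * nat))
    (lone : seq nat) (c : cert) {struct c} : bool :=
  let inX := nth false bs in
  let ys := [seq y <- iota 0 m | ~~ inX y] in
  match c with
  | Better ch =>
      let: (cs, ps) := components bs (foldl exchange base ch) in
      let vs := flatten (cs ++ ps) in
      [&& path_system (joined pos) inX cs ps, all (gtn (size bs)) vs,
          all (fun i => inX i ==> (i \in vs)) (iota 0 (size bs))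
        & size (flatten cs) < mu]
  | HallGap A =>
      [&& uniq A, all inX A, 1 < size A,
          all (fun a => all (fun b => [|| a == b, joined links a b,
                                          a \in lone | b \in lone]) A) A
        & count (fun y => 1 < count (fun a => (a, y) \notin neg) A) ys < size A]
  | NbrGap A =>
      [&& uniq A, all inX A, 0 < size A, all (mem lone) A
        & count (fun y => has (fun a => (a, y) \notin neg) A) ys <= size A]
  | SplitEdge s y c1 c2 =>
      [&& inX s, y < size bs, check bs ((s, y) :: pos) neg links lone c1
        & check bs pos ((s, y) :: neg) links lone c2]
  | SplitLink a b c1 c2 =>
      [&& size bs == m, inX a, inX b,
          check (rcons bs false) [:: (a, m), (b, m) & pos] neg links lone c1
        & check bs pos neg ((a, b) :: links) lone c2]
  | SplitNbr a c1 c2 =>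
      [&& size bs == m, inX a,
          check (rcons bs false) ((a, m) :: pos) neg links lone c1
        & check bs pos neg links (a :: lone) c2]
  end.

End Check.

Fixpoint blocks (i : nat) (sz : seq nat) :=
  if sz is z :: sz' then iota i z :: blocks (i + z) sz' else [::].

Fixpoint alternation (b : bool) (n : nat) :=
  if n is n'.+1 then b :: alternation (~~ b) n' else [::].

(* [a] lists the numbers of vertices of [X] on the cycles, [b] on the paths. *)
Definition check_shape (a b : seq nat) (c : cert) :=
  let za := [seq l.*2 | l <- a] in
  let zb := [seq l.*2.+1 | l <- b] in
  let bs := flatten ([seq alternation true z | z <- za]
                     ++ [seq alternation false z | z <- zb]) in
  let base :=
    flatten ([seq zip c (rot 1 c) | c <- blocks 0 za]
             ++ [seq zip p (behead p) | p <- blocks (sumn za) zb]) in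
  check (sumn za) (size bs) base bs base [::] [::] [::] c.

Section Certificates.

Local Notation F1 a b c := (Better [:: (a, b, c)]).
Local Notation F2 a b c d e f := (Better [:: (a, b, c); (d, e, f)]).
Local Notation F3 a b c d e f g h i := (Better [:: (a, b, c); (d, e, f); (g, h, i)]).
Local Notation H := HallGap.
Local Notation N := NbrGap.
Local Notation E := SplitEdge.
Local Notation P := SplitLink.
Local Notation Q := SplitNbr.

(* Every shape with at most seven vertices of [X] and at least one cycle. *)
Definition certificates : seq (seq nat * seq nat * cert) := [::
([:: 2], [::], (Q 0 (F1 0 1 4) (Q 2 (F1 2 3 4) (N [:: 0; 2]))));
([:: 2], [:: 1], (E 0 4 (F1 0 1 4) (E 2 4 (F1 2 3 4) (E 0 6 (F1 0 1 6) (E 2 6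
(F1 2 3 6) (Q 0 (F1 0 1 7) (Q 2 (F1 2 3 7) (N [:: 0; 2]))))))));
([:: 3], [::], (Q 0 (F1 0 1 6) (Q 2 (F1 2 3 6) (Q 4 (F1 4 5 6) (N [:: 0; 2;
4])))));
([:: 2], [:: 2], (E 0 4 (F1 0 1 4) (E 2 4 (F1 2 3 4) (E 0 8 (F1 0 1 8) (E 2 8
(F1 2 3 8) (P 0 5 (F2 0 1 9 5 6 9) (Q 0 (F1 0 1 9) (Q 2 (F1 2 3 9) (E 5 3 (E 0
6 (F2 0 3 6 5 6 3) (E 2 6 (F2 2 3 6 5 6 3) (N [:: 0; 2]))) (E 5 1 (E 0 6 (F2 0
1 6 5 6 1) (E 2 6 (F2 2 1 6 5 6 1) (N [:: 0; 2]))) (H [:: 0; 5])))))))))));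
([:: 2], [:: 1; 1], (E 0 4 (F1 0 1 4) (E 2 4 (F1 2 3 4) (E 0 6 (F1 0 1 6) (E 2
6 (F1 2 3 6) (E 0 7 (F1 0 1 7) (E 2 7 (F1 2 3 7) (E 0 9 (F1 0 1 9) (E 2 9 (F1 2
3 9) (Q 0 (F1 0 1 10) (Q 2 (F1 2 3 10) (N [:: 0; 2]))))))))))));
([:: 3], [:: 1], (E 0 6 (F1 0 1 6) (E 2 6 (F1 2 3 6) (E 4 6 (F1 4 5 6) (E 0 8
(F1 0 1 8) (E 2 8 (F1 2 3 8) (E 4 8 (F1 4 5 8) (Q 0 (F1 0 1 9) (Q 2 (F1 2 3 9)
(Q 4 (F1 4 5 9) (N [:: 0; 2; 4])))))))))));
([:: 4], [::], (Q 0 (F1 0 1 8) (Q 2 (F1 2 3 8) (Q 4 (F1 4 5 8) (Q 6 (F1 6 7 8)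
(N [:: 0; 2; 4; 6]))))));
([:: 2; 2], [::], (Q 0 (F1 0 1 8) (Q 2 (F1 2 3 8) (Q 4 (F1 4 5 8) (Q 6 (F1 6 7
8) (N [:: 0; 2; 4; 6]))))));
([:: 2], [:: 3], (E 0 4 (F1 0 1 4) (E 2 4 (F1 2 3 4) (E 0 10 (F1 0 1 10) (E 2
10 (F1 2 3 10) (P 0 5 (F2 0 1 11 5 6 11) (P 0 7 (F2 0 1 11 7 8 11) (Q 0 (F1 0 1
11) (Q 2 (F1 2 3 11) (E 7 3 (E 0 6 (F2 0 3 6 7 6 3) (E 2 6 (F2 2 3 6 7 6 3) (E
0 8 (F2 0 3 8 7 8 3) (E 2 8 (F2 2 3 8 7 8 3) (N [:: 0; 2]))))) (E 7 1 (E 0 6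
(F2 0 1 6 7 6 1) (E 2 6 (F2 2 1 6 7 6 1) (E 0 8 (F2 0 1 8 7 8 1) (E 2 8 (F2 2 1
8 7 8 1) (N [:: 0; 2]))))) (E 0 6 (E 5 3 (F2 0 3 6 5 6 3) (E 5 1 (F2 0 1 6 5 6
1) (E 7 4 (F2 0 1 6 7 6 4) (E 5 10 (F2 0 1 6 5 6 10) (P 5 7 (F3 0 1 6 5 6 11 7
8 11) (H [:: 0; 5; 7])))))) (H [:: 0; 7])))))))))))));
([:: 2], [:: 2; 1], (E 0 4 (F1 0 1 4) (E 2 4 (F1 2 3 4) (E 0 8 (F1 0 1 8) (E 2
8 (F1 2 3 8) (E 0 9 (F1 0 1 9) (E 2 9 (F1 2 3 9) (E 0 11 (F1 0 1 11) (E 2 11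
(F1 2 3 11) (P 0 5 (F2 0 1 12 5 6 12) (Q 0 (F1 0 1 12) (Q 2 (F1 2 3 12) (E 5 3
(E 0 6 (F2 0 3 6 5 6 3) (E 2 6 (F2 2 3 6 5 6 3) (N [:: 0; 2]))) (E 5 1 (E 0 6
(F2 0 1 6 5 6 1) (E 2 6 (F2 2 1 6 5 6 1) (N [:: 0; 2]))) (H [:: 0;
5])))))))))))))));
([:: 2], [:: 1; 1; 1], (E 0 4 (F1 0 1 4) (E 2 4 (F1 2 3 4) (E 0 6 (F1 0 1 6) (E
2 6 (F1 2 3 6) (E 0 7 (F1 0 1 7) (E 2 7 (F1 2 3 7) (E 0 9 (F1 0 1 9) (E 2 9 (F1
2 3 9) (E 0 10 (F1 0 1 10) (E 2 10 (F1 2 3 10) (E 0 12 (F1 0 1 12) (E 2 12 (F1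
2 3 12) (Q 0 (F1 0 1 13) (Q 2 (F1 2 3 13) (N [:: 0; 2]))))))))))))))));
([:: 3], [:: 2], (E 0 6 (F1 0 1 6) (E 2 6 (F1 2 3 6) (E 4 6 (F1 4 5 6) (E 0 10
(F1 0 1 10) (E 2 10 (F1 2 3 10) (E 4 10 (F1 4 5 10) (P 0 2 (F2 0 1 11 2 3 11)
(P 0 4 (F2 0 1 11 4 5 11) (P 0 7 (F2 0 1 11 7 8 11) (P 2 7 (F2 2 3 11 7 8 11)
(Q 0 (F1 0 1 11) (Q 2 (F1 2 3 11) (Q 4 (F1 4 5 11) (E 7 5 (E 0 8 (F2 0 5 8 7 8
5) (E 4 8 (F2 4 5 8 7 8 5) (E 2 8 (E 4 1 (F3 2 1 8 4 5 1 7 8 5) (E 0 3 (F3 0 5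
3 2 3 8 7 8 5) (H [:: 0; 4]))) (N [:: 0; 2; 4])))) (E 7 1 (E 0 8 (F2 0 1 8 7 8
1) (E 2 8 (F2 2 1 8 7 8 1) (E 4 8 (E 2 5 (F3 2 1 5 4 5 8 7 8 1) (E 0 3 (F3 0 1
3 4 3 8 7 8 1) (H [:: 0; 2]))) (N [:: 0; 2; 4])))) (E 7 3 (E 2 8 (F2 2 3 8 7 8
3) (H [:: 2; 7])) (H [:: 0; 7]))))))))))))))))));
([:: 3], [:: 1; 1], (E 0 6 (F1 0 1 6) (E 2 6 (F1 2 3 6) (E 4 6 (F1 4 5 6) (E 0
8 (F1 0 1 8) (E 2 8 (F1 2 3 8) (E 4 8 (F1 4 5 8) (E 0 9 (F1 0 1 9) (E 2 9 (F1 2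
3 9) (E 4 9 (F1 4 5 9) (E 0 11 (F1 0 1 11) (E 2 11 (F1 2 3 11) (E 4 11 (F1 4 5
11) (Q 0 (F1 0 1 12) (Q 2 (F1 2 3 12) (Q 4 (F1 4 5 12) (N [:: 0; 2;
4])))))))))))))))));
([:: 4], [:: 1], (E 0 8 (F1 0 1 8) (E 2 8 (F1 2 3 8) (E 4 8 (F1 4 5 8) (E 6 8
(F1 6 7 8) (E 0 10 (F1 0 1 10) (E 2 10 (F1 2 3 10) (E 4 10 (F1 4 5 10) (E 6 10
(F1 6 7 10) (Q 0 (F1 0 1 11) (Q 2 (F1 2 3 11) (Q 4 (F1 4 5 11) (Q 6 (F1 6 7 11)
(N [:: 0; 2; 4; 6]))))))))))))));
([:: 2; 2], [:: 1], (E 0 8 (F1 0 1 8) (E 2 8 (F1 2 3 8) (E 4 8 (F1 4 5 8) (E 6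
8 (F1 6 7 8) (E 0 10 (F1 0 1 10) (E 2 10 (F1 2 3 10) (E 4 10 (F1 4 5 10) (E 6
10 (F1 6 7 10) (Q 0 (F1 0 1 11) (Q 2 (F1 2 3 11) (Q 4 (F1 4 5 11) (Q 6 (F1 6 7
11) (N [:: 0; 2; 4; 6]))))))))))))));
([:: 5], [::], (Q 0 (F1 0 1 10) (Q 2 (F1 2 3 10) (Q 4 (F1 4 5 10) (Q 6 (F1 6 7
10) (Q 8 (F1 8 9 10) (N [:: 0; 2; 4; 6; 8])))))));
([:: 3; 2], [::], (Q 0 (F1 0 1 10) (Q 2 (F1 2 3 10) (Q 4 (F1 4 5 10) (Q 6 (F1 6
7 10) (Q 8 (F1 8 9 10) (N [:: 0; 2; 4; 6; 8])))))));
([:: 2], [:: 4], (E 0 4 (F1 0 1 4) (E 2 4 (F1 2 3 4) (E 0 12 (F1 0 1 12) (E 2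
12 (F1 2 3 12) (P 0 5 (F2 0 1 13 5 6 13) (P 0 7 (F2 0 1 13 7 8 13) (P 0 9 (F2 0
1 13 9 10 13) (P 0 11 (F2 0 1 13 11 12 13) (Q 0 (F1 0 1 13) (Q 2 (F1 2 3 13) (P
5 9 (E 0 6 (F3 0 1 6 5 6 13 9 10 13) (E 2 6 (F3 2 3 6 5 6 13 9 10 13) (E 0 8
(F3 0 1 8 5 6 13 9 8 13) (E 2 8 (F3 2 3 8 5 6 13 9 8 13) (E 0 10 (F3 0 1 10 5 6
13 9 10 13) (E 2 10 (F3 2 3 10 5 6 13 9 10 13) (N [:: 0; 2]))))))) (P 7 9 (E 0
6 (F3 0 1 6 7 6 13 9 8 13) (E 2 6 (F3 2 3 6 7 6 13 9 8 13) (E 0 8 (F3 0 1 8 7 8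
13 9 10 13) (E 2 8 (F3 2 3 8 7 8 13 9 10 13) (E 0 10 (F3 0 1 10 7 8 13 9 10 13)
(E 2 10 (F3 2 3 10 7 8 13 9 10 13) (N [:: 0; 2]))))))) (P 7 11 (E 0 6 (F3 0 1 6
7 6 13 11 10 13) (E 2 6 (F3 2 3 6 7 6 13 11 10 13) (E 0 8 (F3 0 1 8 7 8 13 11
12 13) (E 2 8 (F3 2 3 8 7 8 13 11 12 13) (E 0 10 (F3 0 1 10 7 8 13 11 10 13) (E
2 10 (F3 2 3 10 7 8 13 11 10 13) (N [:: 0; 2]))))))) (E 0 6 (E 5 3 (F2 0 3 6 5
6 3) (E 7 3 (F2 0 3 6 7 6 3) (E 5 1 (F2 0 1 6 5 6 1) (E 7 1 (F2 0 1 6 7 6 1) (E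
7 4 (F2 0 1 6 7 6 4) (E 5 12 (F2 0 1 6 5 6 12) (P 5 7 (F3 0 1 6 5 6 13 7 8 13)
(E 0 8 (E 9 3 (F2 0 3 8 9 8 3) (E 9 1 (F2 0 1 8 9 8 1) (E 9 4 (F2 0 1 8 9 8 4)
(E 7 12 (F2 0 1 8 7 8 12) (H [:: 0; 5; 7; 9]))))) (E 0 10 (E 9 3 (F2 0 3 10 9
10 3) (E 9 1 (F2 0 1 10 9 10 1) (E 9 12 (F2 0 1 10 9 10 12) (E 5 10 (E 9 4 (F3
0 1 6 5 6 10 9 10 4) (H [:: 0; 5; 7; 9])) (H [:: 0; 5]))))) (H [:: 0;
5])))))))))) (E 9 3 (E 0 8 (F2 0 3 8 9 8 3) (E 2 8 (F2 2 3 8 9 8 3) (E 0 10 (F2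
0 3 10 9 10 3) (E 2 10 (F2 2 3 10 9 10 3) (E 2 6 (E 5 3 (F2 2 3 6 5 6 3) (E 5 1
(F2 2 1 6 5 6 1) (E 5 12 (F2 2 3 6 5 6 12) (E 5 8 (F3 2 3 6 5 6 8 9 8 3) (H [::
0; 5]))))) (N [:: 0; 2])))))) (E 9 1 (E 0 8 (F2 0 1 8 9 8 1) (E 0 10 (F2 0 1 10
9 10 1) (H [:: 0; 9]))) (E 0 8 (E 7 3 (F2 0 3 8 7 8 3) (E 7 1 (F2 0 1 8 7 8 1)
(E 9 4 (F2 0 1 8 9 8 4) (E 7 12 (F2 0 1 8 7 8 12) (P 9 11 (F3 0 1 8 9 8 13 11
10 13) (E 0 10 (E 11 3 (F2 0 3 10 11 10 3) (E 11 1 (F2 0 1 10 11 10 1) (E 11 4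
(F2 0 1 10 11 10 4) (E 9 12 (F2 0 1 10 9 10 12) (H [:: 0; 7; 9; 11]))))) (H [::
0; 7]))))))) (H [:: 0; 9])))))))))))))))))));
([:: 2], [:: 3; 1], (E 0 4 (F1 0 1 4) (E 2 4 (F1 2 3 4) (E 0 10 (F1 0 1 10) (E
2 10 (F1 2 3 10) (E 0 11 (F1 0 1 11) (E 2 11 (F1 2 3 11) (E 0 13 (F1 0 1 13) (E
2 13 (F1 2 3 13) (P 0 5 (F2 0 1 14 5 6 14) (P 0 7 (F2 0 1 14 7 8 14) (Q 0 (F1 0
1 14) (Q 2 (F1 2 3 14) (E 7 3 (E 0 6 (F2 0 3 6 7 6 3) (E 2 6 (F2 2 3 6 7 6 3)
(E 0 8 (F2 0 3 8 7 8 3) (E 2 8 (F2 2 3 8 7 8 3) (N [:: 0; 2]))))) (E 7 1 (E 0 6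
(F2 0 1 6 7 6 1) (E 2 6 (F2 2 1 6 7 6 1) (E 0 8 (F2 0 1 8 7 8 1) (E 2 8 (F2 2 1
8 7 8 1) (N [:: 0; 2]))))) (E 0 6 (E 5 3 (F2 0 3 6 5 6 3) (E 5 1 (F2 0 1 6 5 6
1) (E 7 4 (F2 0 1 6 7 6 4) (E 5 10 (F2 0 1 6 5 6 10) (E 5 11 (F2 0 1 6 5 6 11)
(E 7 11 (F2 0 1 6 7 6 11) (E 5 13 (F2 0 1 6 5 6 13) (E 7 13 (F2 0 1 6 7 6 13)
(P 5 7 (F3 0 1 6 5 6 14 7 8 14) (H [:: 0; 5; 7])))))))))) (H [:: 0;
7])))))))))))))))));
([:: 2], [:: 2; 2], (E 0 4 (F1 0 1 4) (E 2 4 (F1 2 3 4) (E 0 8 (F1 0 1 8) (E 2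
8 (F1 2 3 8) (E 0 9 (F1 0 1 9) (E 2 9 (F1 2 3 9) (E 0 13 (F1 0 1 13) (E 2 13
(F1 2 3 13) (P 0 5 (F2 0 1 14 5 6 14) (P 0 7 (F2 0 1 14 7 8 14) (P 0 10 (F2 0 1
14 10 11 14) (Q 0 (F1 0 1 14) (Q 2 (F1 2 3 14) (E 0 6 (E 5 3 (F2 0 3 6 5 6 3)
(E 7 3 (F2 0 3 6 7 6 3) (E 5 1 (F2 0 1 6 5 6 1) (E 7 1 (F2 0 1 6 7 6 1) (E 7 4
(F2 0 1 6 7 6 4) (E 5 8 (F2 0 1 6 5 6 8) (E 5 9 (F2 0 1 6 5 6 9) (E 7 9 (F2 0 1
6 7 6 9) (E 5 13 (F2 0 1 6 5 6 13) (E 7 13 (F2 0 1 6 7 6 13) (P 5 7 (F3 0 1 6 5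
6 14 7 8 14) (H [:: 0; 5; 7])))))))))))) (E 10 3 (E 0 11 (F2 0 3 11 10 11 3) (E
2 11 (F2 2 3 11 10 11 3) (E 2 6 (E 5 3 (F2 2 3 6 5 6 3) (E 5 1 (F2 2 1 6 5 6 1)
(E 5 8 (F2 2 3 6 5 6 8) (E 5 9 (F2 2 3 6 5 6 9) (E 5 13 (F2 2 3 6 5 6 13) (E 5
11 (F3 2 3 6 5 6 11 10 11 3) (H [:: 0; 5]))))))) (N [:: 0; 2])))) (E 10 1 (E 0
11 (F2 0 1 11 10 11 1) (H [:: 0; 10])) (H [:: 0; 10]))))))))))))))))));
([:: 2], [:: 2; 1; 1], (E 0 4 (F1 0 1 4) (E 2 4 (F1 2 3 4) (E 0 8 (F1 0 1 8) (E
2 8 (F1 2 3 8) (E 0 9 (F1 0 1 9) (E 2 9 (F1 2 3 9) (E 0 11 (F1 0 1 11) (E 2 11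
(F1 2 3 11) (E 0 12 (F1 0 1 12) (E 2 12 (F1 2 3 12) (E 0 14 (F1 0 1 14) (E 2 14
(F1 2 3 14) (P 0 5 (F2 0 1 15 5 6 15) (Q 0 (F1 0 1 15) (Q 2 (F1 2 3 15) (E 5 3
(E 0 6 (F2 0 3 6 5 6 3) (E 2 6 (F2 2 3 6 5 6 3) (N [:: 0; 2]))) (E 5 1 (E 0 6
(F2 0 1 6 5 6 1) (E 2 6 (F2 2 1 6 5 6 1) (N [:: 0; 2]))) (H [:: 0;
5])))))))))))))))))));
([:: 2], [:: 1; 1; 1; 1], (E 0 4 (F1 0 1 4) (E 2 4 (F1 2 3 4) (E 0 6 (F1 0 1 6)
(E 2 6 (F1 2 3 6) (E 0 7 (F1 0 1 7) (E 2 7 (F1 2 3 7) (E 0 9 (F1 0 1 9) (E 2 9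
(F1 2 3 9) (E 0 10 (F1 0 1 10) (E 2 10 (F1 2 3 10) (E 0 12 (F1 0 1 12) (E 2 12
(F1 2 3 12) (E 0 13 (F1 0 1 13) (E 2 13 (F1 2 3 13) (E 0 15 (F1 0 1 15) (E 2 15
(F1 2 3 15) (Q 0 (F1 0 1 16) (Q 2 (F1 2 3 16) (N [:: 0; 2]))))))))))))))))))));
([:: 3], [:: 3], (E 0 6 (F1 0 1 6) (E 2 6 (F1 2 3 6) (E 4 6 (F1 4 5 6) (E 0 12
(F1 0 1 12) (E 2 12 (F1 2 3 12) (E 4 12 (F1 4 5 12) (P 0 2 (F2 0 1 13 2 3 13)
(P 0 4 (F2 0 1 13 4 5 13) (P 0 7 (F2 0 1 13 7 8 13) (P 0 9 (F2 0 1 13 9 10 13)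
(P 0 11 (F2 0 1 13 11 12 13) (P 2 4 (F2 2 3 13 4 5 13) (P 2 7 (F2 2 3 13 7 8
13) (P 2 9 (F2 2 3 13 9 10 13) (P 2 11 (F2 2 3 13 11 12 13) (P 4 7 (F2 4 5 13 7
8 13) (P 4 9 (F2 4 5 13 9 10 13) (P 4 11 (F2 4 5 13 11 12 13) (Q 0 (F1 0 1 13)
(Q 2 (F1 2 3 13) (Q 4 (F1 4 5 13) (E 9 6 (E 0 8 (F2 0 1 8 9 8 6) (E 2 8 (F2 2 3
8 9 8 6) (E 4 8 (F2 4 5 8 9 8 6) (E 0 10 (F2 0 1 10 9 10 6) (E 2 10 (F2 2 3 10
9 10 6) (E 4 10 (F2 4 5 10 9 10 6) (N [:: 0; 2; 4]))))))) (E 0 8 (E 7 5 (F2 0 5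
8 7 8 5) (E 9 5 (F2 0 5 8 9 8 5) (E 7 1 (F2 0 1 8 7 8 1) (E 9 1 (F2 0 1 8 9 8
1) (E 7 12 (F2 0 1 8 7 8 12) (E 9 12 (F2 0 1 8 9 8 12) (P 7 9 (F3 0 1 8 7 8 13
9 10 13) (P 7 11 (F3 0 1 8 7 8 13 11 12 13) (P 9 11 (F3 0 1 8 9 8 13 11 12 13)
(E 11 6 (E 0 10 (F2 0 1 10 11 10 6) (E 7 10 (F3 0 1 8 7 8 10 11 10 6) (H [:: 0;
7; 9]))) (H [:: 0; 2; 4; 7; 9; 11]))))))))))) (E 9 3 (E 2 8 (F2 2 3 8 9 8 3) (E
4 8 (F2 4 3 8 9 8 3) (E 2 10 (F2 2 3 10 9 10 3) (E 4 10 (F2 4 3 10 9 10 3) (E 0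
10 (E 2 5 (F3 0 5 10 2 3 5 9 10 3) (E 4 1 (F3 0 1 10 4 3 1 9 10 3) (H [:: 2;
4]))) (N [:: 0; 2; 4])))))) (E 9 5 (E 4 8 (F2 4 5 8 9 8 5) (E 0 10 (F2 0 5 10 9
10 5) (E 4 10 (F2 4 5 10 9 10 5) (E 9 1 (E 2 8 (F2 2 1 8 9 8 1) (E 2 10 (F2 2 1
10 9 10 1) (N [:: 0; 2; 4]))) (H [:: 0; 9]))))) (E 9 1 (E 0 10 (F2 0 1 10 9 10
1) (H [:: 0; 9])) (H [:: 0; 9]))))))))))))))))))))))))))));
([:: 3], [:: 2; 1], (E 0 6 (F1 0 1 6) (E 2 6 (F1 2 3 6) (E 4 6 (F1 4 5 6) (E 0
10 (F1 0 1 10) (E 2 10 (F1 2 3 10) (E 4 10 (F1 4 5 10) (E 0 11 (F1 0 1 11) (E 2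
11 (F1 2 3 11) (E 4 11 (F1 4 5 11) (E 0 13 (F1 0 1 13) (E 2 13 (F1 2 3 13) (E 4
13 (F1 4 5 13) (P 0 2 (F2 0 1 14 2 3 14) (P 0 4 (F2 0 1 14 4 5 14) (P 0 7 (F2 0
1 14 7 8 14) (P 2 7 (F2 2 3 14 7 8 14) (Q 0 (F1 0 1 14) (Q 2 (F1 2 3 14) (Q 4
(F1 4 5 14) (E 7 5 (E 0 8 (F2 0 5 8 7 8 5) (E 4 8 (F2 4 5 8 7 8 5) (E 2 8 (E 4
1 (F3 2 1 8 4 5 1 7 8 5) (E 0 3 (F3 0 5 3 2 3 8 7 8 5) (H [:: 0; 4]))) (N [::
0; 2; 4])))) (E 7 1 (E 0 8 (F2 0 1 8 7 8 1) (E 2 8 (F2 2 1 8 7 8 1) (E 4 8 (E 2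
5 (F3 2 1 5 4 5 8 7 8 1) (E 0 3 (F3 0 1 3 4 3 8 7 8 1) (H [:: 0; 2]))) (N [::
0; 2; 4])))) (E 7 3 (E 2 8 (F2 2 3 8 7 8 3) (H [:: 2; 7])) (H [:: 0;
7]))))))))))))))))))))))));
([:: 3], [:: 1; 1; 1], (E 0 6 (F1 0 1 6) (E 2 6 (F1 2 3 6) (E 4 6 (F1 4 5 6) (E
0 8 (F1 0 1 8) (E 2 8 (F1 2 3 8) (E 4 8 (F1 4 5 8) (E 0 9 (F1 0 1 9) (E 2 9 (F1
2 3 9) (E 4 9 (F1 4 5 9) (E 0 11 (F1 0 1 11) (E 2 11 (F1 2 3 11) (E 4 11 (F1 4
5 11) (E 0 12 (F1 0 1 12) (E 2 12 (F1 2 3 12) (E 4 12 (F1 4 5 12) (E 0 14 (F1 0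
1 14) (E 2 14 (F1 2 3 14) (E 4 14 (F1 4 5 14) (Q 0 (F1 0 1 15) (Q 2 (F1 2 3 15)
(Q 4 (F1 4 5 15) (N [:: 0; 2; 4])))))))))))))))))))))));
([:: 4], [:: 2], (E 0 8 (F1 0 1 8) (E 2 8 (F1 2 3 8) (E 4 8 (F1 4 5 8) (E 6 8
(F1 6 7 8) (E 0 12 (F1 0 1 12) (E 2 12 (F1 2 3 12) (E 4 12 (F1 4 5 12) (E 6 12
(F1 6 7 12) (P 0 2 (F2 0 1 13 2 3 13) (P 0 4 (F2 0 1 13 4 5 13) (P 0 6 (F2 0 1
13 6 7 13) (P 0 9 (F2 0 1 13 9 10 13) (P 0 11 (F2 0 1 13 11 12 13) (P 2 4 (F2 2
3 13 4 5 13) (P 2 6 (F2 2 3 13 6 7 13) (P 2 9 (F2 2 3 13 9 10 13) (P 2 11 (F2 2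
3 13 11 12 13) (P 4 6 (F2 4 5 13 6 7 13) (P 4 9 (F2 4 5 13 9 10 13) (P 4 11 (F2
4 5 13 11 12 13) (P 6 9 (F2 6 7 13 9 10 13) (P 6 11 (F2 6 7 13 11 12 13) (Q 0
(F1 0 1 13) (Q 2 (F1 2 3 13) (Q 4 (F1 4 5 13) (Q 6 (F1 6 7 13) (E 11 8 (E 0 10
(F2 0 1 10 11 10 8) (E 2 10 (F2 2 3 10 11 10 8) (E 4 10 (F2 4 5 10 11 10 8) (E
6 10 (F2 6 7 10 11 10 8) (N [:: 0; 2; 4; 6]))))) (P 9 11 (E 0 10 (F3 0 1 10 9
10 13 11 12 13) (E 2 10 (F3 2 3 10 9 10 13 11 12 13) (E 4 10 (F3 4 5 10 9 10 13
11 12 13) (E 6 10 (F3 6 7 10 9 10 13 11 12 13) (N [:: 0; 2; 4; 6]))))) (E 9 12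
(E 0 10 (F2 0 1 10 9 10 12) (E 2 10 (F2 2 3 10 9 10 12) (E 4 10 (F2 4 5 10 9 10
12) (E 6 10 (F2 6 7 10 9 10 12) (N [:: 0; 2; 4; 6]))))) (H [:: 0; 2; 4; 6; 9;
11])))))))))))))))))))))))))))))));
([:: 4], [:: 1; 1], (E 0 8 (F1 0 1 8) (E 2 8 (F1 2 3 8) (E 4 8 (F1 4 5 8) (E 6
8 (F1 6 7 8) (E 0 10 (F1 0 1 10) (E 2 10 (F1 2 3 10) (E 4 10 (F1 4 5 10) (E 6
10 (F1 6 7 10) (E 0 11 (F1 0 1 11) (E 2 11 (F1 2 3 11) (E 4 11 (F1 4 5 11) (E 6
11 (F1 6 7 11) (E 0 13 (F1 0 1 13) (E 2 13 (F1 2 3 13) (E 4 13 (F1 4 5 13) (E 6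
13 (F1 6 7 13) (Q 0 (F1 0 1 14) (Q 2 (F1 2 3 14) (Q 4 (F1 4 5 14) (Q 6 (F1 6 7
14) (N [:: 0; 2; 4; 6]))))))))))))))))))))));
([:: 2; 2], [:: 2], (E 0 8 (F1 0 1 8) (E 2 8 (F1 2 3 8) (E 4 8 (F1 4 5 8) (E 6
8 (F1 6 7 8) (E 0 12 (F1 0 1 12) (E 2 12 (F1 2 3 12) (E 4 12 (F1 4 5 12) (E 6
12 (F1 6 7 12) (P 0 2 (F2 0 1 13 2 3 13) (P 0 4 (F2 0 1 13 4 5 13) (P 0 6 (F2 0
1 13 6 7 13) (P 0 9 (F2 0 1 13 9 10 13) (P 0 11 (F2 0 1 13 11 12 13) (P 2 4 (F2
2 3 13 4 5 13) (P 2 6 (F2 2 3 13 6 7 13) (P 2 9 (F2 2 3 13 9 10 13) (P 2 11 (F2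
2 3 13 11 12 13) (P 4 6 (F2 4 5 13 6 7 13) (P 4 9 (F2 4 5 13 9 10 13) (P 4 11
(F2 4 5 13 11 12 13) (P 6 9 (F2 6 7 13 9 10 13) (P 6 11 (F2 6 7 13 11 12 13) (Q
0 (F1 0 1 13) (Q 2 (F1 2 3 13) (Q 4 (F1 4 5 13) (Q 6 (F1 6 7 13) (E 11 8 (E 0
10 (F2 0 1 10 11 10 8) (E 2 10 (F2 2 3 10 11 10 8) (E 4 10 (F2 4 5 10 11 10 8)
(E 6 10 (F2 6 7 10 11 10 8) (N [:: 0; 2; 4; 6]))))) (P 9 11 (E 0 10 (F3 0 1 10
9 10 13 11 12 13) (E 2 10 (F3 2 3 10 9 10 13 11 12 13) (E 4 10 (F3 4 5 10 9 10
13 11 12 13) (E 6 10 (F3 6 7 10 9 10 13 11 12 13) (N [:: 0; 2; 4; 6]))))) (E 9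
12 (E 0 10 (F2 0 1 10 9 10 12) (E 2 10 (F2 2 3 10 9 10 12) (E 4 10 (F2 4 5 10 9
10 12) (E 6 10 (F2 6 7 10 9 10 12) (N [:: 0; 2; 4; 6]))))) (H [:: 0; 2; 4; 6;
9; 11])))))))))))))))))))))))))))))));
([:: 2; 2], [:: 1; 1], (E 0 8 (F1 0 1 8) (E 2 8 (F1 2 3 8) (E 4 8 (F1 4 5 8) (E
6 8 (F1 6 7 8) (E 0 10 (F1 0 1 10) (E 2 10 (F1 2 3 10) (E 4 10 (F1 4 5 10) (E 6
10 (F1 6 7 10) (E 0 11 (F1 0 1 11) (E 2 11 (F1 2 3 11) (E 4 11 (F1 4 5 11) (E 6
11 (F1 6 7 11) (E 0 13 (F1 0 1 13) (E 2 13 (F1 2 3 13) (E 4 13 (F1 4 5 13) (E 6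
13 (F1 6 7 13) (Q 0 (F1 0 1 14) (Q 2 (F1 2 3 14) (Q 4 (F1 4 5 14) (Q 6 (F1 6 7
14) (N [:: 0; 2; 4; 6]))))))))))))))))))))));
([:: 5], [:: 1], (E 0 10 (F1 0 1 10) (E 2 10 (F1 2 3 10) (E 4 10 (F1 4 5 10) (E
6 10 (F1 6 7 10) (E 8 10 (F1 8 9 10) (E 0 12 (F1 0 1 12) (E 2 12 (F1 2 3 12) (E
4 12 (F1 4 5 12) (E 6 12 (F1 6 7 12) (E 8 12 (F1 8 9 12) (Q 0 (F1 0 1 13) (Q 2
(F1 2 3 13) (Q 4 (F1 4 5 13) (Q 6 (F1 6 7 13) (Q 8 (F1 8 9 13) (N [:: 0; 2; 4;
6; 8])))))))))))))))));
([:: 3; 2], [:: 1], (E 0 10 (F1 0 1 10) (E 2 10 (F1 2 3 10) (E 4 10 (F1 4 5 10)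
(E 6 10 (F1 6 7 10) (E 8 10 (F1 8 9 10) (E 0 12 (F1 0 1 12) (E 2 12 (F1 2 3 12)
(E 4 12 (F1 4 5 12) (E 6 12 (F1 6 7 12) (E 8 12 (F1 8 9 12) (Q 0 (F1 0 1 13) (Q
2 (F1 2 3 13) (Q 4 (F1 4 5 13) (Q 6 (F1 6 7 13) (Q 8 (F1 8 9 13) (N [:: 0; 2;
4; 6; 8])))))))))))))))));
([:: 6], [::], (Q 0 (F1 0 1 12) (Q 2 (F1 2 3 12) (Q 4 (F1 4 5 12) (Q 6 (F1 6 7
12) (Q 8 (F1 8 9 12) (Q 10 (F1 10 11 12) (N [:: 0; 2; 4; 6; 8; 10]))))))));
([:: 4; 2], [::], (Q 0 (F1 0 1 12) (Q 2 (F1 2 3 12) (Q 4 (F1 4 5 12) (Q 6 (F1 6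
7 12) (Q 8 (F1 8 9 12) (Q 10 (F1 10 11 12) (N [:: 0; 2; 4; 6; 8; 10]))))))));
([:: 3; 3], [::], (Q 0 (F1 0 1 12) (Q 2 (F1 2 3 12) (Q 4 (F1 4 5 12) (Q 6 (F1 6
7 12) (Q 8 (F1 8 9 12) (Q 10 (F1 10 11 12) (N [:: 0; 2; 4; 6; 8; 10]))))))));
([:: 2; 2; 2], [::], (Q 0 (F1 0 1 12) (Q 2 (F1 2 3 12) (Q 4 (F1 4 5 12) (Q 6
(F1 6 7 12) (Q 8 (F1 8 9 12) (Q 10 (F1 10 11 12) (N [:: 0; 2; 4; 6; 8;
10]))))))));
([:: 2], [:: 5], (E 0 4 (F1 0 1 4) (E 2 4 (F1 2 3 4) (E 0 14 (F1 0 1 14) (E 2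
14 (F1 2 3 14) (P 0 5 (F2 0 1 15 5 6 15) (P 0 7 (F2 0 1 15 7 8 15) (P 0 9 (F2 0
1 15 9 10 15) (P 0 11 (F2 0 1 15 11 12 15) (P 0 13 (F2 0 1 15 13 14 15) (Q 0
(F1 0 1 15) (Q 2 (F1 2 3 15) (P 7 11 (E 0 6 (F3 0 1 6 7 6 15 11 10 15) (E 2 6
(F3 2 3 6 7 6 15 11 10 15) (E 0 8 (F3 0 1 8 7 8 15 11 12 15) (E 2 8 (F3 2 3 8 7
8 15 11 12 15) (E 0 10 (F3 0 1 10 7 8 15 11 10 15) (E 2 10 (F3 2 3 10 7 8 15 11
10 15) (E 0 12 (F3 0 1 12 7 8 15 11 12 15) (E 2 12 (F3 2 3 12 7 8 15 11 12 15)
(N [:: 0; 2]))))))))) (E 0 6 (E 5 3 (F2 0 3 6 5 6 3) (E 7 3 (F2 0 3 6 7 6 3) (E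
5 1 (F2 0 1 6 5 6 1) (E 7 1 (F2 0 1 6 7 6 1) (E 7 4 (F2 0 1 6 7 6 4) (E 5 14
(F2 0 1 6 5 6 14) (P 5 7 (F3 0 1 6 5 6 15 7 8 15) (P 5 9 (F3 0 1 6 5 6 15 9 10
15) (P 5 11 (F3 0 1 6 5 6 15 11 12 15) (P 5 13 (F3 0 1 6 5 6 15 13 14 15) (P 7
9 (F3 0 1 6 7 6 15 9 8 15) (P 7 13 (F3 0 1 6 7 6 15 13 12 15) (E 9 3 (E 0 8 (F2
0 3 8 9 8 3) (E 0 10 (F2 0 3 10 9 10 3) (E 5 8 (F3 0 3 6 5 6 8 9 8 3) (E 7 10
(F3 0 3 6 7 6 10 9 10 3) (E 7 14 (F3 0 3 6 7 6 14 9 10 3) (H [:: 0; 5; 7]))))))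
(E 11 3 (E 0 10 (F2 0 3 10 11 10 3) (E 0 12 (F2 0 3 12 11 12 3) (E 5 10 (F3 0 3
6 5 6 10 11 10 3) (E 7 12 (F3 0 3 6 7 6 12 11 12 3) (E 7 14 (F3 0 3 6 7 6 14 11
12 3) (H [:: 0; 5; 7])))))) (E 9 1 (E 0 8 (F2 0 1 8 9 8 1) (E 0 10 (F2 0 1 10 9
10 1) (E 5 8 (F3 0 1 6 5 6 8 9 8 1) (E 7 10 (F3 0 1 6 7 6 10 9 10 1) (E 7 14
(F3 0 1 6 7 6 14 9 10 1) (H [:: 0; 5; 7])))))) (E 11 1 (E 0 10 (F2 0 1 10 11 10
1) (E 0 12 (F2 0 1 12 11 12 1) (E 5 10 (F3 0 1 6 5 6 10 11 10 1) (E 7 12 (F3 0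
1 6 7 6 12 11 12 1) (E 7 14 (F3 0 1 6 7 6 14 11 12 1) (H [:: 0; 5; 7])))))) (E
9 4 (E 0 8 (F2 0 1 8 9 8 4) (E 5 8 (F3 0 1 6 5 6 8 9 8 4) (E 5 10 (F3 0 1 6 5 6
10 9 10 4) (E 7 10 (F3 0 1 6 7 6 10 9 10 4) (E 7 14 (F3 0 1 6 7 6 14 9 10 4) (H
[:: 0; 5; 7])))))) (E 13 3 (E 0 12 (F2 0 3 12 13 12 3) (E 5 12 (F3 0 3 6 5 6 12
13 12 3) (E 7 14 (F3 0 3 6 7 6 14 13 14 3) (E 7 12 (E 0 8 (F3 0 3 8 7 8 12 13
12 3) (E 0 10 (E 9 14 (F2 0 1 10 9 10 14) (E 9 12 (F3 0 3 10 9 10 12 13 12 3)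
(H [:: 0; 5; 7; 9]))) (H [:: 0; 5]))) (H [:: 0; 5; 7; 9]))))) (E 13 1 (E 0 12
(F2 0 1 12 13 12 1) (E 5 12 (F3 0 1 6 5 6 12 13 12 1) (E 7 14 (F3 0 1 6 7 6 14
13 14 1) (E 7 12 (E 0 8 (F3 0 1 8 7 8 12 13 12 1) (E 0 10 (E 9 14 (F2 0 1 10 9
10 14) (E 9 12 (F3 0 1 10 9 10 12 13 12 1) (H [:: 0; 5; 7; 9]))) (H [:: 0;
5]))) (H [:: 0; 5; 7; 9]))))) (E 11 4 (E 0 10 (F2 0 1 10 11 10 4) (E 5 10 (F3 0
1 6 5 6 10 11 10 4) (E 5 12 (F3 0 1 6 5 6 12 11 12 4) (E 7 12 (F3 0 1 6 7 6 12
11 12 4) (E 7 14 (F3 0 1 6 7 6 14 11 12 4) (H [:: 0; 5; 7])))))) (E 13 4 (E 0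
12 (F2 0 1 12 13 12 4) (E 5 12 (F3 0 1 6 5 6 12 13 12 4) (E 7 14 (F3 0 1 6 7 6
14 13 14 4) (E 7 12 (E 0 8 (F3 0 1 8 7 8 12 13 12 4) (E 0 10 (E 9 14 (F2 0 1 10
9 10 14) (E 9 12 (F3 0 1 10 9 10 12 13 12 4) (H [:: 0; 5; 7; 9]))) (H [:: 0;
5]))) (H [:: 0; 5; 7; 9]))))) (E 0 8 (E 7 14 (F2 0 1 8 7 8 14) (P 9 11 (F3 0 1
8 9 8 15 11 10 15) (E 9 14 (E 0 10 (F2 0 1 10 9 10 14) (E 5 10 (F3 0 1 6 5 6 10
9 10 14) (E 7 10 (F3 0 1 8 7 8 10 9 10 14) (H [:: 0; 5; 7; 9])))) (H [:: 0; 5;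
7; 9; 11])))) (E 0 10 (P 9 11 (F3 0 1 10 9 10 15 11 12 15) (P 9 13 (F3 0 1 10 9
10 15 13 14 15) (P 11 13 (F3 0 1 10 11 10 15 13 12 15) (H [:: 0; 5; 7; 9; 11;
13])))) (E 0 12 (P 9 11 (F3 0 1 12 9 10 15 11 12 15) (P 9 13 (F3 0 1 12 9 10 15
13 12 15) (P 11 13 (F3 0 1 12 11 12 15 13 14 15) (H [:: 0; 5; 7; 9; 11; 13]))))
(H [:: 0; 5]))))))))))))))))))))))))) (P 9 11 (E 0 8 (F3 0 1 8 9 8 15 11 10 15)
(E 2 8 (F3 2 3 8 9 8 15 11 10 15) (E 0 10 (F3 0 1 10 9 10 15 11 12 15) (E 2 10
(F3 2 3 10 9 10 15 11 12 15) (E 0 12 (F3 0 1 12 9 10 15 11 12 15) (E 2 12 (F3 2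
3 12 9 10 15 11 12 15) (E 2 6 (E 5 3 (F2 2 3 6 5 6 3) (E 5 1 (F2 2 1 6 5 6 1)
(E 5 14 (F2 2 3 6 5 6 14) (H [:: 0; 5])))) (N [:: 0; 2])))))))) (P 9 13 (E 0 8
(F3 0 1 8 9 8 15 13 12 15) (E 2 8 (F3 2 3 8 9 8 15 13 12 15) (E 0 10 (F3 0 1 10
9 10 15 13 14 15) (E 2 10 (F3 2 3 10 9 10 15 13 14 15) (E 0 12 (F3 0 1 12 9 10
15 13 12 15) (E 2 12 (F3 2 3 12 9 10 15 13 12 15) (E 2 6 (E 5 3 (F2 2 3 6 5 6
3) (E 5 1 (F2 2 1 6 5 6 1) (E 5 14 (F2 2 3 6 5 6 14) (H [:: 0; 5])))) (N [:: 0;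
2])))))))) (E 2 6 (E 5 3 (F2 2 3 6 5 6 3) (E 7 3 (F2 2 3 6 7 6 3) (E 5 1 (F2 2
1 6 5 6 1) (E 7 1 (F2 2 1 6 7 6 1) (E 7 4 (F2 2 3 6 7 6 4) (E 5 14 (F2 2 3 6 5
6 14) (P 5 7 (F3 2 3 6 5 6 15 7 8 15) (P 5 9 (F3 2 3 6 5 6 15 9 10 15) (P 5 11
(F3 2 3 6 5 6 15 11 12 15) (P 7 9 (F3 2 3 6 7 6 15 9 8 15) (E 0 10 (E 9 3 (F2 0
3 10 9 10 3) (E 11 3 (F2 0 3 10 11 10 3) (E 9 1 (F2 0 1 10 9 10 1) (E 11 1 (F2
0 1 10 11 10 1) (E 11 4 (F2 0 1 10 11 10 4) (E 9 14 (F2 0 1 10 9 10 14) (E 9 4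
(E 0 8 (F2 0 1 8 9 8 4) (E 5 8 (F3 2 3 6 5 6 8 9 8 4) (E 5 10 (F3 2 3 6 5 6 10
9 10 4) (H [:: 0; 5])))) (E 7 14 (E 0 8 (F2 0 1 8 7 8 14) (E 5 8 (F3 2 3 6 5 6
8 7 8 14) (E 9 6 (F3 0 1 10 7 6 14 9 10 6) (H [:: 0; 5; 9])))) (H [:: 0; 5; 7;
9; 11]))))))))) (E 0 8 (E 9 3 (F2 0 3 8 9 8 3) (E 9 1 (F2 0 1 8 9 8 1) (E 9 4
(F2 0 1 8 9 8 4) (E 7 14 (F2 0 1 8 7 8 14) (E 0 12 (E 11 3 (F2 0 3 12 11 12 3)
(E 11 1 (F2 0 1 12 11 12 1) (E 11 14 (F2 0 1 12 11 12 14) (E 5 12 (E 11 4 (F3 2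
3 6 5 6 12 11 12 4) (H [:: 0; 5; 7; 9; 11])) (H [:: 0; 5]))))) (H [:: 0;
5])))))) (H [:: 0; 5]))))))))))))) (E 0 8 (E 7 3 (F2 0 3 8 7 8 3) (E 9 3 (F2 0
3 8 9 8 3) (E 7 1 (F2 0 1 8 7 8 1) (E 9 1 (F2 0 1 8 9 8 1) (E 9 4 (F2 0 1 8 9 8
4) (E 7 14 (F2 0 1 8 7 8 14) (P 5 7 (F3 0 1 8 5 6 15 7 8 15) (P 5 9 (F3 0 1 8 5
6 15 9 8 15) (P 7 9 (F3 0 1 8 7 8 15 9 10 15) (P 7 13 (F3 0 1 8 7 8 15 13 14
15) (E 0 10 (E 11 3 (F2 0 3 10 11 10 3) (E 11 1 (F2 0 1 10 11 10 1) (E 11 4 (F2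
0 1 10 11 10 4) (E 9 14 (F2 0 1 10 9 10 14) (P 5 11 (F3 0 1 10 5 6 15 11 10 15)
(E 9 6 (E 5 3 (F3 0 3 8 5 6 3 9 8 6) (E 5 1 (F3 0 1 8 5 6 1 9 8 6) (E 7 4 (F3 0
1 8 7 6 4 9 8 6) (E 5 14 (F3 0 1 8 5 6 14 9 8 6) (H [:: 0; 5; 7; 9; 11]))))) (E
11 6 (E 5 3 (F3 0 3 10 5 6 3 11 10 6) (E 5 1 (F3 0 1 10 5 6 1 11 10 6) (E 7 4
(F3 0 1 10 7 6 4 11 10 6) (E 5 14 (F3 0 1 10 5 6 14 11 10 6) (H [:: 0; 5; 7; 9;
11]))))) (H [:: 0; 7; 9; 11])))))))) (E 0 12 (E 11 3 (F2 0 3 12 11 12 3) (E 13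
3 (F2 0 3 12 13 12 3) (E 11 1 (F2 0 1 12 11 12 1) (E 13 1 (F2 0 1 12 13 12 1)
(E 13 4 (F2 0 1 12 13 12 4) (E 11 14 (F2 0 1 12 11 12 14) (P 11 13 (F3 0 1 12
11 12 15 13 14 15) (E 7 12 (E 11 4 (F3 0 1 8 7 8 12 11 12 4) (E 11 8 (E 9 14
(F3 0 1 12 9 8 14 11 12 8) (H [:: 0; 7; 9; 11; 13])) (H [:: 0; 11]))) (H [:: 0;
7]))))))))) (H [:: 0; 7]))))))))))))) (E 11 3 (E 0 10 (F2 0 3 10 11 10 3) (E 2
10 (F2 2 3 10 11 10 3) (E 0 12 (F2 0 3 12 11 12 3) (E 2 12 (F2 2 3 12 11 12 3)
(E 2 8 (E 7 3 (F2 2 3 8 7 8 3) (E 7 1 (F2 2 1 8 7 8 1) (E 7 14 (F2 2 3 8 7 8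
14) (E 7 10 (F3 2 3 8 7 8 10 11 10 3) (H [:: 0; 7]))))) (N [:: 0; 2])))))) (E
11 1 (E 0 10 (F2 0 1 10 11 10 1) (E 0 12 (F2 0 1 12 11 12 1) (H [:: 0; 11])))
(E 0 10 (E 9 3 (F2 0 3 10 9 10 3) (E 9 1 (F2 0 1 10 9 10 1) (E 11 4 (F2 0 1 10
11 10 4) (E 9 14 (F2 0 1 10 9 10 14) (P 7 9 (F3 0 1 10 7 8 15 9 10 15) (P 11 13
(F3 0 1 10 11 10 15 13 12 15) (E 0 12 (E 13 3 (F2 0 3 12 13 12 3) (E 13 1 (F2 0
1 12 13 12 1) (E 13 4 (F2 0 1 12 13 12 4) (E 11 14 (F2 0 1 12 11 12 14) (P 7 13
(F3 0 1 12 7 8 15 13 12 15) (E 9 6 (E 7 3 (F3 0 3 10 7 6 3 9 10 6) (E 7 1 (F3 0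
1 10 7 6 1 9 10 6) (E 7 14 (F3 0 1 10 7 6 14 9 10 6) (E 7 4 (E 11 6 (F3 0 1 10
7 6 4 11 10 6) (E 13 6 (F3 0 1 12 7 6 4 13 12 6) (H [:: 0; 7; 11; 13]))) (H [::
0; 7; 9; 11; 13]))))) (E 11 8 (E 7 3 (F3 0 3 10 7 8 3 11 10 8) (E 7 1 (F3 0 1
10 7 8 1 11 10 8) (E 9 4 (F3 0 1 10 9 8 4 11 10 8) (E 7 14 (F3 0 1 10 7 8 14 11
10 8) (H [:: 0; 7; 9; 11; 13]))))) (H [:: 0; 9; 11])))))))) (H [:: 0;
9])))))))) (H [:: 0; 11]))))))))))))))))))))));
([:: 2], [:: 4; 1], (E 0 4 (F1 0 1 4) (E 2 4 (F1 2 3 4) (E 0 12 (F1 0 1 12) (E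
2 12 (F1 2 3 12) (E 0 13 (F1 0 1 13) (E 2 13 (F1 2 3 13) (E 0 15 (F1 0 1 15) (E
2 15 (F1 2 3 15) (P 0 5 (F2 0 1 16 5 6 16) (P 0 7 (F2 0 1 16 7 8 16) (P 0 9 (F2
0 1 16 9 10 16) (P 0 11 (F2 0 1 16 11 12 16) (Q 0 (F1 0 1 16) (Q 2 (F1 2 3 16)
(P 5 9 (E 0 6 (F3 0 1 6 5 6 16 9 10 16) (E 2 6 (F3 2 3 6 5 6 16 9 10 16) (E 0 8
(F3 0 1 8 5 6 16 9 8 16) (E 2 8 (F3 2 3 8 5 6 16 9 8 16) (E 0 10 (F3 0 1 10 5 6
16 9 10 16) (E 2 10 (F3 2 3 10 5 6 16 9 10 16) (N [:: 0; 2]))))))) (P 7 9 (E 0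
6 (F3 0 1 6 7 6 16 9 8 16) (E 2 6 (F3 2 3 6 7 6 16 9 8 16) (E 0 8 (F3 0 1 8 7 8
16 9 10 16) (E 2 8 (F3 2 3 8 7 8 16 9 10 16) (E 0 10 (F3 0 1 10 7 8 16 9 10 16)
(E 2 10 (F3 2 3 10 7 8 16 9 10 16) (N [:: 0; 2]))))))) (P 7 11 (E 0 6 (F3 0 1 6
7 6 16 11 10 16) (E 2 6 (F3 2 3 6 7 6 16 11 10 16) (E 0 8 (F3 0 1 8 7 8 16 11
12 16) (E 2 8 (F3 2 3 8 7 8 16 11 12 16) (E 0 10 (F3 0 1 10 7 8 16 11 10 16) (E
2 10 (F3 2 3 10 7 8 16 11 10 16) (N [:: 0; 2]))))))) (E 0 6 (E 5 3 (F2 0 3 6 5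
6 3) (E 7 3 (F2 0 3 6 7 6 3) (E 5 1 (F2 0 1 6 5 6 1) (E 7 1 (F2 0 1 6 7 6 1) (E
7 4 (F2 0 1 6 7 6 4) (E 5 12 (F2 0 1 6 5 6 12) (E 5 13 (F2 0 1 6 5 6 13) (E 7
13 (F2 0 1 6 7 6 13) (E 5 15 (F2 0 1 6 5 6 15) (E 7 15 (F2 0 1 6 7 6 15) (P 5 7
(F3 0 1 6 5 6 16 7 8 16) (E 0 8 (E 9 3 (F2 0 3 8 9 8 3) (E 9 1 (F2 0 1 8 9 8 1)
(E 9 4 (F2 0 1 8 9 8 4) (E 7 12 (F2 0 1 8 7 8 12) (E 9 13 (F2 0 1 8 9 8 13) (E
9 15 (F2 0 1 8 9 8 15) (H [:: 0; 5; 7; 9]))))))) (E 0 10 (E 9 3 (F2 0 3 10 9 10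
3) (E 9 1 (F2 0 1 10 9 10 1) (E 9 12 (F2 0 1 10 9 10 12) (E 9 13 (F2 0 1 10 9
10 13) (E 9 15 (F2 0 1 10 9 10 15) (E 5 10 (E 9 4 (F3 0 1 6 5 6 10 9 10 4) (H
[:: 0; 5; 7; 9])) (H [:: 0; 5]))))))) (H [:: 0; 5])))))))))))))) (E 9 3 (E 0 8
(F2 0 3 8 9 8 3) (E 2 8 (F2 2 3 8 9 8 3) (E 0 10 (F2 0 3 10 9 10 3) (E 2 10 (F2
2 3 10 9 10 3) (E 2 6 (E 5 3 (F2 2 3 6 5 6 3) (E 5 1 (F2 2 1 6 5 6 1) (E 5 12
(F2 2 3 6 5 6 12) (E 5 13 (F2 2 3 6 5 6 13) (E 5 15 (F2 2 3 6 5 6 15) (E 5 8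
(F3 2 3 6 5 6 8 9 8 3) (H [:: 0; 5]))))))) (N [:: 0; 2])))))) (E 9 1 (E 0 8 (F2
0 1 8 9 8 1) (E 0 10 (F2 0 1 10 9 10 1) (H [:: 0; 9]))) (E 0 8 (E 7 3 (F2 0 3 8
7 8 3) (E 7 1 (F2 0 1 8 7 8 1) (E 9 4 (F2 0 1 8 9 8 4) (E 7 12 (F2 0 1 8 7 8
12) (E 7 13 (F2 0 1 8 7 8 13) (E 9 13 (F2 0 1 8 9 8 13) (E 7 15 (F2 0 1 8 7 8
15) (E 9 15 (F2 0 1 8 9 8 15) (P 9 11 (F3 0 1 8 9 8 16 11 10 16) (E 0 10 (E 11
3 (F2 0 3 10 11 10 3) (E 11 1 (F2 0 1 10 11 10 1) (E 11 4 (F2 0 1 10 11 10 4)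
(E 9 12 (F2 0 1 10 9 10 12) (E 11 13 (F2 0 1 10 11 10 13) (E 11 15 (F2 0 1 10
11 10 15) (H [:: 0; 7; 9; 11]))))))) (H [:: 0; 7]))))))))))) (H [:: 0;
9])))))))))))))))))))))));
([:: 2], [:: 3; 2], (E 0 4 (F1 0 1 4) (E 2 4 (F1 2 3 4) (E 0 10 (F1 0 1 10) (E
2 10 (F1 2 3 10) (E 0 11 (F1 0 1 11) (E 2 11 (F1 2 3 11) (E 0 15 (F1 0 1 15) (E
2 15 (F1 2 3 15) (P 0 5 (F2 0 1 16 5 6 16) (P 0 7 (F2 0 1 16 7 8 16) (P 0 9 (F2
0 1 16 9 10 16) (P 0 12 (F2 0 1 16 12 13 16) (Q 0 (F1 0 1 16) (Q 2 (F1 2 3 16)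
(P 7 12 (E 0 6 (F3 0 1 6 7 6 16 12 13 16) (E 2 6 (F3 2 3 6 7 6 16 12 13 16) (E
0 8 (F3 0 1 8 7 8 16 12 13 16) (E 2 8 (F3 2 3 8 7 8 16 12 13 16) (E 0 13 (F3 0
1 13 7 8 16 12 13 16) (E 2 13 (F3 2 3 13 7 8 16 12 13 16) (N [:: 0; 2])))))))
(E 0 6 (E 5 3 (F2 0 3 6 5 6 3) (E 7 3 (F2 0 3 6 7 6 3) (E 5 1 (F2 0 1 6 5 6 1)
(E 7 1 (F2 0 1 6 7 6 1) (E 7 4 (F2 0 1 6 7 6 4) (E 5 10 (F2 0 1 6 5 6 10) (E 5
11 (F2 0 1 6 5 6 11) (E 7 11 (F2 0 1 6 7 6 11) (E 5 15 (F2 0 1 6 5 6 15) (E 7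
15 (F2 0 1 6 7 6 15) (P 5 7 (F3 0 1 6 5 6 16 7 8 16) (P 5 9 (F3 0 1 6 5 6 16 9
10 16) (P 5 12 (F3 0 1 6 5 6 16 12 13 16) (P 7 9 (F3 0 1 6 7 6 16 9 8 16) (E 0
8 (E 9 3 (F2 0 3 8 9 8 3) (E 9 1 (F2 0 1 8 9 8 1) (E 9 4 (F2 0 1 8 9 8 4) (E 7
10 (F2 0 1 8 7 8 10) (E 9 11 (F2 0 1 8 9 8 11) (E 9 15 (F2 0 1 8 9 8 15) (H [::
0; 5; 7; 9]))))))) (E 0 13 (E 12 3 (F2 0 3 13 12 13 3) (E 12 1 (F2 0 1 13 12 13
1) (E 12 4 (F2 0 1 13 12 13 4) (E 12 10 (F2 0 1 13 12 13 10) (E 12 15 (F2 0 1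
13 12 13 15) (H [:: 0; 5; 7; 12])))))) (H [:: 0; 5]))))))))))))))))) (E 2 6 (E
5 3 (F2 2 3 6 5 6 3) (E 7 3 (F2 2 3 6 7 6 3) (E 5 1 (F2 2 1 6 5 6 1) (E 7 1 (F2
2 1 6 7 6 1) (E 7 4 (F2 2 3 6 7 6 4) (E 5 10 (F2 2 3 6 5 6 10) (E 5 11 (F2 2 3
6 5 6 11) (E 7 11 (F2 2 3 6 7 6 11) (E 5 15 (F2 2 3 6 5 6 15) (E 7 15 (F2 2 3 6
7 6 15) (P 5 7 (F3 2 3 6 5 6 16 7 8 16) (P 5 9 (F3 2 3 6 5 6 16 9 10 16) (P 7 9
(F3 2 3 6 7 6 16 9 8 16) (E 0 8 (E 9 3 (F2 0 3 8 9 8 3) (E 9 1 (F2 0 1 8 9 8 1)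
(E 9 4 (F2 0 1 8 9 8 4) (E 7 10 (F2 0 1 8 7 8 10) (E 9 11 (F2 0 1 8 9 8 11) (E
9 15 (F2 0 1 8 9 8 15) (H [:: 0; 5; 7; 9]))))))) (H [:: 0; 5]))))))))))))))) (E
0 8 (E 7 3 (F2 0 3 8 7 8 3) (E 9 3 (F2 0 3 8 9 8 3) (E 7 1 (F2 0 1 8 7 8 1) (E
9 1 (F2 0 1 8 9 8 1) (E 9 4 (F2 0 1 8 9 8 4) (E 7 10 (F2 0 1 8 7 8 10) (E 7 11
(F2 0 1 8 7 8 11) (E 9 11 (F2 0 1 8 9 8 11) (E 7 15 (F2 0 1 8 7 8 15) (E 9 15
(F2 0 1 8 9 8 15) (P 7 9 (F3 0 1 8 7 8 16 9 10 16) (P 9 12 (F3 0 1 8 9 8 16 12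
13 16) (E 0 13 (E 12 3 (F2 0 3 13 12 13 3) (E 12 1 (F2 0 1 13 12 13 1) (E 12 4
(F2 0 1 13 12 13 4) (E 12 10 (F2 0 1 13 12 13 10) (E 12 15 (F2 0 1 13 12 13 15)
(H [:: 0; 7; 9; 12])))))) (H [:: 0; 7])))))))))))))) (E 12 3 (E 0 13 (F2 0 3 13
12 13 3) (E 2 13 (F2 2 3 13 12 13 3) (E 2 8 (E 7 3 (F2 2 3 8 7 8 3) (E 7 1 (F2
2 1 8 7 8 1) (E 7 10 (F2 2 3 8 7 8 10) (E 7 11 (F2 2 3 8 7 8 11) (E 7 15 (F2 2
3 8 7 8 15) (E 7 13 (F3 2 3 8 7 8 13 12 13 3) (H [:: 0; 7]))))))) (N [:: 0;
2])))) (E 12 1 (E 0 13 (F2 0 1 13 12 13 1) (H [:: 0; 12])) (H [:: 0;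
12]))))))))))))))))))))));
([:: 2], [:: 3; 1; 1], (E 0 4 (F1 0 1 4) (E 2 4 (F1 2 3 4) (E 0 10 (F1 0 1 10)
(E 2 10 (F1 2 3 10) (E 0 11 (F1 0 1 11) (E 2 11 (F1 2 3 11) (E 0 13 (F1 0 1 13)
(E 2 13 (F1 2 3 13) (E 0 14 (F1 0 1 14) (E 2 14 (F1 2 3 14) (E 0 16 (F1 0 1 16)
(E 2 16 (F1 2 3 16) (P 0 5 (F2 0 1 17 5 6 17) (P 0 7 (F2 0 1 17 7 8 17) (Q 0
(F1 0 1 17) (Q 2 (F1 2 3 17) (E 7 3 (E 0 6 (F2 0 3 6 7 6 3) (E 2 6 (F2 2 3 6 7
6 3) (E 0 8 (F2 0 3 8 7 8 3) (E 2 8 (F2 2 3 8 7 8 3) (N [:: 0; 2]))))) (E 7 1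
(E 0 6 (F2 0 1 6 7 6 1) (E 2 6 (F2 2 1 6 7 6 1) (E 0 8 (F2 0 1 8 7 8 1) (E 2 8
(F2 2 1 8 7 8 1) (N [:: 0; 2]))))) (E 0 6 (E 5 3 (F2 0 3 6 5 6 3) (E 5 1 (F2 0
1 6 5 6 1) (E 7 4 (F2 0 1 6 7 6 4) (E 5 10 (F2 0 1 6 5 6 10) (E 5 11 (F2 0 1 6
5 6 11) (E 7 11 (F2 0 1 6 7 6 11) (E 5 13 (F2 0 1 6 5 6 13) (E 7 13 (F2 0 1 6 7
6 13) (E 5 14 (F2 0 1 6 5 6 14) (E 7 14 (F2 0 1 6 7 6 14) (E 5 16 (F2 0 1 6 5 6
16) (E 7 16 (F2 0 1 6 7 6 16) (P 5 7 (F3 0 1 6 5 6 17 7 8 17) (H [:: 0; 5;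
7])))))))))))))) (H [:: 0; 7])))))))))))))))))))));
([:: 2], [:: 2; 2; 1], (E 0 4 (F1 0 1 4) (E 2 4 (F1 2 3 4) (E 0 8 (F1 0 1 8) (E
2 8 (F1 2 3 8) (E 0 9 (F1 0 1 9) (E 2 9 (F1 2 3 9) (E 0 13 (F1 0 1 13) (E 2 13
(F1 2 3 13) (E 0 14 (F1 0 1 14) (E 2 14 (F1 2 3 14) (E 0 16 (F1 0 1 16) (E 2 16
(F1 2 3 16) (P 0 5 (F2 0 1 17 5 6 17) (P 0 7 (F2 0 1 17 7 8 17) (P 0 10 (F2 0 1
17 10 11 17) (Q 0 (F1 0 1 17) (Q 2 (F1 2 3 17) (E 0 6 (E 5 3 (F2 0 3 6 5 6 3)
(E 7 3 (F2 0 3 6 7 6 3) (E 5 1 (F2 0 1 6 5 6 1) (E 7 1 (F2 0 1 6 7 6 1) (E 7 4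
(F2 0 1 6 7 6 4) (E 5 8 (F2 0 1 6 5 6 8) (E 5 9 (F2 0 1 6 5 6 9) (E 7 9 (F2 0 1
6 7 6 9) (E 5 13 (F2 0 1 6 5 6 13) (E 7 13 (F2 0 1 6 7 6 13) (E 5 14 (F2 0 1 6
5 6 14) (E 7 14 (F2 0 1 6 7 6 14) (E 5 16 (F2 0 1 6 5 6 16) (E 7 16 (F2 0 1 6 7
6 16) (P 5 7 (F3 0 1 6 5 6 17 7 8 17) (H [:: 0; 5; 7])))))))))))))))) (E 10 3
(E 0 11 (F2 0 3 11 10 11 3) (E 2 11 (F2 2 3 11 10 11 3) (E 2 6 (E 5 3 (F2 2 3 6
5 6 3) (E 5 1 (F2 2 1 6 5 6 1) (E 5 8 (F2 2 3 6 5 6 8) (E 5 9 (F2 2 3 6 5 6 9)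
(E 5 13 (F2 2 3 6 5 6 13) (E 5 14 (F2 2 3 6 5 6 14) (E 5 16 (F2 2 3 6 5 6 16)
(E 5 11 (F3 2 3 6 5 6 11 10 11 3) (H [:: 0; 5]))))))))) (N [:: 0; 2])))) (E 10
1 (E 0 11 (F2 0 1 11 10 11 1) (H [:: 0; 10])) (H [:: 0;
10]))))))))))))))))))))));
([:: 2], [:: 2; 1; 1; 1], (E 0 4 (F1 0 1 4) (E 2 4 (F1 2 3 4) (E 0 8 (F1 0 1 8)
(E 2 8 (F1 2 3 8) (E 0 9 (F1 0 1 9) (E 2 9 (F1 2 3 9) (E 0 11 (F1 0 1 11) (E 2
11 (F1 2 3 11) (E 0 12 (F1 0 1 12) (E 2 12 (F1 2 3 12) (E 0 14 (F1 0 1 14) (E 2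
14 (F1 2 3 14) (E 0 15 (F1 0 1 15) (E 2 15 (F1 2 3 15) (E 0 17 (F1 0 1 17) (E 2
17 (F1 2 3 17) (P 0 5 (F2 0 1 18 5 6 18) (Q 0 (F1 0 1 18) (Q 2 (F1 2 3 18) (E 5
3 (E 0 6 (F2 0 3 6 5 6 3) (E 2 6 (F2 2 3 6 5 6 3) (N [:: 0; 2]))) (E 5 1 (E 0 6
(F2 0 1 6 5 6 1) (E 2 6 (F2 2 1 6 5 6 1) (N [:: 0; 2]))) (H [:: 0;
5])))))))))))))))))))))));
([:: 2], [:: 1; 1; 1; 1; 1], (E 0 4 (F1 0 1 4) (E 2 4 (F1 2 3 4) (E 0 6 (F1 0 1
6) (E 2 6 (F1 2 3 6) (E 0 7 (F1 0 1 7) (E 2 7 (F1 2 3 7) (E 0 9 (F1 0 1 9) (E 2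
9 (F1 2 3 9) (E 0 10 (F1 0 1 10) (E 2 10 (F1 2 3 10) (E 0 12 (F1 0 1 12) (E 2
12 (F1 2 3 12) (E 0 13 (F1 0 1 13) (E 2 13 (F1 2 3 13) (E 0 15 (F1 0 1 15) (E 2
15 (F1 2 3 15) (E 0 16 (F1 0 1 16) (E 2 16 (F1 2 3 16) (E 0 18 (F1 0 1 18) (E 2
18 (F1 2 3 18) (Q 0 (F1 0 1 19) (Q 2 (F1 2 3 19) (N [:: 0;
2]))))))))))))))))))))))));
([:: 3], [:: 4], (E 0 6 (F1 0 1 6) (E 2 6 (F1 2 3 6) (E 4 6 (F1 4 5 6) (E 0 14
(F1 0 1 14) (E 2 14 (F1 2 3 14) (E 4 14 (F1 4 5 14) (P 0 2 (F2 0 1 15 2 3 15)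
(P 0 4 (F2 0 1 15 4 5 15) (P 0 7 (F2 0 1 15 7 8 15) (P 0 9 (F2 0 1 15 9 10 15)
(P 0 11 (F2 0 1 15 11 12 15) (P 0 13 (F2 0 1 15 13 14 15) (P 2 4 (F2 2 3 15 4 5
15) (P 2 7 (F2 2 3 15 7 8 15) (P 2 9 (F2 2 3 15 9 10 15) (P 2 11 (F2 2 3 15 11
12 15) (P 2 13 (F2 2 3 15 13 14 15) (P 4 7 (F2 4 5 15 7 8 15) (P 4 9 (F2 4 5 15
9 10 15) (P 4 11 (F2 4 5 15 11 12 15) (P 4 13 (F2 4 5 15 13 14 15) (Q 0 (F1 0 1
15) (Q 2 (F1 2 3 15) (Q 4 (F1 4 5 15) (P 7 11 (E 0 8 (F3 0 1 8 7 8 15 11 12 15)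
(E 2 8 (F3 2 3 8 7 8 15 11 12 15) (E 4 8 (F3 4 5 8 7 8 15 11 12 15) (E 0 10 (F3
0 1 10 7 8 15 11 10 15) (E 2 10 (F3 2 3 10 7 8 15 11 10 15) (E 4 10 (F3 4 5 10
7 8 15 11 10 15) (E 0 12 (F3 0 1 12 7 8 15 11 12 15) (E 2 12 (F3 2 3 12 7 8 15
11 12 15) (E 4 12 (F3 4 5 12 7 8 15 11 12 15) (N [:: 0; 2; 4])))))))))) (P 9 11
(E 0 8 (F3 0 1 8 9 8 15 11 12 15) (E 2 8 (F3 2 3 8 9 8 15 11 12 15) (E 4 8 (F3
4 5 8 9 8 15 11 12 15) (E 0 10 (F3 0 1 10 9 10 15 11 12 15) (E 2 10 (F3 2 3 10
9 10 15 11 12 15) (E 4 10 (F3 4 5 10 9 10 15 11 12 15) (E 0 12 (F3 0 1 12 9 10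
15 11 12 15) (E 2 12 (F3 2 3 12 9 10 15 11 12 15) (E 4 12 (F3 4 5 12 9 10 15 11
12 15) (N [:: 0; 2; 4])))))))))) (P 9 13 (E 0 8 (F3 0 1 8 9 8 15 13 12 15) (E 2
8 (F3 2 3 8 9 8 15 13 12 15) (E 4 8 (F3 4 5 8 9 8 15 13 12 15) (E 0 10 (F3 0 1
10 9 10 15 13 14 15) (E 2 10 (F3 2 3 10 9 10 15 13 14 15) (E 4 10 (F3 4 5 10 9
10 15 13 14 15) (E 0 12 (F3 0 1 12 9 10 15 13 12 15) (E 2 12 (F3 2 3 12 9 10 15
13 12 15) (E 4 12 (F3 4 5 12 9 10 15 13 12 15) (N [:: 0; 2; 4])))))))))) (E 0
10 (E 9 5 (F2 0 5 10 9 10 5) (E 11 5 (F2 0 5 10 11 10 5) (E 9 1 (F2 0 1 10 9 10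
1) (E 11 1 (F2 0 1 10 11 10 1) (E 9 6 (F2 0 1 10 9 10 6) (E 11 6 (F2 0 1 10 11
10 6) (E 9 14 (F2 0 1 10 9 10 14) (E 11 14 (F2 0 1 10 11 10 14) (P 7 9 (F3 0 1
10 7 8 15 9 10 15) (P 11 13 (F3 0 1 10 11 10 15 13 14 15) (E 9 3 (E 2 8 (F2 2 3
8 9 8 3) (E 4 8 (F2 4 3 8 9 8 3) (E 2 10 (F2 2 3 10 9 10 3) (E 4 10 (F2 4 3 10
9 10 3) (E 2 5 (F3 0 5 10 2 3 5 9 10 3) (E 4 1 (F3 0 1 10 4 3 1 9 10 3) (H [::
2; 4; 9]))))))) (E 0 8 (E 7 5 (F2 0 5 8 7 8 5) (E 7 1 (F2 0 1 8 7 8 1) (E 7 14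
(F2 0 1 8 7 8 14) (P 7 13 (F3 0 1 8 7 8 15 13 14 15) (E 13 6 (E 0 12 (F2 0 1 12
13 12 6) (E 7 12 (F3 0 1 8 7 8 12 13 12 6) (E 9 12 (F3 0 1 8 9 8 12 13 12 6) (H
[:: 0; 7; 9; 11])))) (H [:: 0; 2; 4; 7; 9; 11; 13])))))) (E 0 12 (E 13 5 (F2 0
5 12 13 12 5) (E 13 1 (F2 0 1 12 13 12 1) (E 13 6 (F2 0 1 12 13 12 6) (P 7 13
(F3 0 1 12 7 8 15 13 12 15) (E 7 14 (E 11 8 (F3 0 1 10 7 8 14 11 10 8) (E 13 8
(F3 0 1 12 7 8 14 13 12 8) (H [:: 0; 9; 11; 13]))) (H [:: 0; 2; 4; 7; 9; 11;
13])))))) (H [:: 0; 9])))))))))))))) (E 2 10 (E 9 1 (F2 2 1 10 9 10 1) (E 11 1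
(F2 2 1 10 11 10 1) (E 9 3 (F2 2 3 10 9 10 3) (E 9 6 (F2 2 3 10 9 10 6) (E 11 6
(F2 2 3 10 11 10 6) (E 9 14 (F2 2 3 10 9 10 14) (E 11 14 (F2 2 3 10 11 10 14)
(P 7 9 (F3 2 3 10 7 8 15 9 10 15) (P 11 13 (F3 2 3 10 11 10 15 13 14 15) (E 9 5
(E 0 8 (F2 0 5 8 9 8 5) (E 4 8 (F2 4 5 8 9 8 5) (E 4 10 (F2 4 5 10 9 10 5) (E 4
1 (F3 2 1 10 4 5 1 9 10 5) (E 0 3 (F3 0 5 3 2 3 10 9 10 5) (H [:: 0; 4;
9])))))) (E 0 8 (E 7 5 (F2 0 5 8 7 8 5) (E 7 1 (F2 0 1 8 7 8 1) (E 7 14 (F2 0 1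
8 7 8 14) (P 7 13 (F3 0 1 8 7 8 15 13 14 15) (E 0 12 (E 11 5 (F2 0 5 12 11 12
5) (E 13 5 (F2 0 5 12 13 12 5) (E 13 1 (F2 0 1 12 13 12 1) (E 13 6 (F2 0 1 12
13 12 6) (H [:: 0; 7; 9; 11; 13]))))) (H [:: 0; 9])))))) (H [:: 0;
9])))))))))))) (P 7 13 (E 0 8 (F3 0 1 8 7 8 15 13 14 15) (E 2 8 (F3 2 3 8 7 8
15 13 14 15) (E 4 8 (F3 4 5 8 7 8 15 13 14 15) (E 0 12 (F3 0 1 12 7 8 15 13 12
15) (E 2 12 (F3 2 3 12 7 8 15 13 12 15) (E 4 12 (F3 4 5 12 7 8 15 13 12 15) (E
4 10 (E 9 5 (F2 4 5 10 9 10 5) (E 9 3 (F2 4 3 10 9 10 3) (E 9 6 (F2 4 5 10 9 10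
6) (E 9 14 (F2 4 5 10 9 10 14) (H [:: 0; 9]))))) (N [:: 0; 2; 4])))))))) (E 4
10 (E 9 5 (F2 4 5 10 9 10 5) (E 11 5 (F2 4 5 10 11 10 5) (E 9 3 (F2 4 3 10 9 10
3) (E 9 6 (F2 4 5 10 9 10 6) (E 11 6 (F2 4 5 10 11 10 6) (E 9 14 (F2 4 5 10 9
10 14) (E 11 14 (F2 4 5 10 11 10 14) (P 7 9 (F3 4 5 10 7 8 15 9 10 15) (P 11 13
(F3 4 5 10 11 10 15 13 14 15) (E 9 1 (E 0 8 (F2 0 1 8 9 8 1) (E 2 8 (F2 2 1 8 9
8 1) (E 2 5 (F3 2 1 5 4 5 10 9 10 1) (E 0 3 (F3 0 1 3 4 3 10 9 10 1) (H [:: 0;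
2; 9]))))) (E 0 8 (E 7 5 (F2 0 5 8 7 8 5) (E 7 1 (F2 0 1 8 7 8 1) (E 7 14 (F2 0
1 8 7 8 14) (E 0 12 (E 13 5 (F2 0 5 12 13 12 5) (E 11 1 (F2 0 1 12 11 12 1) (E
13 1 (F2 0 1 12 13 12 1) (E 13 6 (F2 0 1 12 13 12 6) (H [:: 0; 7; 9; 11;
13]))))) (H [:: 0; 9]))))) (H [:: 0; 9])))))))))))) (E 0 8 (E 7 5 (F2 0 5 8 7 8
5) (E 9 5 (F2 0 5 8 9 8 5) (E 7 1 (F2 0 1 8 7 8 1) (E 9 1 (F2 0 1 8 9 8 1) (E 9
6 (F2 0 1 8 9 8 6) (E 7 14 (F2 0 1 8 7 8 14) (P 7 9 (F3 0 1 8 7 8 15 9 10 15)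
(E 7 3 (E 2 8 (F2 2 3 8 7 8 3) (E 4 8 (F2 4 3 8 7 8 3) (E 2 5 (F3 0 5 8 2 3 5 7
8 3) (E 4 1 (F3 0 1 8 4 3 1 7 8 3) (H [:: 2; 4; 7]))))) (E 0 12 (E 11 5 (F2 0 5
12 11 12 5) (E 11 1 (F2 0 1 12 11 12 1) (E 11 14 (F2 0 1 12 11 12 14) (E 7 12
(E 11 6 (F3 0 1 8 7 8 12 11 12 6) (E 2 8 (E 9 3 (F2 2 3 8 9 8 3) (E 2 12 (E 11
3 (F2 2 3 12 11 12 3) (H [:: 0; 7; 9; 11])) (H [:: 2; 7]))) (H [:: 2; 7]))) (H
[:: 0; 7]))))) (H [:: 0; 7])))))))))) (E 2 8 (E 7 1 (F2 2 1 8 7 8 1) (E 7 3 (F2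
2 3 8 7 8 3) (E 7 14 (F2 2 3 8 7 8 14) (E 7 5 (E 4 8 (F2 4 5 8 7 8 5) (E 4 1
(F3 2 1 8 4 5 1 7 8 5) (E 0 3 (F3 0 5 3 2 3 8 7 8 5) (H [:: 0; 4; 7])))) (H [::
0; 7]))))) (E 4 8 (E 7 5 (F2 4 5 8 7 8 5) (E 7 3 (F2 4 3 8 7 8 3) (E 7 14 (F2 4
5 8 7 8 14) (E 7 1 (E 2 5 (F3 2 1 5 4 5 8 7 8 1) (E 0 3 (F3 0 1 3 4 3 8 7 8 1)
(H [:: 0; 2; 7]))) (H [:: 0; 7]))))) (E 11 5 (E 0 12 (F2 0 5 12 11 12 5) (E 4
12 (F2 4 5 12 11 12 5) (E 2 12 (E 4 1 (F3 2 1 12 4 5 1 11 12 5) (E 0 3 (F3 0 5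
3 2 3 12 11 12 5) (H [:: 0; 4]))) (N [:: 0; 2; 4])))) (E 11 1 (E 0 12 (F2 0 1
12 11 12 1) (E 2 12 (F2 2 1 12 11 12 1) (E 4 12 (E 2 5 (F3 2 1 5 4 5 12 11 12
1) (E 0 3 (F3 0 1 3 4 3 12 11 12 1) (H [:: 0; 2]))) (N [:: 0; 2; 4])))) (E 11 3
(E 2 12 (F2 2 3 12 11 12 3) (H [:: 2; 11])) (H [:: 0;
11])))))))))))))))))))))))))))))))))))))));
([:: 3], [:: 3; 1], (E 0 6 (F1 0 1 6) (E 2 6 (F1 2 3 6) (E 4 6 (F1 4 5 6) (E 0
12 (F1 0 1 12) (E 2 12 (F1 2 3 12) (E 4 12 (F1 4 5 12) (E 0 13 (F1 0 1 13) (E 2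
13 (F1 2 3 13) (E 4 13 (F1 4 5 13) (E 0 15 (F1 0 1 15) (E 2 15 (F1 2 3 15) (E 4
15 (F1 4 5 15) (P 0 2 (F2 0 1 16 2 3 16) (P 0 4 (F2 0 1 16 4 5 16) (P 0 7 (F2 0
1 16 7 8 16) (P 0 9 (F2 0 1 16 9 10 16) (P 0 11 (F2 0 1 16 11 12 16) (P 2 4 (F2
2 3 16 4 5 16) (P 2 7 (F2 2 3 16 7 8 16) (P 2 9 (F2 2 3 16 9 10 16) (P 2 11 (F2
2 3 16 11 12 16) (P 4 7 (F2 4 5 16 7 8 16) (P 4 9 (F2 4 5 16 9 10 16) (P 4 11
(F2 4 5 16 11 12 16) (Q 0 (F1 0 1 16) (Q 2 (F1 2 3 16) (Q 4 (F1 4 5 16) (E 9 6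
(E 0 8 (F2 0 1 8 9 8 6) (E 2 8 (F2 2 3 8 9 8 6) (E 4 8 (F2 4 5 8 9 8 6) (E 0 10
(F2 0 1 10 9 10 6) (E 2 10 (F2 2 3 10 9 10 6) (E 4 10 (F2 4 5 10 9 10 6) (N [::
0; 2; 4]))))))) (E 0 8 (E 7 5 (F2 0 5 8 7 8 5) (E 9 5 (F2 0 5 8 9 8 5) (E 7 1
(F2 0 1 8 7 8 1) (E 9 1 (F2 0 1 8 9 8 1) (E 7 12 (F2 0 1 8 7 8 12) (E 9 12 (F2
0 1 8 9 8 12) (E 7 13 (F2 0 1 8 7 8 13) (E 9 13 (F2 0 1 8 9 8 13) (E 7 15 (F2 0
1 8 7 8 15) (E 9 15 (F2 0 1 8 9 8 15) (P 7 9 (F3 0 1 8 7 8 16 9 10 16) (P 7 11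
(F3 0 1 8 7 8 16 11 12 16) (P 9 11 (F3 0 1 8 9 8 16 11 12 16) (E 11 6 (E 0 10
(F2 0 1 10 11 10 6) (E 7 10 (F3 0 1 8 7 8 10 11 10 6) (H [:: 0; 7; 9]))) (H [::
0; 2; 4; 7; 9; 11]))))))))))))))) (E 9 3 (E 2 8 (F2 2 3 8 9 8 3) (E 4 8 (F2 4 3
8 9 8 3) (E 2 10 (F2 2 3 10 9 10 3) (E 4 10 (F2 4 3 10 9 10 3) (E 0 10 (E 2 5
(F3 0 5 10 2 3 5 9 10 3) (E 4 1 (F3 0 1 10 4 3 1 9 10 3) (H [:: 2; 4]))) (N [::
0; 2; 4])))))) (E 9 5 (E 4 8 (F2 4 5 8 9 8 5) (E 0 10 (F2 0 5 10 9 10 5) (E 4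
10 (F2 4 5 10 9 10 5) (E 9 1 (E 2 8 (F2 2 1 8 9 8 1) (E 2 10 (F2 2 1 10 9 10 1)
(N [:: 0; 2; 4]))) (H [:: 0; 9]))))) (E 9 1 (E 0 10 (F2 0 1 10 9 10 1) (H [::
0; 9])) (H [:: 0; 9]))))))))))))))))))))))))))))))))));
([:: 3], [:: 2; 2], (E 0 6 (F1 0 1 6) (E 2 6 (F1 2 3 6) (E 4 6 (F1 4 5 6) (E 0
10 (F1 0 1 10) (E 2 10 (F1 2 3 10) (E 4 10 (F1 4 5 10) (E 0 11 (F1 0 1 11) (E 2
11 (F1 2 3 11) (E 4 11 (F1 4 5 11) (E 0 15 (F1 0 1 15) (E 2 15 (F1 2 3 15) (E 4
15 (F1 4 5 15) (P 0 2 (F2 0 1 16 2 3 16) (P 0 4 (F2 0 1 16 4 5 16) (P 0 7 (F2 0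
1 16 7 8 16) (P 0 9 (F2 0 1 16 9 10 16) (P 0 12 (F2 0 1 16 12 13 16) (P 2 4 (F2
2 3 16 4 5 16) (P 2 7 (F2 2 3 16 7 8 16) (P 2 9 (F2 2 3 16 9 10 16) (P 2 12 (F2
2 3 16 12 13 16) (P 4 7 (F2 4 5 16 7 8 16) (P 4 9 (F2 4 5 16 9 10 16) (Q 0 (F1
0 1 16) (Q 2 (F1 2 3 16) (Q 4 (F1 4 5 16) (E 0 8 (E 7 5 (F2 0 5 8 7 8 5) (E 9 5
(F2 0 5 8 9 8 5) (E 7 1 (F2 0 1 8 7 8 1) (E 9 1 (F2 0 1 8 9 8 1) (E 9 6 (F2 0 1
8 9 8 6) (E 7 10 (F2 0 1 8 7 8 10) (E 7 11 (F2 0 1 8 7 8 11) (E 9 11 (F2 0 1 8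
9 8 11) (E 7 15 (F2 0 1 8 7 8 15) (E 9 15 (F2 0 1 8 9 8 15) (P 7 9 (F3 0 1 8 7
8 16 9 10 16) (E 2 5 (E 7 3 (F3 0 5 8 2 3 5 7 8 3) (E 9 3 (F3 0 5 8 2 3 5 9 8
3) (H [:: 0; 7; 9]))) (E 4 1 (E 7 3 (F3 0 1 8 4 3 1 7 8 3) (E 9 3 (F3 0 1 8 4 3
1 9 8 3) (H [:: 0; 7; 9]))) (H [:: 2; 4; 7; 9])))))))))))))) (E 2 8 (E 7 1 (F2
2 1 8 7 8 1) (E 7 3 (F2 2 3 8 7 8 3) (E 7 10 (F2 2 3 8 7 8 10) (E 7 11 (F2 2 3
8 7 8 11) (E 7 15 (F2 2 3 8 7 8 15) (E 7 5 (E 4 8 (F2 4 5 8 7 8 5) (E 4 1 (F3 2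
1 8 4 5 1 7 8 5) (E 0 3 (F3 0 5 3 2 3 8 7 8 5) (H [:: 0; 4; 7])))) (H [:: 0;
7]))))))) (E 12 6 (E 0 13 (F2 0 1 13 12 13 6) (E 2 13 (F2 2 3 13 12 13 6) (E 4
13 (F2 4 5 13 12 13 6) (E 4 8 (E 7 5 (F2 4 5 8 7 8 5) (E 7 3 (F2 4 3 8 7 8 3)
(E 7 10 (F2 4 5 8 7 8 10) (E 7 11 (F2 4 5 8 7 8 11) (E 7 15 (F2 4 5 8 7 8 15)
(E 7 13 (F3 4 5 8 7 8 13 12 13 6) (H [:: 0; 7]))))))) (N [:: 0; 2; 4]))))) (E 4
8 (E 7 5 (F2 4 5 8 7 8 5) (E 7 3 (F2 4 3 8 7 8 3) (E 7 10 (F2 4 5 8 7 8 10) (E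
7 11 (F2 4 5 8 7 8 11) (E 7 15 (F2 4 5 8 7 8 15) (E 7 1 (E 2 5 (F3 2 1 5 4 5 8
7 8 1) (E 0 3 (F3 0 1 3 4 3 8 7 8 1) (H [:: 0; 2; 7]))) (H [:: 0; 7]))))))) (E
12 5 (E 0 13 (F2 0 5 13 12 13 5) (E 4 13 (F2 4 5 13 12 13 5) (E 2 13 (E 4 1 (F3
2 1 13 4 5 1 12 13 5) (E 0 3 (F3 0 5 3 2 3 13 12 13 5) (H [:: 0; 4]))) (N [::
0; 2; 4])))) (E 12 1 (E 0 13 (F2 0 1 13 12 13 1) (E 2 13 (F2 2 1 13 12 13 1) (E
4 13 (E 2 5 (F3 2 1 5 4 5 13 12 13 1) (E 0 3 (F3 0 1 3 4 3 13 12 13 1) (H [::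
0; 2]))) (N [:: 0; 2; 4])))) (E 12 3 (E 2 13 (F2 2 3 13 12 13 3) (H [:: 2;
12])) (H [:: 0; 12])))))))))))))))))))))))))))))))))));
([:: 3], [:: 2; 1; 1], (E 0 6 (F1 0 1 6) (E 2 6 (F1 2 3 6) (E 4 6 (F1 4 5 6) (E
0 10 (F1 0 1 10) (E 2 10 (F1 2 3 10) (E 4 10 (F1 4 5 10) (E 0 11 (F1 0 1 11) (E
2 11 (F1 2 3 11) (E 4 11 (F1 4 5 11) (E 0 13 (F1 0 1 13) (E 2 13 (F1 2 3 13) (E
4 13 (F1 4 5 13) (E 0 14 (F1 0 1 14) (E 2 14 (F1 2 3 14) (E 4 14 (F1 4 5 14) (E
0 16 (F1 0 1 16) (E 2 16 (F1 2 3 16) (E 4 16 (F1 4 5 16) (P 0 2 (F2 0 1 17 2 3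
17) (P 0 4 (F2 0 1 17 4 5 17) (P 0 7 (F2 0 1 17 7 8 17) (P 2 7 (F2 2 3 17 7 8
17) (Q 0 (F1 0 1 17) (Q 2 (F1 2 3 17) (Q 4 (F1 4 5 17) (E 7 5 (E 0 8 (F2 0 5 8
7 8 5) (E 4 8 (F2 4 5 8 7 8 5) (E 2 8 (E 4 1 (F3 2 1 8 4 5 1 7 8 5) (E 0 3 (F3
0 5 3 2 3 8 7 8 5) (H [:: 0; 4]))) (N [:: 0; 2; 4])))) (E 7 1 (E 0 8 (F2 0 1 8
7 8 1) (E 2 8 (F2 2 1 8 7 8 1) (E 4 8 (E 2 5 (F3 2 1 5 4 5 8 7 8 1) (E 0 3 (F3
0 1 3 4 3 8 7 8 1) (H [:: 0; 2]))) (N [:: 0; 2; 4])))) (E 7 3 (E 2 8 (F2 2 3 8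
7 8 3) (H [:: 2; 7])) (H [:: 0; 7]))))))))))))))))))))))))))))));
([:: 3], [:: 1; 1; 1; 1], (E 0 6 (F1 0 1 6) (E 2 6 (F1 2 3 6) (E 4 6 (F1 4 5 6)
(E 0 8 (F1 0 1 8) (E 2 8 (F1 2 3 8) (E 4 8 (F1 4 5 8) (E 0 9 (F1 0 1 9) (E 2 9
(F1 2 3 9) (E 4 9 (F1 4 5 9) (E 0 11 (F1 0 1 11) (E 2 11 (F1 2 3 11) (E 4 11
(F1 4 5 11) (E 0 12 (F1 0 1 12) (E 2 12 (F1 2 3 12) (E 4 12 (F1 4 5 12) (E 0 14
(F1 0 1 14) (E 2 14 (F1 2 3 14) (E 4 14 (F1 4 5 14) (E 0 15 (F1 0 1 15) (E 2 15
(F1 2 3 15) (E 4 15 (F1 4 5 15) (E 0 17 (F1 0 1 17) (E 2 17 (F1 2 3 17) (E 4 17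
(F1 4 5 17) (Q 0 (F1 0 1 18) (Q 2 (F1 2 3 18) (Q 4 (F1 4 5 18) (N [:: 0; 2;
4])))))))))))))))))))))))))))));
([:: 4], [:: 3], (E 0 8 (F1 0 1 8) (E 2 8 (F1 2 3 8) (E 4 8 (F1 4 5 8) (E 6 8
(F1 6 7 8) (E 0 14 (F1 0 1 14) (E 2 14 (F1 2 3 14) (E 4 14 (F1 4 5 14) (E 6 14
(F1 6 7 14) (P 0 2 (F2 0 1 15 2 3 15) (P 0 4 (F2 0 1 15 4 5 15) (P 0 6 (F2 0 1
15 6 7 15) (P 0 9 (F2 0 1 15 9 10 15) (P 0 11 (F2 0 1 15 11 12 15) (P 0 13 (F2
0 1 15 13 14 15) (P 2 4 (F2 2 3 15 4 5 15) (P 2 6 (F2 2 3 15 6 7 15) (P 2 9 (F2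
2 3 15 9 10 15) (P 2 11 (F2 2 3 15 11 12 15) (P 2 13 (F2 2 3 15 13 14 15) (P 4
6 (F2 4 5 15 6 7 15) (P 4 9 (F2 4 5 15 9 10 15) (P 4 11 (F2 4 5 15 11 12 15) (P
4 13 (F2 4 5 15 13 14 15) (P 6 9 (F2 6 7 15 9 10 15) (P 6 11 (F2 6 7 15 11 12
15) (P 6 13 (F2 6 7 15 13 14 15) (Q 0 (F1 0 1 15) (Q 2 (F1 2 3 15) (Q 4 (F1 4 5
15) (Q 6 (F1 6 7 15) (E 11 8 (E 0 10 (F2 0 1 10 11 10 8) (E 2 10 (F2 2 3 10 11
10 8) (E 4 10 (F2 4 5 10 11 10 8) (E 6 10 (F2 6 7 10 11 10 8) (E 0 12 (F2 0 1
12 11 12 8) (E 2 12 (F2 2 3 12 11 12 8) (E 4 12 (F2 4 5 12 11 12 8) (E 6 12 (F2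
6 7 12 11 12 8) (N [:: 0; 2; 4; 6]))))))))) (E 0 10 (E 9 14 (F2 0 1 10 9 10 14)
(E 11 14 (F2 0 1 10 11 10 14) (P 9 11 (F3 0 1 10 9 10 15 11 12 15) (P 9 13 (F3
0 1 10 9 10 15 13 14 15) (P 11 13 (F3 0 1 10 11 10 15 13 14 15) (E 13 8 (E 0 12
(F2 0 1 12 13 12 8) (E 2 12 (F2 2 3 12 13 12 8) (E 4 12 (F2 4 5 12 13 12 8) (E
6 12 (F2 6 7 12 13 12 8) (E 9 12 (F3 0 1 10 9 10 12 13 12 8) (H [:: 0; 2; 4; 6;
9; 11])))))) (H [:: 0; 2; 4; 6; 9; 11; 13]))))))) (E 2 10 (E 9 14 (F2 2 3 10 9
10 14) (E 11 14 (F2 2 3 10 11 10 14) (P 9 11 (F3 2 3 10 9 10 15 11 12 15) (P 9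
13 (F3 2 3 10 9 10 15 13 14 15) (P 11 13 (F3 2 3 10 11 10 15 13 14 15) (E 13 8
(E 0 12 (F2 0 1 12 13 12 8) (E 2 12 (F2 2 3 12 13 12 8) (E 4 12 (F2 4 5 12 13
12 8) (E 6 12 (F2 6 7 12 13 12 8) (E 9 12 (F3 2 3 10 9 10 12 13 12 8) (H [:: 0;
2; 4; 6; 9; 11])))))) (H [:: 0; 2; 4; 6; 9; 11; 13]))))))) (E 4 10 (E 9 14 (F2
4 5 10 9 10 14) (E 11 14 (F2 4 5 10 11 10 14) (P 9 11 (F3 4 5 10 9 10 15 11 12
15) (P 9 13 (F3 4 5 10 9 10 15 13 14 15) (P 11 13 (F3 4 5 10 11 10 15 13 14 15)
(E 13 8 (E 0 12 (F2 0 1 12 13 12 8) (E 2 12 (F2 2 3 12 13 12 8) (E 4 12 (F2 4 5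
12 13 12 8) (E 6 12 (F2 6 7 12 13 12 8) (E 9 12 (F3 4 5 10 9 10 12 13 12 8) (H
[:: 0; 2; 4; 6; 9; 11])))))) (H [:: 0; 2; 4; 6; 9; 11; 13]))))))) (E 13 8 (E 0
12 (F2 0 1 12 13 12 8) (E 2 12 (F2 2 3 12 13 12 8) (E 4 12 (F2 4 5 12 13 12 8)
(E 6 12 (F2 6 7 12 13 12 8) (E 6 10 (E 9 14 (F2 6 7 10 9 10 14) (E 11 14 (F2 6
7 10 11 10 14) (P 9 11 (F3 6 7 10 9 10 15 11 12 15) (E 9 12 (F3 6 7 10 9 10 12
13 12 8) (H [:: 0; 2; 4; 6; 9; 11]))))) (N [:: 0; 2; 4; 6])))))) (E 6 10 (E 9
14 (F2 6 7 10 9 10 14) (E 11 14 (F2 6 7 10 11 10 14) (P 9 11 (F3 6 7 10 9 10 15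
11 12 15) (P 9 13 (F3 6 7 10 9 10 15 13 14 15) (P 11 13 (F3 6 7 10 11 10 15 13
14 15) (H [:: 0; 2; 4; 6; 9; 11; 13])))))) (E 0 12 (E 11 14 (F2 0 1 12 11 12
14) (P 9 11 (F3 0 1 12 9 10 15 11 12 15) (P 9 13 (F3 0 1 12 9 10 15 13 12 15)
(P 11 13 (F3 0 1 12 11 12 15 13 14 15) (E 13 10 (E 9 14 (F3 0 1 12 9 10 14 13
12 10) (H [:: 0; 2; 4; 6; 9; 11; 13])) (H [:: 0; 2; 4; 6; 11; 13])))))) (E 11 3
(E 2 12 (F2 2 3 12 11 12 3) (E 4 12 (F2 4 3 12 11 12 3) (E 6 12 (E 11 7 (F2 6 7
12 11 12 7) (E 11 5 (F2 6 5 12 11 12 5) (E 11 14 (F2 6 7 12 11 12 14) (E 2 7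
(F3 2 3 7 6 7 12 11 12 3) (E 2 5 (F3 2 3 5 6 5 12 11 12 3) (H [:: 0; 2;
11])))))) (N [:: 0; 2; 4; 6])))) (E 11 5 (E 4 12 (F2 4 5 12 11 12 5) (E 6 12
(F2 6 5 12 11 12 5) (E 2 12 (E 11 1 (F2 2 1 12 11 12 1) (E 11 14 (F2 2 3 12 11
12 14) (E 6 1 (F3 2 1 12 6 5 1 11 12 5) (E 6 3 (F3 2 3 12 6 5 3 11 12 5) (H [::
0; 6; 11]))))) (N [:: 0; 2; 4; 6])))) (E 11 7 (E 6 12 (F2 6 7 12 11 12 7) (E 11
1 (E 2 12 (F2 2 1 12 11 12 1) (E 4 12 (E 0 3 (F3 0 7 3 4 3 12 11 12 7) (E 6 3
(F3 4 3 12 6 7 3 11 12 7) (E 0 5 (F3 0 7 5 4 5 12 11 12 7) (E 2 5 (F3 2 1 5 4 5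
12 11 12 1) (H [:: 0; 2; 6]))))) (N [:: 0; 2; 4; 6]))) (H [:: 0; 11]))) (H [::
0; 11]))))))))))))))))))))))))))))))))))))))))));
([:: 4], [:: 2; 1], (E 0 8 (F1 0 1 8) (E 2 8 (F1 2 3 8) (E 4 8 (F1 4 5 8) (E 6
8 (F1 6 7 8) (E 0 12 (F1 0 1 12) (E 2 12 (F1 2 3 12) (E 4 12 (F1 4 5 12) (E 6
12 (F1 6 7 12) (E 0 13 (F1 0 1 13) (E 2 13 (F1 2 3 13) (E 4 13 (F1 4 5 13) (E 6
13 (F1 6 7 13) (E 0 15 (F1 0 1 15) (E 2 15 (F1 2 3 15) (E 4 15 (F1 4 5 15) (E 6
15 (F1 6 7 15) (P 0 2 (F2 0 1 16 2 3 16) (P 0 4 (F2 0 1 16 4 5 16) (P 0 6 (F2 0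
1 16 6 7 16) (P 0 9 (F2 0 1 16 9 10 16) (P 0 11 (F2 0 1 16 11 12 16) (P 2 4 (F2
2 3 16 4 5 16) (P 2 6 (F2 2 3 16 6 7 16) (P 2 9 (F2 2 3 16 9 10 16) (P 2 11 (F2
2 3 16 11 12 16) (P 4 6 (F2 4 5 16 6 7 16) (P 4 9 (F2 4 5 16 9 10 16) (P 4 11
(F2 4 5 16 11 12 16) (P 6 9 (F2 6 7 16 9 10 16) (P 6 11 (F2 6 7 16 11 12 16) (Q
0 (F1 0 1 16) (Q 2 (F1 2 3 16) (Q 4 (F1 4 5 16) (Q 6 (F1 6 7 16) (E 11 8 (E 0
10 (F2 0 1 10 11 10 8) (E 2 10 (F2 2 3 10 11 10 8) (E 4 10 (F2 4 5 10 11 10 8)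
(E 6 10 (F2 6 7 10 11 10 8) (N [:: 0; 2; 4; 6]))))) (E 0 10 (E 9 12 (F2 0 1 10
9 10 12) (E 9 13 (F2 0 1 10 9 10 13) (E 11 13 (F2 0 1 10 11 10 13) (E 9 15 (F2
0 1 10 9 10 15) (E 11 15 (F2 0 1 10 11 10 15) (P 9 11 (F3 0 1 10 9 10 16 11 12
16) (H [:: 0; 2; 4; 6; 9; 11]))))))) (E 9 3 (E 2 10 (F2 2 3 10 9 10 3) (E 4 10
(F2 4 3 10 9 10 3) (E 6 10 (E 9 7 (F2 6 7 10 9 10 7) (E 9 5 (F2 6 5 10 9 10 5)
(E 9 12 (F2 6 7 10 9 10 12) (E 9 13 (F2 6 7 10 9 10 13) (E 9 15 (F2 6 7 10 9 10
15) (E 2 7 (F3 2 3 7 6 7 10 9 10 3) (E 2 5 (F3 2 3 5 6 5 10 9 10 3) (H [:: 0;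
2; 9])))))))) (N [:: 0; 2; 4; 6])))) (E 9 5 (E 4 10 (F2 4 5 10 9 10 5) (E 6 10
(F2 6 5 10 9 10 5) (E 2 10 (E 9 1 (F2 2 1 10 9 10 1) (E 9 12 (F2 2 3 10 9 10
12) (E 9 13 (F2 2 3 10 9 10 13) (E 9 15 (F2 2 3 10 9 10 15) (E 6 1 (F3 2 1 10 6
5 1 9 10 5) (E 6 3 (F3 2 3 10 6 5 3 9 10 5) (H [:: 0; 6; 9]))))))) (N [:: 0; 2;
4; 6])))) (E 9 7 (E 6 10 (F2 6 7 10 9 10 7) (E 9 1 (E 2 10 (F2 2 1 10 9 10 1)
(E 4 10 (E 0 3 (F3 0 7 3 4 3 10 9 10 7) (E 6 3 (F3 4 3 10 6 7 3 9 10 7) (E 0 5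
(F3 0 7 5 4 5 10 9 10 7) (E 2 5 (F3 2 1 5 4 5 10 9 10 1) (H [:: 0; 2; 6])))))
(N [:: 0; 2; 4; 6]))) (H [:: 0; 9]))) (H [:: 0;
9])))))))))))))))))))))))))))))))))))))))));
([:: 4], [:: 1; 1; 1], (E 0 8 (F1 0 1 8) (E 2 8 (F1 2 3 8) (E 4 8 (F1 4 5 8) (E
6 8 (F1 6 7 8) (E 0 10 (F1 0 1 10) (E 2 10 (F1 2 3 10) (E 4 10 (F1 4 5 10) (E 6
10 (F1 6 7 10) (E 0 11 (F1 0 1 11) (E 2 11 (F1 2 3 11) (E 4 11 (F1 4 5 11) (E 6
11 (F1 6 7 11) (E 0 13 (F1 0 1 13) (E 2 13 (F1 2 3 13) (E 4 13 (F1 4 5 13) (E 6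
13 (F1 6 7 13) (E 0 14 (F1 0 1 14) (E 2 14 (F1 2 3 14) (E 4 14 (F1 4 5 14) (E 6
14 (F1 6 7 14) (E 0 16 (F1 0 1 16) (E 2 16 (F1 2 3 16) (E 4 16 (F1 4 5 16) (E 6
16 (F1 6 7 16) (Q 0 (F1 0 1 17) (Q 2 (F1 2 3 17) (Q 4 (F1 4 5 17) (Q 6 (F1 6 7
17) (N [:: 0; 2; 4; 6]))))))))))))))))))))))))))))));
([:: 2; 2], [:: 3], (E 0 8 (F1 0 1 8) (E 2 8 (F1 2 3 8) (E 4 8 (F1 4 5 8) (E 6
8 (F1 6 7 8) (E 0 14 (F1 0 1 14) (E 2 14 (F1 2 3 14) (E 4 14 (F1 4 5 14) (E 6
14 (F1 6 7 14) (P 0 2 (F2 0 1 15 2 3 15) (P 0 4 (F2 0 1 15 4 5 15) (P 0 6 (F2 0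
1 15 6 7 15) (P 0 9 (F2 0 1 15 9 10 15) (P 0 11 (F2 0 1 15 11 12 15) (P 0 13
(F2 0 1 15 13 14 15) (P 2 4 (F2 2 3 15 4 5 15) (P 2 6 (F2 2 3 15 6 7 15) (P 2 9
(F2 2 3 15 9 10 15) (P 2 11 (F2 2 3 15 11 12 15) (P 2 13 (F2 2 3 15 13 14 15)
(P 4 6 (F2 4 5 15 6 7 15) (P 4 9 (F2 4 5 15 9 10 15) (P 4 11 (F2 4 5 15 11 12
15) (P 4 13 (F2 4 5 15 13 14 15) (P 6 9 (F2 6 7 15 9 10 15) (P 6 11 (F2 6 7 15
11 12 15) (P 6 13 (F2 6 7 15 13 14 15) (Q 0 (F1 0 1 15) (Q 2 (F1 2 3 15) (Q 4
(F1 4 5 15) (Q 6 (F1 6 7 15) (P 9 11 (E 0 10 (F3 0 1 10 9 10 15 11 12 15) (E 2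
10 (F3 2 3 10 9 10 15 11 12 15) (E 4 10 (F3 4 5 10 9 10 15 11 12 15) (E 6 10
(F3 6 7 10 9 10 15 11 12 15) (E 0 12 (F3 0 1 12 9 10 15 11 12 15) (E 2 12 (F3 2
3 12 9 10 15 11 12 15) (E 4 12 (F3 4 5 12 9 10 15 11 12 15) (E 6 12 (F3 6 7 12
9 10 15 11 12 15) (N [:: 0; 2; 4; 6]))))))))) (P 9 13 (E 0 10 (F3 0 1 10 9 10
15 13 14 15) (E 2 10 (F3 2 3 10 9 10 15 13 14 15) (E 4 10 (F3 4 5 10 9 10 15 13
14 15) (E 6 10 (F3 6 7 10 9 10 15 13 14 15) (E 0 12 (F3 0 1 12 9 10 15 13 12
15) (E 2 12 (F3 2 3 12 9 10 15 13 12 15) (E 4 12 (F3 4 5 12 9 10 15 13 12 15)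
(E 6 12 (F3 6 7 12 9 10 15 13 12 15) (N [:: 0; 2; 4; 6]))))))))) (P 11 13 (E 0
10 (F3 0 1 10 11 10 15 13 12 15) (E 2 10 (F3 2 3 10 11 10 15 13 12 15) (E 4 10
(F3 4 5 10 11 10 15 13 12 15) (E 6 10 (F3 6 7 10 11 10 15 13 12 15) (E 0 12 (F3
0 1 12 11 12 15 13 14 15) (E 2 12 (F3 2 3 12 11 12 15 13 14 15) (E 4 12 (F3 4 5
12 11 12 15 13 14 15) (E 6 12 (F3 6 7 12 11 12 15 13 14 15) (N [:: 0; 2; 4;
6]))))))))) (E 0 10 (E 9 3 (F2 0 3 10 9 10 3) (E 9 1 (F2 0 1 10 9 10 1) (E 11 8
(F2 0 1 10 11 10 8) (E 9 14 (F2 0 1 10 9 10 14) (E 13 8 (E 0 12 (F2 0 1 12 13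
12 8) (E 2 12 (F2 2 3 12 13 12 8) (E 4 12 (F2 4 5 12 13 12 8) (E 6 12 (F2 6 7
12 13 12 8) (E 9 12 (F3 0 1 10 9 10 12 13 12 8) (E 11 14 (F3 0 1 10 11 10 14 13
14 8) (H [:: 0; 2; 4; 6; 9; 11]))))))) (E 11 14 (E 0 12 (F2 0 1 12 11 12 14) (E
4 12 (F2 4 5 12 11 12 14) (E 6 12 (F2 6 7 12 11 12 14) (E 4 3 (F3 0 3 10 4 5 3
11 10 14) (E 6 3 (F3 0 3 10 6 7 3 11 10 14) (E 4 1 (F3 0 1 10 4 5 1 11 10 14)
(E 6 1 (F3 0 1 10 6 7 1 11 10 14) (E 9 12 (F3 0 1 10 9 10 12 11 12 14) (H [::
0; 4; 6; 9]))))))))) (H [:: 0; 2; 4; 6; 9; 11; 13]))))))) (E 2 10 (E 9 3 (F2 2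
3 10 9 10 3) (E 9 1 (F2 2 1 10 9 10 1) (E 9 14 (F2 2 3 10 9 10 14) (E 9 7 (E 4
10 (F2 4 7 10 9 10 7) (E 6 10 (F2 6 7 10 9 10 7) (E 4 3 (F3 2 3 10 4 7 3 9 10
7) (E 6 3 (F3 2 3 10 6 7 3 9 10 7) (E 4 1 (F3 2 1 10 4 7 1 9 10 7) (E 6 1 (F3 2
1 10 6 7 1 9 10 7) (H [:: 0; 4; 6; 9]))))))) (E 9 5 (E 4 10 (F2 4 5 10 9 10 5)
(E 6 10 (F2 6 5 10 9 10 5) (E 4 3 (F3 2 3 10 4 5 3 9 10 5) (E 6 3 (F3 2 3 10 6
5 3 9 10 5) (E 4 1 (F3 2 1 10 4 5 1 9 10 5) (E 6 1 (F3 2 1 10 6 5 1 9 10 5) (H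
[:: 0; 4; 6; 9]))))))) (H [:: 0; 9])))))) (E 4 10 (E 9 7 (F2 4 7 10 9 10 7) (E
11 7 (F2 4 7 10 11 10 7) (E 9 5 (F2 4 5 10 9 10 5) (E 11 5 (F2 4 5 10 11 10 5)
(E 11 8 (F2 4 5 10 11 10 8) (E 9 14 (F2 4 5 10 9 10 14) (E 9 3 (E 0 7 (F3 0 3 7
4 7 10 9 10 3) (E 2 7 (F3 2 3 7 4 7 10 9 10 3) (E 0 5 (F3 0 3 5 4 5 10 9 10 3)
(E 2 5 (F3 2 3 5 4 5 10 9 10 3) (H [:: 0; 2; 4; 9; 11]))))) (E 9 1 (E 0 7 (F3 0
1 7 4 7 10 9 10 1) (E 2 7 (F3 2 1 7 4 7 10 9 10 1) (E 0 5 (F3 0 1 5 4 5 10 9 10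
1) (E 2 5 (F3 2 1 5 4 5 10 9 10 1) (H [:: 0; 2; 4; 9; 11]))))) (H [:: 0;
9]))))))))) (E 13 8 (E 0 12 (F2 0 1 12 13 12 8) (E 2 12 (F2 2 3 12 13 12 8) (E
4 12 (F2 4 5 12 13 12 8) (E 6 12 (F2 6 7 12 13 12 8) (E 6 10 (E 11 8 (F2 6 7 10
11 10 8) (E 9 14 (F2 6 7 10 9 10 14) (E 9 12 (F3 6 7 10 9 10 12 13 12 8) (E 11
14 (F3 6 7 10 11 10 14 13 14 8) (H [:: 0; 2; 4; 6; 9; 11]))))) (N [:: 0; 2; 4;
6])))))) (E 6 10 (E 11 8 (F2 6 7 10 11 10 8) (E 9 14 (F2 6 7 10 9 10 14) (E 11
14 (E 0 12 (F2 0 1 12 11 12 14) (E 2 12 (F2 2 3 12 11 12 14) (E 0 7 (F3 0 1 7 6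
7 10 11 10 14) (E 2 7 (F3 2 3 7 6 7 10 11 10 14) (E 0 5 (F3 0 1 5 6 5 10 11 10
14) (E 2 5 (F3 2 3 5 6 5 10 11 10 14) (N [:: 0; 2]))))))) (H [:: 0; 2; 4; 6; 9;
11; 13])))) (E 11 14 (E 0 12 (F2 0 1 12 11 12 14) (E 2 12 (F2 2 3 12 11 12 14)
(E 4 12 (F2 4 5 12 11 12 14) (E 6 12 (F2 6 7 12 11 12 14) (N [:: 0; 2; 4;
6]))))) (E 13 10 (E 11 8 (E 0 12 (F3 0 1 12 11 10 8 13 12 10) (E 2 12 (F3 2 3
12 11 10 8 13 12 10) (E 4 12 (F3 4 5 12 11 10 8 13 12 10) (E 6 12 (F3 6 7 12 11
10 8 13 12 10) (N [:: 0; 2; 4; 6]))))) (E 9 14 (E 0 12 (F3 0 1 12 9 10 14 13 12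
10) (E 2 12 (F3 2 3 12 9 10 14 13 12 10) (E 4 12 (F3 4 5 12 9 10 14 13 12 10)
(E 6 12 (F3 6 7 12 9 10 14 13 12 10) (N [:: 0; 2; 4; 6]))))) (H [:: 0; 2; 4; 6;
9; 11; 13]))) (H [:: 0; 2; 4; 6; 11;
13]))))))))))))))))))))))))))))))))))))))))));
([:: 2; 2], [:: 2; 1], (E 0 8 (F1 0 1 8) (E 2 8 (F1 2 3 8) (E 4 8 (F1 4 5 8) (E
6 8 (F1 6 7 8) (E 0 12 (F1 0 1 12) (E 2 12 (F1 2 3 12) (E 4 12 (F1 4 5 12) (E 6
12 (F1 6 7 12) (E 0 13 (F1 0 1 13) (E 2 13 (F1 2 3 13) (E 4 13 (F1 4 5 13) (E 6
13 (F1 6 7 13) (E 0 15 (F1 0 1 15) (E 2 15 (F1 2 3 15) (E 4 15 (F1 4 5 15) (E 6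
15 (F1 6 7 15) (P 0 2 (F2 0 1 16 2 3 16) (P 0 4 (F2 0 1 16 4 5 16) (P 0 6 (F2 0
1 16 6 7 16) (P 0 9 (F2 0 1 16 9 10 16) (P 0 11 (F2 0 1 16 11 12 16) (P 2 4 (F2
2 3 16 4 5 16) (P 2 6 (F2 2 3 16 6 7 16) (P 2 9 (F2 2 3 16 9 10 16) (P 2 11 (F2
2 3 16 11 12 16) (P 4 6 (F2 4 5 16 6 7 16) (P 4 9 (F2 4 5 16 9 10 16) (P 4 11
(F2 4 5 16 11 12 16) (P 6 9 (F2 6 7 16 9 10 16) (P 6 11 (F2 6 7 16 11 12 16) (Q
0 (F1 0 1 16) (Q 2 (F1 2 3 16) (Q 4 (F1 4 5 16) (Q 6 (F1 6 7 16) (E 11 8 (E 0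
10 (F2 0 1 10 11 10 8) (E 2 10 (F2 2 3 10 11 10 8) (E 4 10 (F2 4 5 10 11 10 8)
(E 6 10 (F2 6 7 10 11 10 8) (N [:: 0; 2; 4; 6]))))) (E 0 10 (E 9 12 (F2 0 1 10
9 10 12) (E 9 13 (F2 0 1 10 9 10 13) (E 11 13 (F2 0 1 10 11 10 13) (E 9 15 (F2
0 1 10 9 10 15) (E 11 15 (F2 0 1 10 11 10 15) (P 9 11 (F3 0 1 10 9 10 16 11 12
16) (H [:: 0; 2; 4; 6; 9; 11]))))))) (E 9 7 (E 4 10 (F2 4 7 10 9 10 7) (E 6 10
(F2 6 7 10 9 10 7) (E 2 10 (E 4 3 (F3 2 3 10 4 7 3 9 10 7) (E 6 3 (F3 2 3 10 6
7 3 9 10 7) (E 4 1 (F3 2 1 10 4 7 1 9 10 7) (E 6 1 (F3 2 1 10 6 7 1 9 10 7) (N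
[:: 4; 6]))))) (N [:: 0; 2; 4; 6])))) (E 9 5 (E 4 10 (F2 4 5 10 9 10 5) (E 6 10
(F2 6 5 10 9 10 5) (E 2 10 (E 4 3 (F3 2 3 10 4 5 3 9 10 5) (E 6 3 (F3 2 3 10 6
5 3 9 10 5) (E 4 1 (F3 2 1 10 4 5 1 9 10 5) (E 6 1 (F3 2 1 10 6 5 1 9 10 5) (N
[:: 4; 6]))))) (N [:: 0; 2; 4; 6])))) (E 9 3 (E 2 10 (F2 2 3 10 9 10 3) (E 0 7
(E 4 10 (F3 0 3 7 4 7 10 9 10 3) (E 6 10 (F3 0 3 7 6 7 10 9 10 3) (N [:: 0; 2;
4; 6]))) (E 0 5 (E 4 10 (F3 0 3 5 4 5 10 9 10 3) (E 6 10 (F3 0 3 5 6 5 10 9 10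
3) (N [:: 0; 2; 4; 6]))) (H [:: 0; 2; 9])))) (H [:: 0;
9])))))))))))))))))))))))))))))))))))))))));
([:: 2; 2], [:: 1; 1; 1], (E 0 8 (F1 0 1 8) (E 2 8 (F1 2 3 8) (E 4 8 (F1 4 5 8)
(E 6 8 (F1 6 7 8) (E 0 10 (F1 0 1 10) (E 2 10 (F1 2 3 10) (E 4 10 (F1 4 5 10)
(E 6 10 (F1 6 7 10) (E 0 11 (F1 0 1 11) (E 2 11 (F1 2 3 11) (E 4 11 (F1 4 5 11)
(E 6 11 (F1 6 7 11) (E 0 13 (F1 0 1 13) (E 2 13 (F1 2 3 13) (E 4 13 (F1 4 5 13)
(E 6 13 (F1 6 7 13) (E 0 14 (F1 0 1 14) (E 2 14 (F1 2 3 14) (E 4 14 (F1 4 5 14)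
(E 6 14 (F1 6 7 14) (E 0 16 (F1 0 1 16) (E 2 16 (F1 2 3 16) (E 4 16 (F1 4 5 16)
(E 6 16 (F1 6 7 16) (Q 0 (F1 0 1 17) (Q 2 (F1 2 3 17) (Q 4 (F1 4 5 17) (Q 6 (F1
6 7 17) (N [:: 0; 2; 4; 6]))))))))))))))))))))))))))))));
([:: 5], [:: 2], (E 0 10 (F1 0 1 10) (E 2 10 (F1 2 3 10) (E 4 10 (F1 4 5 10) (E
6 10 (F1 6 7 10) (E 8 10 (F1 8 9 10) (E 0 14 (F1 0 1 14) (E 2 14 (F1 2 3 14) (E
4 14 (F1 4 5 14) (E 6 14 (F1 6 7 14) (E 8 14 (F1 8 9 14) (P 0 2 (F2 0 1 15 2 3
15) (P 0 4 (F2 0 1 15 4 5 15) (P 0 6 (F2 0 1 15 6 7 15) (P 0 8 (F2 0 1 15 8 9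
15) (P 0 11 (F2 0 1 15 11 12 15) (P 0 13 (F2 0 1 15 13 14 15) (P 2 4 (F2 2 3 15
4 5 15) (P 2 6 (F2 2 3 15 6 7 15) (P 2 8 (F2 2 3 15 8 9 15) (P 2 11 (F2 2 3 15
11 12 15) (P 2 13 (F2 2 3 15 13 14 15) (P 4 6 (F2 4 5 15 6 7 15) (P 4 8 (F2 4 5
15 8 9 15) (P 4 11 (F2 4 5 15 11 12 15) (P 4 13 (F2 4 5 15 13 14 15) (P 6 8 (F2
6 7 15 8 9 15) (P 6 11 (F2 6 7 15 11 12 15) (P 6 13 (F2 6 7 15 13 14 15) (P 8
11 (F2 8 9 15 11 12 15) (P 8 13 (F2 8 9 15 13 14 15) (Q 0 (F1 0 1 15) (Q 2 (F1
2 3 15) (Q 4 (F1 4 5 15) (Q 6 (F1 6 7 15) (Q 8 (F1 8 9 15) (E 13 10 (E 0 12 (F2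
0 1 12 13 12 10) (E 2 12 (F2 2 3 12 13 12 10) (E 4 12 (F2 4 5 12 13 12 10) (E 6
12 (F2 6 7 12 13 12 10) (E 8 12 (F2 8 9 12 13 12 10) (N [:: 0; 2; 4; 6;
8])))))) (P 11 13 (E 0 12 (F3 0 1 12 11 12 15 13 14 15) (E 2 12 (F3 2 3 12 11
12 15 13 14 15) (E 4 12 (F3 4 5 12 11 12 15 13 14 15) (E 6 12 (F3 6 7 12 11 12
15 13 14 15) (E 8 12 (F3 8 9 12 11 12 15 13 14 15) (N [:: 0; 2; 4; 6; 8]))))))
(E 11 14 (E 0 12 (F2 0 1 12 11 12 14) (E 2 12 (F2 2 3 12 11 12 14) (E 4 12 (F2
4 5 12 11 12 14) (E 6 12 (F2 6 7 12 11 12 14) (E 8 12 (F2 8 9 12 11 12 14) (N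
[:: 0; 2; 4; 6; 8])))))) (H [:: 0; 2; 4; 6; 8; 11;
13]))))))))))))))))))))))))))))))))))))))));
([:: 5], [:: 1; 1], (E 0 10 (F1 0 1 10) (E 2 10 (F1 2 3 10) (E 4 10 (F1 4 5 10)
(E 6 10 (F1 6 7 10) (E 8 10 (F1 8 9 10) (E 0 12 (F1 0 1 12) (E 2 12 (F1 2 3 12)
(E 4 12 (F1 4 5 12) (E 6 12 (F1 6 7 12) (E 8 12 (F1 8 9 12) (E 0 13 (F1 0 1 13)
(E 2 13 (F1 2 3 13) (E 4 13 (F1 4 5 13) (E 6 13 (F1 6 7 13) (E 8 13 (F1 8 9 13)
(E 0 15 (F1 0 1 15) (E 2 15 (F1 2 3 15) (E 4 15 (F1 4 5 15) (E 6 15 (F1 6 7 15)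
(E 8 15 (F1 8 9 15) (Q 0 (F1 0 1 16) (Q 2 (F1 2 3 16) (Q 4 (F1 4 5 16) (Q 6 (F1
6 7 16) (Q 8 (F1 8 9 16) (N [:: 0; 2; 4; 6; 8])))))))))))))))))))))))))));
([:: 3; 2], [:: 2], (E 0 10 (F1 0 1 10) (E 2 10 (F1 2 3 10) (E 4 10 (F1 4 5 10)
(E 6 10 (F1 6 7 10) (E 8 10 (F1 8 9 10) (E 0 14 (F1 0 1 14) (E 2 14 (F1 2 3 14)
(E 4 14 (F1 4 5 14) (E 6 14 (F1 6 7 14) (E 8 14 (F1 8 9 14) (P 0 2 (F2 0 1 15 2
3 15) (P 0 4 (F2 0 1 15 4 5 15) (P 0 6 (F2 0 1 15 6 7 15) (P 0 8 (F2 0 1 15 8 9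
15) (P 0 11 (F2 0 1 15 11 12 15) (P 0 13 (F2 0 1 15 13 14 15) (P 2 4 (F2 2 3 15
4 5 15) (P 2 6 (F2 2 3 15 6 7 15) (P 2 8 (F2 2 3 15 8 9 15) (P 2 11 (F2 2 3 15
11 12 15) (P 2 13 (F2 2 3 15 13 14 15) (P 4 6 (F2 4 5 15 6 7 15) (P 4 8 (F2 4 5
15 8 9 15) (P 4 11 (F2 4 5 15 11 12 15) (P 4 13 (F2 4 5 15 13 14 15) (P 6 8 (F2
6 7 15 8 9 15) (P 6 11 (F2 6 7 15 11 12 15) (P 6 13 (F2 6 7 15 13 14 15) (P 8
11 (F2 8 9 15 11 12 15) (P 8 13 (F2 8 9 15 13 14 15) (Q 0 (F1 0 1 15) (Q 2 (F1
2 3 15) (Q 4 (F1 4 5 15) (Q 6 (F1 6 7 15) (Q 8 (F1 8 9 15) (E 13 10 (E 0 12 (F2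
0 1 12 13 12 10) (E 2 12 (F2 2 3 12 13 12 10) (E 4 12 (F2 4 5 12 13 12 10) (E 6
12 (F2 6 7 12 13 12 10) (E 8 12 (F2 8 9 12 13 12 10) (N [:: 0; 2; 4; 6;
8])))))) (P 11 13 (E 0 12 (F3 0 1 12 11 12 15 13 14 15) (E 2 12 (F3 2 3 12 11
12 15 13 14 15) (E 4 12 (F3 4 5 12 11 12 15 13 14 15) (E 6 12 (F3 6 7 12 11 12
15 13 14 15) (E 8 12 (F3 8 9 12 11 12 15 13 14 15) (N [:: 0; 2; 4; 6; 8]))))))
(E 11 14 (E 0 12 (F2 0 1 12 11 12 14) (E 2 12 (F2 2 3 12 11 12 14) (E 4 12 (F2
4 5 12 11 12 14) (E 6 12 (F2 6 7 12 11 12 14) (E 8 12 (F2 8 9 12 11 12 14) (N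
[:: 0; 2; 4; 6; 8])))))) (H [:: 0; 2; 4; 6; 8; 11;
13]))))))))))))))))))))))))))))))))))))))));
([:: 3; 2], [:: 1; 1], (E 0 10 (F1 0 1 10) (E 2 10 (F1 2 3 10) (E 4 10 (F1 4 5
10) (E 6 10 (F1 6 7 10) (E 8 10 (F1 8 9 10) (E 0 12 (F1 0 1 12) (E 2 12 (F1 2 3
12) (E 4 12 (F1 4 5 12) (E 6 12 (F1 6 7 12) (E 8 12 (F1 8 9 12) (E 0 13 (F1 0 1
13) (E 2 13 (F1 2 3 13) (E 4 13 (F1 4 5 13) (E 6 13 (F1 6 7 13) (E 8 13 (F1 8 9
13) (E 0 15 (F1 0 1 15) (E 2 15 (F1 2 3 15) (E 4 15 (F1 4 5 15) (E 6 15 (F1 6 7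
15) (E 8 15 (F1 8 9 15) (Q 0 (F1 0 1 16) (Q 2 (F1 2 3 16) (Q 4 (F1 4 5 16) (Q 6
(F1 6 7 16) (Q 8 (F1 8 9 16) (N [:: 0; 2; 4; 6; 8])))))))))))))))))))))))))));
([:: 6], [:: 1], (E 0 12 (F1 0 1 12) (E 2 12 (F1 2 3 12) (E 4 12 (F1 4 5 12) (E
6 12 (F1 6 7 12) (E 8 12 (F1 8 9 12) (E 10 12 (F1 10 11 12) (E 0 14 (F1 0 1 14)
(E 2 14 (F1 2 3 14) (E 4 14 (F1 4 5 14) (E 6 14 (F1 6 7 14) (E 8 14 (F1 8 9 14)
(E 10 14 (F1 10 11 14) (Q 0 (F1 0 1 15) (Q 2 (F1 2 3 15) (Q 4 (F1 4 5 15) (Q 6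
(F1 6 7 15) (Q 8 (F1 8 9 15) (Q 10 (F1 10 11 15) (N [:: 0; 2; 4; 6; 8;
10]))))))))))))))))))));
([:: 4; 2], [:: 1], (E 0 12 (F1 0 1 12) (E 2 12 (F1 2 3 12) (E 4 12 (F1 4 5 12)
(E 6 12 (F1 6 7 12) (E 8 12 (F1 8 9 12) (E 10 12 (F1 10 11 12) (E 0 14 (F1 0 1
14) (E 2 14 (F1 2 3 14) (E 4 14 (F1 4 5 14) (E 6 14 (F1 6 7 14) (E 8 14 (F1 8 9
14) (E 10 14 (F1 10 11 14) (Q 0 (F1 0 1 15) (Q 2 (F1 2 3 15) (Q 4 (F1 4 5 15)
(Q 6 (F1 6 7 15) (Q 8 (F1 8 9 15) (Q 10 (F1 10 11 15) (N [:: 0; 2; 4; 6; 8;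
10]))))))))))))))))))));
([:: 3; 3], [:: 1], (E 0 12 (F1 0 1 12) (E 2 12 (F1 2 3 12) (E 4 12 (F1 4 5 12)
(E 6 12 (F1 6 7 12) (E 8 12 (F1 8 9 12) (E 10 12 (F1 10 11 12) (E 0 14 (F1 0 1
14) (E 2 14 (F1 2 3 14) (E 4 14 (F1 4 5 14) (E 6 14 (F1 6 7 14) (E 8 14 (F1 8 9
14) (E 10 14 (F1 10 11 14) (Q 0 (F1 0 1 15) (Q 2 (F1 2 3 15) (Q 4 (F1 4 5 15)
(Q 6 (F1 6 7 15) (Q 8 (F1 8 9 15) (Q 10 (F1 10 11 15) (N [:: 0; 2; 4; 6; 8;
10]))))))))))))))))))));
([:: 2; 2; 2], [:: 1], (E 0 12 (F1 0 1 12) (E 2 12 (F1 2 3 12) (E 4 12 (F1 4 5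
12) (E 6 12 (F1 6 7 12) (E 8 12 (F1 8 9 12) (E 10 12 (F1 10 11 12) (E 0 14 (F1
0 1 14) (E 2 14 (F1 2 3 14) (E 4 14 (F1 4 5 14) (E 6 14 (F1 6 7 14) (E 8 14 (F1
8 9 14) (E 10 14 (F1 10 11 14) (Q 0 (F1 0 1 15) (Q 2 (F1 2 3 15) (Q 4 (F1 4 5
15) (Q 6 (F1 6 7 15) (Q 8 (F1 8 9 15) (Q 10 (F1 10 11 15) (N [:: 0; 2; 4; 6; 8;
10]))))))))))))))))))));
([:: 7], [::], (Q 0 (F1 0 1 14) (Q 2 (F1 2 3 14) (Q 4 (F1 4 5 14) (Q 6 (F1 6 7
14) (Q 8 (F1 8 9 14) (Q 10 (F1 10 11 14) (Q 12 (F1 12 13 14) (N [:: 0; 2; 4; 6;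
8; 10; 12])))))))));
([:: 5; 2], [::], (Q 0 (F1 0 1 14) (Q 2 (F1 2 3 14) (Q 4 (F1 4 5 14) (Q 6 (F1 6
7 14) (Q 8 (F1 8 9 14) (Q 10 (F1 10 11 14) (Q 12 (F1 12 13 14) (N [:: 0; 2; 4;
6; 8; 10; 12])))))))));
([:: 4; 3], [::], (Q 0 (F1 0 1 14) (Q 2 (F1 2 3 14) (Q 4 (F1 4 5 14) (Q 6 (F1 6
7 14) (Q 8 (F1 8 9 14) (Q 10 (F1 10 11 14) (Q 12 (F1 12 13 14) (N [:: 0; 2; 4;
6; 8; 10; 12])))))))));
([:: 3; 2; 2], [::], (Q 0 (F1 0 1 14) (Q 2 (F1 2 3 14) (Q 4 (F1 4 5 14) (Q 6
(F1 6 7 14) (Q 8 (F1 8 9 14) (Q 10 (F1 10 11 14) (Q 12 (F1 12 13 14) (N [:: 0;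
2; 4; 6; 8; 10; 12])))))))))].

End Certificates.

(** * Validity and completeness of the table *)

Lemma certificates_valid :
  all (fun x => check_shape x.1.1 x.1.2 x.2) certificates.
Proof. by vm_compute. Qed.

(** [f] is fuel and should be at least [n]. Bounding the sum by [n] instead of fixing it lists the
    shapes of all admissible sizes at once. *)
Fixpoint compositions (f n : nat) : seq (seq nat) :=
  [::] :: if f is f'.+1 then
            flatten [seq [seq i :: s | s <- compositions f' (n - i)] | i <- iota 1 n]
          else [::].

Lemma mem_compositions f n s :
  n <= f -> all (leq 1) s -> sumn s <= n -> s \in compositions f n.
Proof.
elim: f n s => [|f IHf] n [|i s] //=; first by lia.
move=> nf /andP[i1 s1] sn; rewrite inE /=; apply/flatten_mapP; exists i.
  by rewrite mem_iota; lia.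
by apply: map_f; apply: IHf => //; lia.
Qed.

(** Components can be sorted by size, so only nonincreasing lists need an entry. A cycle has at
    least four vertices, hence at least two in [X]. *)
Lemma certificates_complete :
  all (fun a => all (fun b =>
      [&& sorted geq a, sorted geq b, a != [::] & all (leq 2) a] ==>
      has (fun x => x.1 == (a, b)) certificates)
    (compositions 7 (7 - sumn a))) (compositions 7 7).
Proof. by vm_compute. Qed.

Lemma all_has (V : Type) (p q : pred V) s :
  all p s -> has q s -> exists2 x, p x & q x.
Proof.
by elim: s => //= x s IH /andP[px /IH{}IH] /orP[qx|/IH//]; exists x.
Qed.

Lemma certificate_exists (a b : seq nat) :
    sorted geq a -> sorted geq b -> a != [::] -> all (leq 2) a ->
    all (leq 1) b -> sumn a + sumn b <= 7 ->
  exists c, check_shape a b c.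
Proof.
move=> sa sb a0 a2 b1 ab7.
have a_in : a \in compositions 7 7.
  by apply: mem_compositions; [|apply: sub_all a2 => i /ltnW|lia].
have b_in : b \in compositions 7 (7 - sumn a) by apply: mem_compositions => //; lia.
have := allP (allP certificates_complete _ a_in) _ b_in.
rewrite sa sb a0 a2 implyTb => /(all_has certificates_valid)[x chk /eqP eab].
by exists x.2; move: chk; rewrite eab.
Qed.

Lemma flatten_blocks i sz : flatten (blocks i sz) = iota i (sumn sz).
Proof. by elim: sz i => //= z sz IH i; rewrite IH -iotaD. Qed.

(** Decoding by position recovers the components. The prefix and suffix are arbitrary because cycles
    and paths occupy two successive stretches of one concatenation. *)
Lemma blocks_nth (V : Type) (z : V) (pre post : seq V) (ss : seq (seq V)) :
  [seq [seq nth z (pre ++ flatten ss ++ post) i | i <- b]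
     | b <- blocks (size pre) [seq size s | s <- ss]] = ss.
Proof.
elim: ss pre => //= s ss IH pre; congr (_ :: _).
  apply: (@eq_from_nth _ z); first by rewrite size_map size_iota.
  move=> i; rewrite size_map size_iota => si.
  rewrite (nth_map 0) ?size_iota // nth_iota // nth_cat ltnNge leq_addr /=.
  by rewrite addKn -catA nth_cat si.
by rewrite -size_cat -[in RHS](IH (pre ++ s)) -!catA.
Qed.

(** The padding [s] is cut off by [zip]. It lets one statement serve cycles, zipped with their
    rotation, and paths, zipped with their tail. *)
Lemma path_zip (V : Type) (r : rel V) x q s :
  path r x q -> all (fun d => r d.1 d.2) (zip (belast x q ++ s) q).
Proof. by elim: q x => [|y q IH] x /=; [case: s | case/andP=> -> /IH]. Qed.

Lemma mem_zip (V : eqType) (s t : seq V) i j :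
  (i, j) \in zip s t -> (i \in s) /\ (j \in t).
Proof.
elim: s t => [|a s IH] [|b t] //=; rewrite !inE.
by case/orP => [/eqP[-> ->]|/IH[-> ->]]; rewrite ?eqxx ?orbT.
Qed.

Lemma mem_zip_map (V W : eqType) (g : V -> W) (s t : seq V) i j :
  (i, j) \in zip s t -> (g i, g j) \in zip (map g s) (map g t).
Proof.
elim: s t => [|a s IH] [|b t] //=; rewrite !inE.
by case/orP => [/eqP[-> ->]|/IH ->]; rewrite ?eqxx ?orbT.
Qed.

(** * Systems of cycles and paths *)

Section TwoFactors.

Variables (T : finType) (e : rel T) (X : {set T}).

Local Notation inX := (fun v : T => v \in X).

(** Since paths end outside [X], every vertex of [X] on a component has degree two in it. So the
    system gives degree two to the vertices of [S] and avoids the rest of [X]; which vertices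
    outside [X] occur is left free. *)
Definition two_factor (S : {set T}) (cs ps : seq (seq T)) : Prop :=
  path_system e inX cs ps /\
  {in X, forall x, (x \in flatten (cs ++ ps)) = (x \in S)}.

Definition nbrs (A : {set T}) : {set T} := [set y | [exists x in A, e x y]].

Hypothesis e_sym : symmetric e.
Hypothesis e_bip : forall u v, e u v -> (u \in X) = (v \notin X).

(** * Soundness of certificates *)

Section Soundness.

Variables (S : {set T}) (z : T).
Hypothesis SX : S \subset X.
Hypothesis hallS :
  forall A : {set T}, A \subset S -> 1 < #|A| -> #|A| <= #|Lambda2 e A|.
Hypothesis nbrS : forall A : {set T}, A \subset S -> 0 < #|A| -> #|A| < #|nbrs A|.

Variables (mu m : nat) (base : seq (nat * nat)).

(** [rho] reads codes as vertices, with [z] as a mere default for [nth]. The absences in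
    [model_links] and [model_lone] are relative to [take m rho], the original system, and not to
    [rho], so that they survive the naming of an extra vertex. *)
Record model (bs : seq bool) (pos neg links : seq (nat * nat)) (lone : seq nat)
    (rho : seq T) : Prop := Model {
  model_sort : [seq v \in X | v <- rho] = bs;
  model_uniq : uniq rho;
  model_size : m <= size rho;
  model_cover : {in X, forall x, (x \in rho) = (x \in S)};
  model_pos : forall i j, (i, j) \in pos ->
    [/\ i < size rho, j < size rho & e (nth z rho i) (nth z rho j)];
  model_neg : forall i j, (i, j) \in neg ->
    [/\ i < size rho, j < size rho & ~~ e (nth z rho i) (nth z rho j)];
  model_links : forall i j, (i, j) \in links -> [/\ i < size rho, j < size rho &
    forall y, y \notin take m rho -> ~~ (e (nth z rho i) y && e (nth z rho j) y)];
  model_lone : forall i, i \in lone -> i < size rho /\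
    forall y, y \notin take m rho -> ~~ e (nth z rho i) y }.

Lemma model_inX bs pos neg links lone rho i :
  model bs pos neg links lone rho -> i < size rho ->
  (nth z rho i \in X) = nth false bs i.
Proof. by case=> <- *; rewrite (nth_map z). Qed.

Lemma nth_false_size bs i : nth false bs i -> i < size bs.
Proof. by case: ltnP => // /(nth_default false) ->. Qed.

Lemma model_extend bs pos neg links lone rho y as_ :
    model bs pos neg links lone rho -> size bs = m -> y \notin rho ->
    y \notin X -> all (fun a => (a < size rho) && e (nth z rho a) y) as_ ->
  model (rcons bs false) ([seq (a, m) | a <- as_] ++ pos) neg links lone
    (rcons rho y).
Proof.
case=> sortr ur mr cov pos_r neg_r lk_r ln_r sz_bs y_rho y_X /allP as_y.
have szr : size rho = m by rewrite -sz_bs -sortr size_map.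
have nthr i : i < size rho -> nth z (rcons rho y) i = nth z rho i.
  by move=> ir; rewrite nth_rcons ir.
have taker : take m (rcons rho y) = take m rho.
  by rewrite -cats1 take_cat szr ltnn subnn take0 cats0 -szr take_size.
split; rewrite ?size_rcons ?taker //.
- by rewrite map_rcons sortr (negPf y_X).
- by rewrite rcons_uniq y_rho.
- exact: leqW.
- move=> x xX; rewrite mem_rcons inE -cov //.
  by case: eqP => // xy; rewrite -xy xX in y_X.
- move=> i j; rewrite mem_cat => /orP[/mapP[a /as_y /andP[ar ay] [-> ->]]|].
    by rewrite -szr !ltnS leqnn ltnW // nthr // nth_rcons ltnn eqxx.
  by case/pos_r => ir jr eij; rewrite !nthr //; split=> //; apply: leqW.
- by move=> i j /neg_r[ir jr eij]; rewrite !nthr //; split=> //; apply: leqW.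
- by move=> i j /lk_r[ir jr eij]; rewrite !nthr //; split=> //; apply: leqW.
- by move=> i /ln_r[ir eij]; rewrite nthr //; split=> //; apply: leqW.
Qed.

Lemma path_system_map (V : eqType) (r : rel V) (P r' : pred V) (g : V -> T) cs ps :
    {in P &, injective g} -> {in P &, {homo g : u v / r u v >-> e u v}} ->
    {in P, forall u, (g u \in X) = r' u} -> all P (flatten (cs ++ ps)) ->
  path_system r r' cs ps ->
  path_system e inX [seq map g c | c <- cs] [seq map g p | p <- ps].
Proof.
move=> g_inj g_homo gX allP_ /and3P[u_cp cyc_c yp_p].
have Pin c : c \in cs ++ ps -> all P c.
  move=> c_in; apply/allP => v vc; apply: (allP allP_).
  by apply/flattenP; exists c.
apply/and3P; split.
- rewrite -map_cat -map_flatten map_inj_in_uniq //.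
  by move=> u v /(allP allP_) Pu /(allP allP_); apply: g_inj.
- rewrite all_map; apply/allP => c c_cs /=.
  have := allP cyc_c _ c_cs; have := Pin c; rewrite mem_cat c_cs => /(_ isT).
  case: c c_cs => //= x q _ Pc /and3P[xX sz_q cq]; rewrite gX ?xX; last by case/andP: Pc.
  rewrite size_map sz_q /=.
  exact: (homo_cycle_in g_homo (s := x :: q)).
- rewrite all_map; apply/allP => c c_cs /=.
  have := allP yp_p _ c_cs; have := Pin c; rewrite mem_cat c_cs orbT => /(_ isT).
  case: c c_cs => //= y q _ Pc /and3P[yX lX yq]; rewrite last_map !gX.
  + by rewrite yX lX /=; apply: (homo_path_in g_homo).
  + exact: (allP (Pc : all P (y :: q)) _ (mem_last y q)).
  + by case/andP: Pc.
Qed.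

Lemma image_sub_S bs pos neg links lone rho (A : seq nat) :
    model bs pos neg links lone rho -> uniq A -> all (nth false bs) A ->
  let A' := [set x in [seq nth z rho a | a <- A]] in
  [/\ {in A, forall a, a < size rho}, A' \subset S & #|A'| = size A].
Proof.
move=> mod uA A_bs A'.
have ltA a : a \in A -> a < size rho.
  by move/(allP A_bs)/nth_false_size; rewrite -(model_sort mod) size_map.
split=> //.
  apply/subsetP => x; rewrite inE => /mapP[a aA ->].
  have aX : nth z rho a \in X by rewrite (model_inX mod) ?ltA // (allP A_bs).
  by rewrite -(model_cover mod) // mem_nth // ltA.
rewrite cardsE -(size_map (nth z rho) A); apply/card_uniqP.
rewrite map_inj_in_uniq // => a b aA bA /eqP.
by rewrite nth_uniq ?ltA ?(model_uniq mod) // => /eqP.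
Qed.

Lemma code_of rho y : y \in take m rho -> m <= size rho ->
  exists2 i, i < m & y = nth z rho i.
Proof.
move=> yr mr; have im : index y (take m rho) < m.
  by rewrite -index_mem size_takel // in yr.
by exists (index y (take m rho)) => //; rewrite -(nth_take z im) nth_index.
Qed.

Lemma card_le_count (B : {set T}) (P : pred nat) (bs : seq bool) rho :
    (forall y, y \in B -> exists i, [/\ i < m, ~~ nth false bs i, P i & y = nth z rho i]) ->
  #|B| <= count P [seq i <- iota 0 m | ~~ nth false bs i].
Proof.
move=> B_P; rewrite -size_filter -filter_predI -(size_map (nth z rho)).
rewrite cardE; apply: uniq_leq_size; first exact: enum_uniq.
move=> y; rewrite mem_enum => /B_P[i [im iX Pi ->]].
by rewrite map_f // mem_filter /= Pi iX mem_iota.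
Qed.

(** The actual graph answers each split and selects a branch whose recorded facts are true. A gap
    leaf then contradicts [hallS] or [nbrS], and a [Better] leaf is carried into the graph by
    decoding its components. *)
Lemma check_sound c bs pos neg links lone rho :
    model bs pos neg links lone rho ->
    check mu m base bs pos neg links lone c ->
  exists cs ps, two_factor S cs ps /\ size (flatten cs) < mu.
Proof.
elim: c bs pos neg links lone rho => /=
  [ch|A|A|s y c1 IH1 c2 IH2|a b c1 IH1 c2 IH2|a c1 IH1 c2 IH2]
  bs pos neg links lone rho mod; have szr : size bs = size rho
    by rewrite -(model_sort mod) size_map.
- case: (components _ _) => cs ps /and4P[sys vs_lt cov lt_mu].
  exists [seq map (nth z rho) c | c <- cs], [seq map (nth z rho) p | p <- ps].
  split; last by rewrite -map_flatten size_map.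
  split.
    apply: (@path_system_map _ _ (fun i => i < size bs) _ _ _ _ _ _ _ vs_lt sys).
    + move=> i j ir jr /eqP; rewrite nth_uniq -?szr ?(model_uniq mod) //.
      by move/eqP.
    + by move=> i j _ _ /orP[] /(model_pos mod)[_ _] //; rewrite e_sym.
    + by move=> i ir; rewrite (model_inX mod) // -szr; apply: ir.
  move=> x xX; rewrite -map_cat -map_flatten -(model_cover mod) //.
  apply/mapP/idP => [[i /(allP vs_lt) /= ir ->]|xr].
    by rewrite mem_nth // -szr.
  have ir : index x rho < size rho by rewrite index_mem.
  exists (index x rho); last by rewrite nth_index.
  have := allP cov (index x rho); rewrite mem_iota /= add0n szr ir => /(_ isT).
  by rewrite -(model_inX mod) // nth_index // xX.
- case/and5P=> uA A_bs sz2 closed.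
  have [ltA A'S cA'] := image_sub_S mod uA A_bs; set A' := [set x in _] in A'S cA'.
  have := hallS A'S; rewrite cA' => /(_ sz2) hall few; exfalso.
  have := leq_trans few hall; rewrite ltnNge => /negP; apply.
  apply: (@card_le_count _ _ _ rho) => y; rewrite inE => two.
  have [u [v [uA' vA' uv yu yv]]] : exists u v, [/\ u \in A', v \in A', u != v, e y u & e y v].
    have /card_gt1P[u [v []]] := two; rewrite !inE => /andP[? ?] /andP[? ?] ?.
    by exists u, v; rewrite !inE.
  have [a aA ua] : exists2 a, a \in A & u = nth z rho a.
    by apply/mapP; rewrite inE in uA'.
  have [b bA vb] : exists2 b, b \in A & v = nth z rho b.
    by apply/mapP; rewrite inE in vA'.
  (* A common neighbour of two elements of the set without a code below [m] would contradict [links]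
     or [lone], so all of [Lambda2] is visible to the count over codes. *)
  have yT : y \in take m rho.
    apply/negPn/negP => yT.
    have /orP[/eqP ab|] := allP (allP closed a aA) b bA.
      by rewrite ua vb ab eqxx in uv.
    rewrite e_sym ua in yu; rewrite e_sym vb in yv.
    case/or3P => [/orP[]|al|bl].
    + by case/(model_links mod) => _ _ /(_ y yT); rewrite yu yv.
    + by case/(model_links mod) => _ _ /(_ y yT); rewrite yu yv.
    + by have [_ /(_ y yT)] := model_lone mod al; rewrite yu.
    + by have [_ /(_ y yT)] := model_lone mod bl; rewrite yv.
  have [i im yi] := code_of yT (model_size mod).
  have ir : i < size rho := leq_trans im (model_size mod).
  exists i; split=> //.
    rewrite -(model_inX mod) // -yi (e_bip yu) negbK.
    by apply: (subsetP SX); apply: (subsetP A'S).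
  (* True adjacencies are never listed in [neg], so the number of pairs not refuted is at least the
     true number of neighbours. *)
  apply: leq_trans two _.
  rewrite -size_filter -(size_map (nth z rho)).
  rewrite cardE; apply: uniq_leq_size; first exact: enum_uniq.
  move=> w; rewrite mem_enum !inE => /andP[/mapP[d dA ->] yd].
  rewrite map_f // mem_filter dA andbT.
  apply/negP => /(model_neg mod)[_ _]; rewrite -yi e_sym.
  by rewrite yd.
- case/and5P=> uA A_bs sz1 /allP lone_A.
  have [ltA A'S cA'] := image_sub_S mod uA A_bs; set A' := [set x in _] in A'S cA'.
  have := nbrS A'S; rewrite cA' => /(_ sz1) hall few; exfalso.
  have := leq_ltn_trans few hall; rewrite ltnNge => /negP; apply.
  apply: (@card_le_count _ _ _ rho) => y; rewrite inE.
  case/exists_inP => u; rewrite inE => /mapP[a aA ->] ay.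
  have yT : y \in take m rho.
    apply/negPn/negP => yT.
    by have [_ /(_ y yT)] := model_lone mod (lone_A a aA); rewrite ay.
  have [i im yi] := code_of yT (model_size mod).
  have ir : i < size rho := leq_trans im (model_size mod).
  exists i; split=> //.
    rewrite -(model_inX mod) // -yi -(e_bip ay) .
    by rewrite (model_inX mod) ?ltA ?(allP A_bs).
  apply/hasP; exists a => //; apply/negP => /(model_neg mod)[_ _].
  by rewrite -yi ay.
- case/and4P=> sX y_lt ch1 ch2.
  have s_lt : s < size rho by rewrite -szr nth_false_size.
  rewrite szr in y_lt.
  have [esy|esy] := boolP (e (nth z rho s) (nth z rho y)).
    apply: (IH1 _ _ _ _ _ rho _ ch1); case: mod => *; split=> // i j; rewrite inE.
    by case/orP => [/eqP[-> ->]|]; auto.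
  apply: (IH2 _ _ _ _ _ rho _ ch2); case: mod => *; split=> // i j; rewrite inE.
  by case/orP => [/eqP[-> ->]|]; auto.
- case/and5P=> /eqP bsm aX bX ch1 ch2.
  have a_lt : a < size rho by rewrite -szr nth_false_size.
  have b_lt : b < size rho by rewrite -szr nth_false_size.
  have rm : take m rho = rho by rewrite -bsm szr take_size.
  have [/existsP[y /and3P[yr ay by_]]|none] :=
    boolP [exists y, [&& y \notin rho, e (nth z rho a) y & e (nth z rho b) y]].
    have yX : y \notin X by rewrite -(e_bip ay) (model_inX mod).
    apply: (IH1 _ _ _ _ _ (rcons rho y) _ ch1).
    apply: (@model_extend _ _ _ _ _ _ y [:: a; b] mod) => //=.
    by rewrite a_lt b_lt ay by_.
  apply: (IH2 _ _ _ _ _ rho _ ch2); case: mod => *; split=> // i j; rewrite inE.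
  case/orP => [/eqP[-> ->]|]; last by auto.
  split=> // y; rewrite rm => yr; apply: contra none => ab.
  by apply/existsP; exists y; rewrite yr.
- case/and4P=> /eqP bsm aX ch1 ch2.
  have a_lt : a < size rho by rewrite -szr nth_false_size.
  have rm : take m rho = rho by rewrite -bsm szr take_size.
  have [/existsP[y /andP[yr ay]]|none] :=
    boolP [exists y, (y \notin rho) && e (nth z rho a) y].
    have yX : y \notin X by rewrite -(e_bip ay) (model_inX mod).
    apply: (IH1 _ _ _ _ _ (rcons rho y) _ ch1).
    apply: (@model_extend _ _ _ _ _ _ y [:: a] mod) => //=.
    by rewrite a_lt ay.
  apply: (IH2 _ _ _ _ _ rho _ ch2); case: mod => *; split=> // i; rewrite inE.
  case/orP => [/eqP->|]; last by auto.
  split=> // y; rewrite rm => yr; apply: contra none => ab.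
  by apply/existsP; exists y; rewrite yr.
Qed.

End Soundness.

(** * Parity and membership patterns of components *)

Lemma last_sort u q : path e u q -> (last u q \in X) = (u \in X) (+) odd (size q).
Proof.
elim: q u => [|v q IH] u /=; first by rewrite addbF.
by case/andP=> /e_bip -> /IH ->; case: (v \in X) (odd _) => [] [].
Qed.

Lemma path_alternation u q :
  path e u q -> [seq v \in X | v <- u :: q] = alternation (u \in X) (size q).+1.
Proof.
elim: q u => [|v q IH] u //= /andP[/e_bip uv /IH /= ->].
by rewrite uv negbK.
Qed.

Lemma xcycle_size c : xcycle e inX c -> size c = (size c)./2.*2.
Proof.
case: c => // x q /and3P[/= xX _ /last_sort]; rewrite last_rcons size_rcons xX /=.
move=> odd_q; rewrite -[LHS]odd_double_half /=.
by move: odd_q; case: (odd (size q)).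
Qed.

Lemma ypath_size p : ypath e inX p -> size p = (size p)./2.*2.+1.
Proof.
case: p => // y q /and3P[/= yX lX /last_sort].
rewrite (negPf yX) (negPf lX) /= => odd_q.
by rewrite -[LHS]odd_double_half /= -odd_q.
Qed.

Lemma xcycle_alternation c :
  xcycle e inX c -> [seq v \in X | v <- c] = alternation true (size c).
Proof.
case: c => // x q /and3P[/= xX _]; rewrite rcons_path => /andP[xq _].
by have /= -> := path_alternation xq; rewrite xX.
Qed.

Lemma ypath_alternation p :
  ypath e inX p -> [seq v \in X | v <- p] = alternation false (size p).
Proof.
case: p => // y q /and3P[/= yX _ yq].
by have /= -> := path_alternation yq; rewrite (negPf yX).
Qed.

Lemma count_alternation b n : count id (alternation b n) = (b + n)./2.
Proof.
elim: n b => [|n IH] [] //=; rewrite IH /=; lia.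
Qed.

Lemma two_factor_perm S cs ps cs' ps' :
  perm_eq cs cs' -> perm_eq ps ps' -> two_factor S cs ps -> two_factor S cs' ps'.
Proof.
move=> pc pp [/and3P[u cyc yp] cov].
have pf : perm_eq (flatten (cs ++ ps)) (flatten (cs' ++ ps')).
  by apply: perm_flatten; apply: perm_cat.
split; last by move=> x xX; rewrite -(perm_mem pf) cov.
by apply/and3P; rewrite -(perm_uniq pf) -(perm_all _ pc) -(perm_all _ pp).
Qed.

(** A path with a single vertex lies outside [X], so dropping it changes nothing about coverage. The
    table lists only paths that meet [X]. *)
Lemma two_factor_filter S cs ps :
  two_factor S cs ps -> two_factor S cs [seq p <- ps | 1 < size p].
Proof.
move=> [/and3P[u cyc yp] cov]; split; first (apply/and3P; split=> //).
- apply: subseq_uniq u; rewrite !flatten_cat; apply: cat_subseq => //.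
  elim: (ps) => //= p qs IH; case: ifP => _ /=; first by rewrite cat_subseq.
  by apply: subseq_trans IH _; apply: suffix_subseq.
- by apply/allP => p; rewrite mem_filter => /andP[_ /(allP yp)].
move=> x xX; rewrite -cov // !flatten_cat !mem_cat; congr (_ || _).
apply/flattenP/flattenP => -[p]; first by rewrite mem_filter => /andP[_ ?]; exists p.
move=> p_ps xp; exists p => //; rewrite mem_filter p_ps andbT.
have := allP yp p p_ps; case: p xp {p_ps} => //= y [|v q] //=.
by rewrite inE => /eqP <-; rewrite xX.
Qed.

Lemma two_factor_card (S : {set T}) cs ps : S \subset X -> two_factor S cs ps ->
  #|S| = sumn [seq (size c)./2 | c <- cs] + sumn [seq (size p)./2 | p <- ps].
Proof.
move=> SX [/and3P[u cyc yp] cov].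
have -> : #|S| = count inX (flatten (cs ++ ps)).
  rewrite -size_filter -(card_uniqP (filter_uniq inX u)).
  apply: eq_card => x; rewrite mem_filter.
  have [xX|xX] /= := boolP (x \in X); first by rewrite cov.
  by apply: contraNF xX => /(subsetP SX).
rewrite flatten_cat count_cat; congr (_ + _); rewrite count_flatten; congr (sumn _).
  apply/eq_in_map => c /(allP cyc) cc /=.
  have -> : count inX c = count id [seq v \in X | v <- c] by rewrite count_map.
  rewrite xcycle_alternation // count_alternation (xcycle_size cc).
  by rewrite /= uphalf_double half_double.
apply/eq_in_map => p /(allP yp) pp /=.
have -> : count inX p = count id [seq v \in X | v <- p] by rewrite count_map.
by rewrite ypath_alternation // count_alternation.
Qed.

(** * Elimination of cycles *)

Section Improve.

Variable S : {set T}.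
Hypothesis SX : S \subset X.
Hypothesis S7 : #|S| <= 7.
Hypothesis hallS :
  forall A : {set T}, A \subset S -> 1 < #|A| -> #|A| <= #|Lambda2 e A|.
Hypothesis nbrS : forall A : {set T}, A \subset S -> 0 < #|A| -> #|A| < #|nbrs A|.

(** Half the size of a component, rounded down, is its number of vertices in [X]. The two sorted
    lists of halves therefore form a shape of the table, and what remains is to see that the system
    is a model of the initial state of the checker. *)
Lemma two_factor_improve_sorted cs ps :
    two_factor S cs ps -> cs != [::] -> all (fun p => 1 < size p) ps ->
    sorted geq [seq (size c)./2 | c <- cs] ->
    sorted geq [seq (size p)./2 | p <- ps] ->
  exists cs' ps', two_factor S cs' ps' /\ size (flatten cs') < size (flatten cs).
Proof.
move=> tf cs0 ps1 sa sb; have cardS := two_factor_card SX tf.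
set a := map _ cs in sa cardS; set b := map _ ps in sb cardS.
case: (tf) => /and3P[u /allP cyc /allP yp] cov.
have za : [seq l.*2 | l <- a] = [seq size c | c <- cs].
  by rewrite -map_comp; apply/eq_in_map => c /cyc cc /=; rewrite -xcycle_size.
have zb : [seq l.*2.+1 | l <- b] = [seq size p | p <- ps].
  by rewrite -map_comp; apply/eq_in_map => p /yp pp /=; rewrite -ypath_size.
have [c0 chk] : exists c, check_shape a b c.
  apply: certificate_exists => //; last by rewrite -cardS.
  - by rewrite -size_eq0 size_map size_eq0.
  - apply/allP => l /mapP[c /cyc cc ->].
    have := xcycle_size cc; case: c cc => // x q /and3P[_ + _]; lia.
  - apply/allP => l /mapP[p p_ps ->].
    have := ypath_size (yp p p_ps); have := allP ps1 p p_ps; lia.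
have z : T.
  case: (cs) cs0 cyc => // -[|x q] cs' _ cyc'; last exact: x.
  by have := cyc' [::] (mem_head _ _).
move: chk; rewrite /check_shape za zb; set bs := flatten _; set base := flatten _.
have szcs : size (flatten cs) = sumn [seq size c | c <- cs] by rewrite size_flatten.
(* A code is a position in the concatenated components. At the start the positive facts are exactly
   the edges of the system, and no absence is assumed. *)
rewrite szcs; apply: (@check_sound S z SX hallS nbrS _ _ _ c0 _ _ _ _ _ (flatten (cs ++ ps))).
have bsE : [seq v \in X | v <- flatten (cs ++ ps)] = bs.
  rewrite map_flatten /bs map_cat -!map_comp; congr (flatten (_ ++ _)).
    by apply/eq_in_map => c /cyc /= /xcycle_alternation.
  by apply/eq_in_map => p /yp /= /ypath_alternation.
have szbs : size bs = size (flatten (cs ++ ps)) by rewrite -bsE size_map.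
split=> //; first by rewrite szbs.
have := blocks_nth z [::] (flatten ps) cs; rewrite /= -flatten_cat => blk_c.
have := blocks_nth z (flatten cs) [::] ps; rewrite cats0 -flatten_cat szcs => blk_p.
set g := nth z _ in blk_c blk_p *.
have szE : size (flatten (cs ++ ps)) = sumn [seq size c | c <- cs] + sumn [seq size p | p <- ps].
  by rewrite size_flatten /shape map_cat sumn_cat.
move=> i j /flattenP[ds]; rewrite mem_cat => /orP[] /mapP[c0' c_in ->] ij.
  have lt i' : i' \in c0' -> i' < size (flatten (cs ++ ps)).
    move=> i'c; have : i' \in flatten (blocks 0 [seq size c | c <- cs]).
      by apply/flattenP; exists c0'.
    by rewrite flatten_blocks mem_iota szE; lia.
  have [ic jc] := mem_zip ij; rewrite mem_rot in jc; split; try exact: lt.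
  have : map g c0' \in cs by rewrite -blk_c map_f.
  move/cyc; have := mem_zip_map g ij; rewrite map_rot.
  case: (map g c0') => // x q; rewrite rot1_cons => gij /and3P[_ _ xq].
  have := path_zip [::] xq; rewrite cats0 belast_rcons.
  by move/allP/(_ (g i, g j)); apply.
have lt i' : i' \in c0' -> i' < size (flatten (cs ++ ps)).
  move=> i'c.
  have : i' \in flatten (blocks (sumn [seq size c | c <- cs]) [seq size p | p <- ps]).
    by apply/flattenP; exists c0'.
  by rewrite flatten_blocks mem_iota szE; lia.
have [ic /mem_behead jc] := mem_zip ij; split; try exact: lt.
have : map g c0' \in ps by rewrite -blk_p map_f.
move/yp; have := mem_zip_map g ij; rewrite -behead_map.
case: (map g c0') => // y q /= gij /and3P[_ _ yq].
have := path_zip [:: last y q] yq; rewrite cats1 -lastI.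
by move/allP/(_ (g i, g j)); apply.
Qed.

Lemma two_factor_improve cs ps :
    two_factor S cs ps -> cs != [::] ->
  exists cs' ps', two_factor S cs' ps' /\ size (flatten cs') < size (flatten cs).
Proof.
move=> tf cs0; pose ge_size (c d : seq T) := (size d)./2 <= (size c)./2.
have tot : total ge_size by move=> c d; apply: leq_total.
have srt cs1 : sorted geq [seq (size c)./2 | c <- sort ge_size cs1].
  by rewrite sorted_map; apply: (sort_sorted tot).
have perm_s cs1 : perm_eq cs1 (sort ge_size cs1) by rewrite perm_sym perm_sort.
pose ps1 := [seq p <- ps | 1 < size p].
have tf1 := two_factor_perm (perm_s cs) (perm_s ps1) (two_factor_filter tf).
have [||cs' [ps' [tf' lt']]] := two_factor_improve_sorted tf1 _ _ (srt _) (srt _).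
- by rewrite -size_eq0 size_sort size_eq0.
- by rewrite all_sort filter_all.
exists cs', ps'; split=> //.
by rewrite (perm_size (perm_flatten (perm_s cs))).
Qed.

Lemma two_factor_linear cs ps :
  two_factor S cs ps -> exists ps', two_factor S [::] ps'.
Proof.
have [n] := ubnP (size (flatten cs)).
elim: n cs ps => // n IH cs ps lt_n tf.
have [cs0|cs0] := eqVneq cs [::]; first by exists ps; rewrite cs0 in tf.
have [cs' [ps' [tf' lt']]] := two_factor_improve tf cs0.
by apply: IH tf'; lia.
Qed.

End Improve.

(** * Existence of a system *)

Section TwoMatching.

Variable S : {set T}.
Hypothesis SX : S \subset X.
Hypothesis hallS :
  forall A : {set T}, A \subset S -> 1 < #|A| -> #|A| <= #|Lambda2 e A|.
Hypothesis nbrS : forall A : {set T}, A \subset S -> 0 < #|A| -> #|A| < #|nbrs A|.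

Implicit Types (F : {set T * T}) (s x y : T).

Definition deg_src F s := #|[set y | (s, y) \in F]|.
Definition deg_tgt F y := #|[set s | (s, y) \in F]|.

Definition two_matching F :=
  [&& [forall d in F, (d.1 \in S) && e d.1 d.2],
      [forall s, deg_src F s <= 2] & [forall y, deg_tgt F y <= 2]].

Lemma two_matchingP F : reflect
  [/\ forall s y, (s, y) \in F -> (s \in S) /\ e s y,
      forall s, deg_src F s <= 2 & forall y, deg_tgt F y <= 2] (two_matching F).
Proof.
apply: (iffP and3P) => -[FS /forallP Fs /forallP Fy]; split=> //.
- by move=> s y sy; have /andP[] := forall_inP FS _ sy.
- by apply/forall_inP => -[s y] /FS[/= -> ->].
Qed.

Lemma deg_srcU F s y s' : deg_src ((s, y) |: F) s' <= (s == s') + deg_src F s'.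
Proof.
rewrite /deg_src; case: eqP => [<-|ss'] /=.
  apply: (@leq_trans #|y |: [set y' | (s, y') \in F]|); last first.
    by rewrite cardsU1 leq_add2r leq_b1.
  apply: subset_leq_card; apply/subsetP => y'; rewrite !inE.
  by case/orP => [/eqP[->]|->]; rewrite ?eqxx ?orbT.
apply: subset_leq_card; apply/subsetP => y'; rewrite !inE.
by case/orP => // /eqP[/esym].
Qed.

Lemma deg_tgtU F s y y' : deg_tgt ((s, y) |: F) y' <= (y == y') + deg_tgt F y'.
Proof.
rewrite /deg_tgt; case: eqP => [<-|ss'] /=.
  apply: (@leq_trans #|s |: [set s' | (s', y) \in F]|); last first.
    by rewrite cardsU1 leq_add2r leq_b1.
  apply: subset_leq_card; apply/subsetP => s'; rewrite !inE.
  by case/orP => [/eqP[->]|->]; rewrite ?eqxx ?orbT.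
apply: subset_leq_card; apply/subsetP => s'; rewrite !inE.
by case/orP => // /eqP[_ /esym].
Qed.

Lemma deg_srcD F s y s' :
  (s, y) \in F -> deg_src (F :\ (s, y)) s' + (s == s') <= deg_src F s'.
Proof.
move=> sy; rewrite /deg_src; case: eqP => [<-|ss'] /=.
  rewrite addn1; apply: proper_card; apply/properP; split.
    by apply/subsetP => y'; rewrite !inE => /andP[].
  by exists y; rewrite !inE ?eqxx.
by rewrite addn0; apply: subset_leq_card; apply/subsetP => y'; rewrite !inE => /andP[].
Qed.

Lemma deg_tgtD F s y y' :
  (s, y) \in F -> deg_tgt (F :\ (s, y)) y' + (y == y') <= deg_tgt F y'.
Proof.
move=> sy; rewrite /deg_tgt; case: eqP => [<-|ss'] /=.
  rewrite addn1; apply: proper_card; apply/properP; split.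
    by apply/subsetP => s'; rewrite !inE => /andP[].
  by exists s; rewrite !inE ?eqxx.
by rewrite addn0; apply: subset_leq_card; apply/subsetP => s'; rewrite !inE => /andP[].
Qed.

Lemma two_matchingU F s y :
    two_matching F -> s \in S -> e s y -> deg_src F s < 2 -> deg_tgt F y < 2 ->
  two_matching ((s, y) |: F).
Proof.
case/two_matchingP => FS Fs Fy sS sy ds dy; apply/two_matchingP; split.
- by move=> s' y'; rewrite !inE => /orP[/eqP[-> ->]|/FS].
- move=> s'; apply: leq_trans (deg_srcU _ _ _ _) _.
  by case: eqP => [<-|_]; [exact: ds | exact: Fs].
- move=> y'; apply: leq_trans (deg_tgtU _ _ _ _) _.
  by case: eqP => [<-|_]; [exact: dy | exact: Fy].
Qed.

Lemma two_matchingD F d : two_matching F -> two_matching (F :\ d).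
Proof.
case/two_matchingP => FS Fs Fy; apply/two_matchingP; split.
- by move=> s' y'; rewrite !inE => /andP[_ /FS].
- move=> s'; apply: leq_trans (Fs s').
  by apply: subset_leq_card; apply/subsetP => y'; rewrite !inE => /andP[].
- move=> s'; apply: leq_trans (Fy s').
  by apply: subset_leq_card; apply/subsetP => y'; rewrite !inE => /andP[].
Qed.

(** Two consecutive edges of an alternating path: from [y] along [F] to [s], then off [F] to [y'].
    Recording only the vertices on the target side turns reachability into plain [connect]. *)
Definition alternates F : rel T := fun y y' =>
  [exists s in S, [&& (s, y) \in F, e s y' & (s, y') \notin F]].

(** Replacing the edge from [s'] to [y] by the one from [s] to [y] keeps the size of [F] and moves
    the deficit from [s] to [s'], one step further along the path. At the last vertex there is room
    for a new edge. *)
Lemma two_matching_augment F s y p :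
    two_matching F -> s \in S -> deg_src F s < 2 -> e s y -> (s, y) \notin F ->
    path (alternates F) y p -> uniq (y :: p) -> deg_tgt F (last y p) < 2 ->
  exists F', two_matching F' /\ #|F'| = #|F|.+1.
Proof.
elim: p F s y => [|y2 p IH] F s y tF sS ds sy syF.
  move=> _ _ dy; exists ((s, y) |: F); split; first exact: two_matchingU.
  by rewrite cardsU1 syF.
move=> /= /andP[/exists_inP[s' s'S /and3P[s'y s'y2 s'y2F]] alt_p] /andP[yp up] dl.
have s's : s' != s by apply: contraNneq syF => <-.
pose F0 := F :\ (s', y); pose F1 := (s, y) |: F0.
have tF0 : two_matching F0 by exact: two_matchingD.
have syF0 : (s, y) \notin F0 by rewrite inE (negPf syF) andbF.
have [_ Fs Fy] := two_matchingP _ tF.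
have dF0s : deg_src F0 s < 2.
  apply: leq_ltn_trans ds; apply: leq_trans (deg_srcD s s'y).
  exact: leq_addr.
have dF0y : deg_tgt F0 y < 2.
  by have := leq_trans (deg_tgtD y s'y) (Fy y); rewrite eqxx addn1.
have tF1 : two_matching F1 by exact: two_matchingU.
have dF1s' : deg_src F1 s' < 2.
  apply: leq_ltn_trans (deg_srcU F0 s y s') _; rewrite eq_sym (negPf s's).
  by have := leq_trans (deg_srcD s' s'y) (Fs s'); rewrite eqxx addn1.
(* Only pairs with target [y] have changed, and [y] does not recur on the path; hence the rest of
   the path still alternates for [F1]. *)
have F1E u v : v != y -> ((u, v) \in F1) = ((u, v) \in F).
  by move=> vy; rewrite !inE !xpair_eqE (negPf vy) !andbF.
have neqy v : v \in y2 :: p -> v != y by apply: contraTneq => ->.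
have cF1 : #|F1| = #|F| by rewrite cardsU1 syF0 (cardsD1 (s', y) F) s'y.
rewrite -cF1; apply: (IH F1 s' y2) => //.
- by rewrite F1E // neqy ?mem_head.
- rewrite (@eq_in_path _ (mem (y2 :: p)) _ (alternates F)) //; last exact/allP.
  move=> u v /neqy uy /neqy vy; apply: eq_existsb => w.
  by rewrite !F1E.
- rewrite /deg_tgt (_ : [set w | (w, _) \in F1] = [set w | (w, last y2 p) \in F]) //.
  by apply/setP => w; rewrite [LHS]inE [RHS]inE F1E // neqy // mem_last.
Qed.

Lemma card_set_sum (P : pred T) : #|[set y | P y]| = \sum_y (P y : nat).
Proof. by rewrite -sum1_card big_mkcond; apply: eq_bigr => y _; rewrite inE; case: (P y). Qed.

Lemma sum_deg_src F (A : {set T}) :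
  \sum_(a in A) deg_src F a = \sum_y #|[set a in A | (a, y) \in F]|.
Proof.
under eq_bigr do rewrite /deg_src card_set_sum.
rewrite exchange_big; apply: eq_bigr => y _.
rewrite card_set_sum big_mkcond /=; apply: eq_bigr => a _.
by case: (a \in A).
Qed.

(** Take [F] of maximum size and suppose that [s0] has fewer than two edges. The vertices reachable
    by alternation from [s0] are saturated. Double counting the edges of [F] at the set [A] of [s0]
    and the partners of reachable vertices gives fewer than [2|A|] from the side of [A], but at
    least [|nbrs A| + |Lambda2 A|] from the other. *)
Lemma perfect_two_matching :
  exists2 F, two_matching F & {in S, forall s, deg_src F s = 2}.
Proof.
have tm0 : two_matching set0.
  apply/two_matchingP; split=> [s y|s|y]; rewrite ?inE //.
    by rewrite /deg_src (_ : [set _ | _] = set0) ?cards0 //; apply/setP => y; rewrite !inE.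
  by rewrite /deg_tgt (_ : [set _ | _] = set0) ?cards0 //; apply/setP => s; rewrite !inE.
have [F tF maxF] := @arg_maxnP _ set0 two_matching (fun F => #|F|) tm0.
exists F => // s0 s0S; apply/eqP.
have [FS Fs Fy] := two_matchingP _ tF.
rewrite eqn_leq Fs leqNgt; apply/negP => ds0.
pose reach := [set y | [exists y1, [&& e s0 y1, (s0, y1) \notin F & connect (alternates F) y1 y]]].
have full_reach y : y \in reach -> deg_tgt F y = 2.
  rewrite inE => /existsP[y1 /and3P[sy1 sy1F /connectP[p0 path_p0 ->]]].
  case/shortenP: path_p0 => p path_p up _.
  apply/eqP; rewrite eqn_leq Fy leqNgt; apply/negP => dl.
  have [F' [tF' cF']] := two_matching_augment tF s0S ds0 sy1 sy1F path_p up dl.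
  by have /= := maxF F' tF'; rewrite /geq /= cF' ltnn.
pose A := s0 |: [set s | [exists y in reach, (s, y) \in F]].
have AS : A \subset S.
  apply/subsetP => s; rewrite !inE => /orP[/eqP->//|/exists_inP[y _ /FS[]]] //.
have A_reach a y : a \in A -> e a y -> (a, y) \notin F -> y \in reach.
  rewrite !inE => /orP[/eqP-> ay ayF|/exists_inP[y1 y1r y1a] ay ayF].
    by apply/existsP; exists y; rewrite ay ayF connect0.
  move: y1r; rewrite inE => /existsP[y0 /and3P[sy0 sy0F con]].
  apply/existsP; exists y0; rewrite sy0 sy0F /=; apply: connect_trans con _.
  by apply: connect1; apply/exists_inP; exists a; rewrite ?y1a ?ay ?ayF //; case: (FS _ _ y1a).
have cA : 0 < #|A| by apply/card_gt0P; exists s0; rewrite !inE eqxx.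
(* For a singleton the strict bound alone gives two neighbours; otherwise both bounds are added. *)
have le2A : #|A|.*2 <= #|nbrs A| + #|Lambda2 e A|.
  have := nbrS AS cA; have [A1|A2] := leqP #|A| 1; first by lia.
  by have := hallS AS A2; lia.
have ltA : \sum_(a in A) deg_src F a < #|A|.*2.
  rewrite (bigD1 s0) /=; last by rewrite !inE eqxx.
  rewrite (cardsD1 s0) !inE eqxx /= doubleS -addn2 addnC -addnS leq_add //.
  rewrite -muln2 -sum_nat_const; rewrite [X in _ <= X](eq_bigl (fun a => (a \in A) && (a != s0))).
    by apply: leq_sum => a _.
  by move=> a; rewrite !inE andbC.
(* A vertex [y] contributes the minimum of two and its number of neighbours in [A] on the left. If
   [y] is reachable, it has two edges of [F], both into [A]; if not, all its edges to [A] belong to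
   [F]. *)
suff : #|nbrs A| + #|Lambda2 e A| <= \sum_(a in A) deg_src F a by lia.
rewrite sum_deg_src /nbrs /Lambda2 !card_set_sum -big_split /=.
apply: leq_sum => y _; set cF := #|[set a in A | (a, y) \in F]|.
have [yr|yr] := boolP (y \in reach).
  have -> : cF = 2.
    rewrite -(full_reach y yr); apply: eq_card => s; rewrite [LHS]inE [RHS]inE.
    apply: andb_idl => sF; rewrite !inE; apply/orP; right.
    by apply/exists_inP; exists y.
  exact: (leq_add (leq_b1 _) (leq_b1 _)).
suff le_c : #|[set u in A | e y u]| <= cF.
  apply: leq_trans le_c; set B := [set u in A | _].
  have -> : [exists x in A, e x y] = (0 < #|B|).
    apply/exists_inP/card_gt0P => [[x xA xy]|[x]]; first by exists x; rewrite inE xA e_sym.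
    by rewrite inE => /andP[xA yx]; exists x; rewrite // e_sym.
  by case: #|B| => [|[|n]].
apply: subset_leq_card; apply/subsetP => a /setIdP[aA ya].
rewrite inE aA /=; apply: contraNT yr => ayF.
by apply: (A_reach a) => //; rewrite e_sym.
Qed.

End TwoMatching.

End TwoFactors.

Section Covering.

Variables (T : finType) (e : rel T) (X : {set T}).

Local Notation inX := (fun v : T => v \in X).

Hypothesis e_sym : symmetric e.
Hypothesis e_bip : forall u v, e u v -> (u \in X) = (v \notin X).

(** * From a two-matching to cycles and paths *)

Section Decomposition.

Variable r : rel T.
Hypothesis r_sym : symmetric r.

Lemma rev_ypath p : ypath r inX p -> ypath r inX (rev p).
Proof.
case: p => // y q /and3P[/= yX lX yq]; rewrite lastI rev_rcons /= lX.
have -> : last (last y q) (rev (belast y q)) = y.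
  by rewrite -[LHS](last_cons y) -rev_rcons -lastI rev_cons last_rcons.
by rewrite yX /= (eq_path (e' := fun z => r^~ z)) ?rev_path // => u v; rewrite r_sym.
Qed.

(** Brings [y] to the front of a path, reversing the path if [y] is its last vertex, or starting a
    one-vertex path if [y] is on none. The final disjunction remembers the origin of the path, so
    that its other end can still be recognised. *)
Lemma end_first ps y :
    all (ypath r inX) ps -> y \notin X ->
    (forall p, p \in ps -> y \in p -> (y == head y p) || (y == last y p)) ->
  exists q ps', [/\ ypath r inX (y :: q), all (ypath r inX) ps',
    {subset ps' <= ps},
    perm_eq (flatten ((y :: q) :: ps'))
      (if y \in flatten ps then flatten ps else y :: flatten ps)
  & [\/ y :: q \in ps, rev (y :: q) \in ps | q = [::]]].
Proof.
move=> yps yX y_end; case: ifP => [/flattenP[p p_ps yp]|_]; last first.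
  exists [::], ps; split; rewrite //= ?yX //; by constructor 3.
have perm_p := perm_to_rem p_ps.
have yps' : all (ypath r inX) (rem p ps).
  by apply/allP => p' /mem_rem; apply: (allP yps).
have sub' : {subset rem p ps <= ps} by move=> p' /mem_rem.
have perm_f := perm_flatten perm_p; rewrite perm_sym in perm_f.
have yp_p := allP yps p p_ps.
case/orP: (y_end p p_ps yp) => /eqP y_eq.
  case: p p_ps yp perm_p yps' sub' perm_f yp_p y_eq => // y' q.
  move=> p_ps _ _ yps' sub' perm_f yp_p /= y_eq.
  rewrite -y_eq in p_ps yps' sub' perm_f yp_p.
  by exists q, (rem (y :: q) ps); split=> //; constructor 1.
have := rev_ypath yp_p; have := revK p.
case/lastP: p p_ps yp perm_p yps' sub' perm_f yp_p y_eq => // p y'.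
rewrite last_rcons rev_rcons => p_ps _ _ yps' sub' perm_f yp_p y_eq; rewrite -y_eq => rK yp_r.
rewrite -y_eq in p_ps yps' sub' perm_f yp_p.
exists (rev p), (rem (rcons p y) ps); split=> //; last by constructor 2; rewrite rK.
apply: perm_trans perm_f => /=.
by rewrite -cat_cons perm_cat2r -rev_rcons perm_rev.
Qed.

(** The new vertex [x] links two path ends. If they are the two ends of one path, a cycle results;
    otherwise two paths merge through [x]. *)
Lemma path_system_add cs ps x y1 y2 :
    path_system r inX cs ps -> x \in X -> x \notin flatten (cs ++ ps) ->
    y1 \notin X -> y2 \notin X -> y1 != y2 -> r x y1 -> r x y2 ->
    y1 \notin flatten cs -> y2 \notin flatten cs ->
    (forall y p, y \in [:: y1; y2] -> p \in ps -> y \in p ->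
       (y == head y p) || (y == last y p)) ->
  exists cs' ps', path_system r inX cs' ps' /\
    {in X, forall v, (v \in flatten (cs' ++ ps')) = (v == x) || (v \in flatten (cs ++ ps))}.
Proof.
move=> /and3P[u cyc yps] xX x_fl y1X y2X y12 xy1 xy2 y1c y2c y_end.
have [|q1 [ps1 [yq1 yps1 sub1 perm1 q1_ps]]] := @end_first ps y1 yps y1X.
  by move=> p p_ps yp; apply: y_end => //; rewrite !inE eqxx.
rewrite flatten_cat in u x_fl.
have x1 : x \notin flatten ((y1 :: q1) :: ps1).
  rewrite (perm_mem perm1); move: x_fl; rewrite mem_cat negb_or => /andP[_ xps].
  case: ifP => // _; rewrite inE negb_or xps andbT.
  by apply: contraNneq y1X => <-.
have u1 : uniq (flatten cs ++ flatten ((y1 :: q1) :: ps1)).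
  rewrite (perm_uniq (perm_cat (perm_refl _) perm1)); case: ifP => // /negbT y1ps.
  by rewrite uniq_catC /= mem_cat negb_or y1ps y1c uniq_catC.
have cov1 v : v \in X -> (v \in flatten ((y1 :: q1) :: ps1)) = (v \in flatten ps).
  move=> vX; rewrite (perm_mem perm1); case: ifP => // _; rewrite inE.
  by case: eqP => // vy; rewrite -vy vX in y1X.
have xc : x \notin flatten cs by move: x_fl; rewrite mem_cat negb_or => /andP[].
(* When [y2] is on the path that starts at [y1], it must be its other end, and [x] closes the path
   into a cycle. *)
have [y2q|y2q] := boolP (y2 \in y1 :: q1).
  have y2l : y2 = last y1 q1.
    have hl : (y2 == y1) || (y2 == last y1 q1).
      case: q1_ps => [q_in|q_in|q0].
      + by have := y_end y2 _ _ q_in y2q; rewrite !inE eqxx orbT; apply.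
      + have := y_end y2 _ _ q_in; rewrite mem_rev y2q !inE eqxx orbT => /(_ isT isT).
        rewrite {2}rev_cons last_rcons lastI rev_rcons /= orbC.
        by [].
      + by move: y2q; rewrite q0 inE => ->.
    by move: hl; rewrite eq_sym (negPf y12) => /eqP.
  exists ((x :: y1 :: q1) :: cs), ps1.
  have perm3 : perm_eq (flatten (((x :: y1 :: q1) :: cs) ++ ps1))
                       (x :: flatten cs ++ flatten ((y1 :: q1) :: ps1)).
    have -> : flatten (((x :: y1 :: q1) :: cs) ++ ps1) =
              x :: (y1 :: q1) ++ flatten cs ++ flatten ps1.
      by rewrite flatten_cat /= catA.
    by rewrite perm_cons perm_catCA.
  split; last first.
    move=> v vX; rewrite (perm_mem perm3) inE flatten_cat.
    by rewrite [v \in _ ++ _]mem_cat (cov1 v vX) [in RHS]mem_cat.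
  apply/and3P; split=> //.
    by rewrite (perm_uniq perm3) cons_uniq u1 mem_cat negb_or xc x1.
  move: yq1 => /and3P[_ _ yq] /=; rewrite xX xy1 rcons_path yq /= -y2l r_sym xy2 cyc.
  by rewrite !andbT; case: (q1) y2l y12 => //= ->; rewrite eqxx.
have [|q2 [ps2 [yq2 yps2 sub2 perm2 _]]] := @end_first ps1 y2 yps1 y2X.
  by move=> p /sub1 p_ps yp; apply: y_end => //; rewrite !inE eqxx orbT.
have cov2 v : v \in X -> (v \in flatten ((y2 :: q2) :: ps2)) = (v \in flatten ps1).
  move=> vX; rewrite (perm_mem perm2); case: ifP => // _; rewrite inE.
  by case: eqP => // vy; rewrite -vy vX in y2X.
pose p' := rev (y1 :: q1) ++ x :: y2 :: q2.
have perm3 : perm_eq (flatten (p' :: ps2)) (x :: (y1 :: q1) ++ flatten ((y2 :: q2) :: ps2)).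
  have -> : flatten (p' :: ps2) = rev (y1 :: q1) ++ [:: x] ++ flatten ((y2 :: q2) :: ps2).
    by rewrite /p' [LHS]/= -catA.
  by rewrite perm_catCA cat1s perm_cons perm_cat2r perm_rev.
have perm4 : perm_eq (flatten (cs ++ (p' :: ps2)))
    (x :: flatten cs ++ (y1 :: q1) ++ flatten ((y2 :: q2) :: ps2)).
  rewrite flatten_cat; apply: perm_trans (perm_cat (perm_refl _) perm3) _.
  by rewrite -cat1s perm_catCA.
have y2c' : y2 \notin flatten cs ++ y1 :: q1 by rewrite mem_cat negb_or y2c.
exists cs, (p' :: ps2); split; last first.
  move=> v vX; rewrite (perm_mem perm4) inE flatten_cat [in RHS]mem_cat -(cov1 v vX).
  rewrite mem_cat [v \in (y1 :: q1) ++ _]mem_cat (cov2 v vX).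
  by rewrite [flatten (_ :: ps1)]/= -cat_cons [in RHS]mem_cat.
apply/and3P; split=> //.
  rewrite (perm_uniq perm4) cons_uniq; apply/andP; split.
    rewrite mem_cat negb_or xc /= [x \in (y1 :: q1) ++ _]mem_cat (cov2 x xX).
    by move: x1; rewrite [flatten (_ :: ps1)]/= -cat_cons mem_cat.
  rewrite catA (perm_uniq (perm_cat (perm_refl _) perm2)).
  case: ifP => [_|/negbT y2ps]; first by rewrite -catA.
  rewrite uniq_catC /= mem_cat negb_or y2ps y2c' uniq_catC -catA.
  exact: u1.
rewrite /= yps2 andbT; move: (rev_ypath yq1) yq2; rewrite /p'.
case Eq1: (rev (y1 :: q1)) => [|z1 z] //= /and3P[z1X z1l z1z] /and3P[_ l2X yq2].
rewrite z1X last_cat /= l2X cat_path z1z /= xy2 yq2 andbT.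
have -> : last z1 z = y1 by rewrite -(last_cons y1) -Eq1 rev_cons last_rcons.
by rewrite r_sym xy1.
Qed.

End Decomposition.

Section LinearForest.

Variable S : {set T}.
Hypothesis SX : S \subset X.

(** Induction on [A], adding one vertex with its two edges of [F]. The components use only edges of
    [F], and not arbitrary edges of the graph, because the degree bound of [F] is what makes the
    attachment points free path ends. *)
Lemma two_matching_decompose (F : {set T * T}) (A : {set T}) :
    two_matching e S F -> {in S, forall s, deg_src F s = 2} -> A \subset S ->
  exists cs ps, path_system (fun u v => ((u, v) \in F) || ((v, u) \in F)) inX cs ps /\
    {in X, forall x, (x \in flatten (cs ++ ps)) = (x \in A)}.
Proof.
move=> tF F2; have [FS _ Fy] := two_matchingP _ _ _ tF.
pose r u v := ((u, v) \in F) || ((v, u) \in F); rewrite -/r.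
have r_sym : symmetric r by move=> u v; rewrite /r orbC.
have F_X s y : (s, y) \in F -> s \in X /\ y \notin X.
  case/FS=> /(subsetP SX) sX /e_bip; rewrite sX => /esym yX; by split.
have r_F y v : y \notin X -> r y v -> (v, y) \in F.
  by move=> yX /orP[/F_X[yX']|//]; rewrite yX' in yX.
have [n] := ubnP #|A|; elim: n A => // n IH A ltn AS.
have [->|[x xA]] := set_0Vmem A.
  by exists [::], [::]; split=> // x _; rewrite inE.
have xS := subsetP AS x xA; have xX := subsetP SX x xS.
have [||cs [ps [sys cov]]] := IH (A :\ x).
- by move: ltn; rewrite (cardsD1 x) xA.
- by apply: subset_trans AS; apply: subD1set.
have x_fl : x \notin flatten (cs ++ ps) by rewrite cov // !inE eqxx.
have /eqP := F2 x xS; rewrite /deg_src => /cards2P[y1 [y2 [y12 Fx]]].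
have xy1 : (x, y1) \in F by have := set21 y1 y2; rewrite -Fx inE.
have xy2 : (x, y2) \in F by have := set22 y1 y2; rewrite -Fx inE.
(* A neighbour of [x] on a cycle or inside a path would have three sources in [F]: [u], [v] and the
   new vertex [x]. *)
have no_inner y u v : (x, y) \in F -> u \in flatten (cs ++ ps) ->
    v \in flatten (cs ++ ps) -> u != v -> r y u -> r y v -> False.
  move=> xy u_fl v_fl uv yu yv; have [_ yX] := F_X _ _ xy.
  have := Fy y; rewrite leqNgt => /negP; apply.
  have sub3 : x |: [set u; v] \subset [set s | (s, y) \in F].
    apply/subsetP => s; rewrite !inE => /or3P[] /eqP-> //; exact: r_F.
  apply: leq_trans (subset_leq_card sub3).
  rewrite cardsU1 cards2 uv !inE negb_or.
  by rewrite (contraNneq _ x_fl) ?(contraNneq _ x_fl) // => ->.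
have notin_cs y : (x, y) \in F -> y \notin flatten cs.
  move=> xy; apply/negP => /flattenP[c c_cs yc].
  case/and3P: (sys) => u_fl /allP/(_ c c_cs) cyc _.
  have c_fl v : v \in c -> v \in flatten (cs ++ ps).
    by move=> vc; rewrite flatten_cat mem_cat; apply/orP; left; apply/flattenP; exists c.
  have uc : uniq c.
    apply: subseq_uniq u_fl; case/splitPr: c_cs => cs1 cs2.
    rewrite flatten_cat flatten_cat /= -!catA.
    by apply: subseq_trans (suffix_subseq _ _); apply: prefix_subseq.
  have [i q rq] := rot_to yc.
  have cyc_r : cycle r (y :: q) by rewrite -rq rot_cycle; case: (c) cyc => // x' q' /and3P[].
  have sz : 2 < size (y :: q) by rewrite -rq size_rot; case: (c) cyc => // x' q' /and3P[].
  have qc v : v \in q -> v \in c by move=> vq; rewrite -(mem_rot i) rq inE vq orbT.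
  have uq : uniq (y :: q) by rewrite -rq rot_uniq.
  case: q rq cyc_r sz qc uq => [|u q] //=; case/lastP: q => [|q v] // rq.
  rewrite rcons_path last_rcons => /and3P[yu _ vy] _ qc.
  case/and3P=> _ + _; rewrite mem_rcons inE negb_or => /andP[uv _].
  apply: (no_inner y u v) => //; first by apply/c_fl/qc; rewrite mem_head.
    by apply/c_fl/qc; rewrite inE mem_rcons mem_head orbT.
  by rewrite r_sym.
have is_end y p : (x, y) \in F -> p \in ps -> y \in p -> (y == head y p) || (y == last y p).
  move=> xy p_ps yp; case/and3P: (sys) => u_fl _ /allP/(_ p p_ps) pp.
  have p_fl v : v \in p -> v \in flatten (cs ++ ps).
    by move=> vp; rewrite flatten_cat mem_cat; apply/orP; right; apply/flattenP; exists p.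
  have up : uniq p.
    apply: subseq_uniq u_fl; case/splitPr: p_ps => ps1 ps2.
    rewrite flatten_cat flatten_cat /=.
    apply: subseq_trans (suffix_subseq _ _); apply: subseq_trans (suffix_subseq _ _).
    exact: prefix_subseq.
  have : sorted r p by case: (p) pp => // y' q /and3P[].
  case/splitPr: yp p_fl up => p1 p2; case/lastP: p1 => [|p1 u]; first by rewrite eqxx.
  case: p2 => [|v p2]; first by rewrite last_cat /= eqxx orbT.
  move=> p_fl; rewrite cat_uniq => /and3P[_ /hasPn p12 _].
  rewrite cat_rcons sorted_cat_cons /= => /and4P[_ uy yv _].
  exfalso; apply: (no_inner y u v) => //; last by rewrite r_sym.
  - by apply: p_fl; rewrite mem_cat mem_rcons mem_head.
  - by apply: p_fl; rewrite mem_cat !inE eqxx !orbT.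
  - apply: contraNneq (p12 v _) => [<-|]; first by rewrite mem_rcons mem_head.
    by rewrite !inE eqxx orbT.
have [_ y1X] := F_X _ _ xy1; have [_ y2X] := F_X _ _ xy2.
have [|||cs' [ps' [sys' cov']]] := path_system_add r_sym sys xX x_fl y1X y2X y12
  _ _ (notin_cs _ xy1) (notin_cs _ xy2).
- by rewrite /r xy1.
- by rewrite /r xy2.
- by move=> y p; rewrite !inE => /orP[] /eqP->; apply: is_end.
exists cs', ps'; split=> // v vX; rewrite cov' // cov // !inE.
by case: eqP => // ->.
Qed.

Hypothesis S7 : #|S| <= 7.
Hypothesis hallS :
  forall A : {set T}, A \subset S -> 1 < #|A| -> #|A| <= #|Lambda2 e A|.
Hypothesis nbrS : forall A : {set T}, A \subset S -> 0 < #|A| -> #|A| < #|nbrs e A|.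

Lemma linear_forest_exists : exists ps,
  two_factor e X S [::] ps /\ all (fun p => 1 < size p) ps.
Proof.
have [F tF F2] := perfect_two_matching e_sym SX hallS nbrS.
have [cs [ps [sys cov]]] := two_matching_decompose tF F2 (subxx S).
have [FS _ _] := two_matchingP _ _ _ tF.
have tf : two_factor e X S cs ps.
  split=> //; case/and3P: sys => u cyc yps; apply/and3P; split=> //.
  - apply: sub_all cyc => -[|x q] //= /and3P[-> -> xq] /=; apply: sub_path xq.
    by move=> a b /orP[] /FS[_] //; rewrite e_sym.
  - apply: sub_all yps => -[|y q] //= /and3P[-> -> yq] /=; apply: sub_path yq.
    by move=> a b /orP[] /FS[_] //; rewrite e_sym.
have [ps' tf'] := two_factor_linear e_sym e_bip SX S7 hallS nbrS tf.
exists [seq p <- ps' | 1 < size p]; split; last exact: filter_all.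
exact: two_factor_filter.
Qed.

End LinearForest.

(** * Inserting a vertex into a cycle *)

Lemma closed_next (c : seq T) (B : pred T) v0 : uniq c -> v0 \in c -> B v0 ->
  (forall v, v \in c -> B v -> B (next c v)) -> forall v, v \in c -> B v.
Proof.
move=> uc v0c Bv0 B_next; have [i q rq] := rot_to v0c.
have : path (frel (next c)) v0 q.
  have := cycle_next uc; rewrite -(rot_cycle i) rq /= rcons_path.
  by case/andP.
have vc v : (v \in c) = (v \in v0 :: q) by rewrite -(mem_rot i) rq.
have : {subset v0 :: q <= c} by move=> v; rewrite vc.
suff all_q u : B u -> {subset u :: q <= c} -> path (frel (next c)) u q -> all B q.
  move=> sub_q pq v; rewrite vc inE => /orP[/eqP->//|].
  exact: (allP (all_q _ Bv0 sub_q pq)).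
elim: q u {rq vc} => //= w q IH u Bu sub_q /andP[/eqP uw wq].
have Bw : B w by rewrite -uw; apply: B_next => //; apply: sub_q; rewrite mem_head.
by rewrite Bw (IH w) // => v vq; apply: sub_q; rewrite inE vq orbT.
Qed.

Lemma cycle_rev c : cycle e c -> cycle e (rev c).
Proof.
by rewrite rev_cycle (eq_cycle (e' := fun z => e^~ z)) // => u v; rewrite e_sym.
Qed.

Section Insertion.

Variables (c : seq T) (x : T).
Hypotheses (uc : uniq c) (cc : cycle e c) (xX : x \in X) (xc : x \notin c).

(** Only vertices of [X] are tracked, so the new cycle may drop or exchange vertices outside [X]. *)
Definition extendable (c : seq T) := exists c', [/\ uniq c', cycle e c' &
  {in X, forall v, (v \in c') = (v == x) || (v \in c)}].

Lemma next_head (y : T) q : next (y :: q) y = head y q.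
Proof. by case: q => [|z q]; rewrite /= eqxx. Qed.

(** The detour [y], [x], [y'] is spliced in before the successor of [y]. *)
Lemma extendable_mix y y' : y \in c -> y' \notin X -> y' \notin c ->
  e x y -> e x y' -> e y' (next c y) -> extendable c.
Proof.
move=> yc y'X y'c xy xy' y'n; have [i q rq] := rot_to yc.
have uq : uniq (y :: q) by rewrite -rq rot_uniq.
have cq : cycle e (y :: q) by rewrite -rq rot_cycle.
have mq v : (v \in c) = (v \in y :: q) by rewrite -(mem_rot i) rq.
rewrite -(next_rot i) // rq next_head in y'n.
exists [:: y, x, y' & q]; split.
- move: uq xc y'c; rewrite !mq /= !inE !negb_or => /andP[yq ->] /andP[xy_ ->] /andP[yy' ->].
  rewrite eq_sym xy_ eq_sym yy' yq !andbT /=.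
  by apply: contraNneq y'X => <-.
- rewrite /= e_sym xy xy' /=; move: cq y'n; case: q {rq uq mq} => [|z q] //=.
    by move=> _ ->.
  by case/andP=> _ -> ->.
- move=> v vX; rewrite mq !inE; case: (v =P y') => [vy|_] /=; first by rewrite -vy vX in y'X.
  by rewrite orbCA.
Qed.

(** The vertex [y] is given up and the gap between its neighbours is bridged by [y'], [x], [y'']. *)
Lemma extendable_replace y y' y'' : y \in c -> y \notin X ->
  y' \notin X -> y' \notin c -> y'' \notin X -> y'' \notin c -> y' != y'' ->
  e x y' -> e x y'' -> e y' (prev c y) -> e y'' (next c y) -> extendable c.
Proof.
move=> yc yX y'X y'c y''X y''c y'y'' xy' xy'' y'p y''n; have [i q rq] := rot_to yc.
have uq : uniq (y :: q) by rewrite -rq rot_uniq.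
have cq : cycle e (y :: q) by rewrite -rq rot_cycle.
have mq v : (v \in c) = (v \in y :: q) by rewrite -(mem_rot i) rq.
have pl : prev c y = last y q.
  rewrite -(prev_rot i) // rq prev_nth mem_head memNindex; last by case/andP: uq.
  exact: (nth_last y (y :: q)).
rewrite -(next_rot i) // rq next_head in y''n; rewrite pl in y'p.
have q0 : q != [::].
  by case: q {rq uq cq mq pl y'p} y''n => //= /e_bip; rewrite (negPf y''X) yX.
exists (x :: y'' :: rcons q y'); split.
- move: uq xc y'c y''c; rewrite !mq /= !inE !mem_rcons !inE !negb_or.
  move=> /andP[yq uq] /andP[_ ->] /andP[_ y'q] /andP[_ ->].
  rewrite rcons_uniq y'q uq [y'' == _]eq_sym y'y'' !andbT.
  by apply/andP; split; [apply: contraNneq y''X => <- | apply: contraNneq y'X => <-].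
- case: q q0 cq y'p y''n {rq uq mq pl} => //= z q _.
  rewrite !rcons_path last_rcons /= => /and3P[_ zq _] y'p ->.
  by rewrite xy'' zq e_sym y'p e_sym xy'.
- move=> v vX; rewrite mq !inE mem_rcons !inE.
  have neqv w : w \notin X -> (v == w) = false.
    by move=> wX; apply: contraNF wX => /eqP <-.
  by rewrite (neqv y'') // (neqv y') // (neqv y).
Qed.

(** The edges leaving [y1] and [y2] are removed. The new cycle goes from [x] to [y1], backwards to
    the successor of [y2], through [y'] to the successor of [y1], and forwards to [y2] and [x]. *)
Lemma extendable_cross y1 y2 y' : y1 \in c -> y2 \in c -> y1 != y2 ->
  y1 \notin X -> y2 \notin X -> y' \notin X -> y' \notin c ->
  e x y1 -> e x y2 -> e y' (next c y1) -> e y' (next c y2) -> extendable c.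
Proof.
move=> y1c y2c y12 y1X y2X y'X y'c xy1 xy2 y'n1 y'n2.
have [i p1 p2 _ _ rq] := rot_to_arc uc y1c y2c y12.
have uq : uniq (y1 :: p1 ++ y2 :: p2) by rewrite -rq rot_uniq.
have cq : cycle e (y1 :: p1 ++ y2 :: p2) by rewrite -rq rot_cycle.
have mq v : (v \in c) = (v \in y1 :: p1 ++ y2 :: p2) by rewrite -(mem_rot i) rq.
have n1 : next c y1 = head y2 p1.
  by rewrite -(next_rot i) // rq next_head; case: (p1).
have n2 : next c y2 = head y1 p2.
  rewrite -(next_rot i) // -(next_rot (size (y1 :: p1))) ?rot_uniq // rq -cat_cons.
  by rewrite rot_size_cat cat_cons next_head; case: (p2).
rewrite n1 in y'n1; rewrite n2 in y'n2.
have p1_0 : p1 != [::].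
  by apply: contraTneq y'n1 => ->; apply/negP => /e_bip /=; rewrite (negPf y'X) y2X.
have p2_0 : p2 != [::].
  by apply: contraTneq y'n2 => ->; apply/negP => /e_bip /=; rewrite (negPf y'X) y1X.
have perm_q : perm_eq (x :: y1 :: rev p2 ++ y' :: rcons p1 y2)
                      (x :: y' :: (y1 :: p1 ++ y2 :: p2)).
  apply/seq.permP => a; rewrite /= !count_cat /= count_rev -cats1 !count_cat /=.
  move: (nat_of_bool (a x)) (nat_of_bool (a y1)) (nat_of_bool (a y')) => ax a1 a'.
  by move: (nat_of_bool (a y2)) (count a p1) (count a p2) => a2 c1 c2; clear; lia.
exists (x :: y1 :: rev p2 ++ y' :: rcons p1 y2); split.
- rewrite (perm_uniq perm_q) /= -/(uniq (y1 :: p1 ++ y2 :: p2)) uq.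
  rewrite inE negb_or -!mq xc y'c !andbT.
  by apply: contraNneq y'X => <-.
- move: cq; rewrite /= xy1 rcons_cat cat_path /= rcons_path.
  case/and4P=> y1p1 l1 y2p2 l2.
  have rp2 : path e y1 (rev p2) /\ last y1 (rev p2) = head y1 p2.
    have : path e y2 (rcons p2 y1) by rewrite rcons_path y2p2.
    rewrite -(eq_path (e := fun z => e^~ z)); last by move=> u v; rewrite /= e_sym.
    rewrite -rev_path last_rcons belast_rcons rev_cons rcons_path => /andP[-> _].
    by split=> //; case: (p2) p2_0 => // z p _; rewrite rev_cons last_rcons.
  rewrite rcons_cat cat_path rp2.1 rp2.2 /= e_sym y'n2 /=.
  rewrite rcons_path last_rcons [e y2 x]e_sym xy2 andbT rcons_path.
  case: (p1) p1_0 y'n1 y1p1 l1 => //= z p _ -> /andP[_ ->] ->.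
  by [].
- move=> v vX; rewrite (perm_mem perm_q) inE [in LHS]inE mq.
  case: (v =P y') => // vy'.
  by rewrite -vy' vX in y'X.
Qed.

End Insertion.

Lemma extendable_rev x c : extendable x (rev c) -> extendable x c.
Proof.
case=> c' [uc' cc' cov]; exists c'; split=> // v vX.
by rewrite cov // mem_rev.
Qed.

(** * Counting when outside vertices miss at most [k] vertices of [X] *)

Section Dense.

Variable k : nat.
Hypothesis hallX :
  forall A : {set T}, A \subset X -> 1 < #|A| -> #|A| <= #|Lambda2 e A|.

Definition missed (y : T) := [set u in X | ~~ e y u].

Hypothesis missed_le : forall y, y \notin X -> #|missed y| <= k.

Lemma common_nbrs x s : x \in X -> s \in X -> x != s ->
  1 < #|[set y | e x y && e s y]|.
Proof.
move=> xX sX xs; have sub2 : [set x; s] \subset X.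
  by apply/subsetP => v; rewrite !inE => /orP[] /eqP ->.
have := hallX sub2; rewrite cards2 xs => /(_ isT) le2; apply: leq_trans le2 _.
apply: subset_leq_card; apply/subsetP => v; rewrite !inE.
case/card_gt1P => u [w []]; rewrite !inE => /andP[ux vu] /andP[wx vw] uw.
rewrite ![e _ v]e_sym; move: ux wx uw vu vw.
by do 2!case/orP => /eqP ->; rewrite ?eqxx // => _ -> ->.
Qed.

(** Double Hall is applied to [A] with one further vertex of [X]: of two neighbours in the larger
    set, at least one lies in [A]. *)
Lemma nbrs_gt (A : {set T}) : A \subset X -> 0 < #|A| -> #|A| < #|X| -> #|A| < #|nbrs e A|.
Proof.
move=> AX A0 ltA; have /subsetPn[x xX xA] : ~~ (X \subset A).
  by apply: contraL ltA => /subset_leq_card; rewrite -leqNgt.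
have sub2 : x |: A \subset X by rewrite subUset sub1set xX.
have := hallX sub2; rewrite cardsU1 xA add1n ltnS => /(_ A0) leA.
apply: leq_trans leA _; apply: subset_leq_card; apply/subsetP => v; rewrite !inE.
case/card_gt1P => u [w []]; rewrite !inE => /andP[ux vu] /andP[wx vw] uw.
case/orP: ux => [/eqP ux|uA]; last by apply/exists_inP; exists u; rewrite // e_sym.
case/orP: wx => [/eqP wx|wA]; last by apply/exists_inP; exists w; rewrite // e_sym.
by rewrite ux wx eqxx in uw.
Qed.

Lemma card_other_side : 1 < #|X| -> #|X| <= #|~: X|.
Proof.
move/(hallX (subxx _)) => le_X; apply: leq_trans le_X _.
apply: subset_leq_card; apply/subsetP => v; rewrite !inE => gt1.
have /card_gt0P[u] := ltnW gt1.
by rewrite inE => /andP[uX /e_bip ->]; rewrite negbK.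
Qed.

Lemma next_inj (c : seq T) : uniq c -> injective (next c).
Proof. by move/prev_next/can_inj. Qed.

Lemma prev_inj (c : seq T) : uniq c -> injective (prev c).
Proof. by move/next_prev/can_inj. Qed.

(** The successor map is injective and exchanges the two sides. *)
Lemma card_cycle_sides c : uniq c -> cycle e c ->
  #|[set v | (v \in c) && (v \notin X)]| = #|[set v | (v \in c) && (v \in X)]|.
Proof.
move=> uc cc; apply/eqP; rewrite eqn_leq; apply/andP; split.
  rewrite -(card_imset _ (next_inj uc)); apply: subset_leq_card.
  apply/subsetP => _ /imsetP[v + ->]; rewrite !inE => /andP[vc vX].
  by rewrite mem_next vc /=; have := e_bip (next_cycle cc vc); rewrite (negPf vX) => /esym/negbFE.
rewrite -(card_imset _ (next_inj uc)); apply: subset_leq_card.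
apply/subsetP => _ /imsetP[v + ->]; rewrite !inE => /andP[vc vX].
by rewrite mem_next vc /=; have := e_bip (next_cycle cc vc); rewrite vX => /esym ->.
Qed.

(* Otherwise [y'] sees the successors of two neighbours of [x], which is a crossing. *)
Lemma cross_missed c x y' (J : {set T}) : uniq c -> cycle e c ->
    x \in X -> x \notin c -> ~ extendable x c -> y' \notin X -> y' \notin c ->
    {in J, forall y, y \in c /\ e x y} ->
  #|J| <= #|missed y' :&: [set next c y | y in J]|.+1.
Proof.
move=> uc cc xX xc nc y'X y'c JP; set nJ := [set _ | _ in _].
have nJX : nJ \subset X.
  apply/subsetP => _ /imsetP[y yJ ->]; have [yc xy] := JP y yJ.
  have := e_bip (next_cycle cc yc); have := e_bip xy; rewrite xX => /esym/negPf ->.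
  by move/esym/negbFE.
have : #|nJ :\: missed y'| <= 1.
  rewrite leqNgt; apply/negP => /card_gt1P[s1 [s2 []]].
  rewrite !inE => /andP[m1 s1J] /andP[m2 s2J] s12.
  rewrite (subsetP nJX) // negbK in m1; rewrite (subsetP nJX) // negbK in m2.
  case/imsetP: s1J s12 m1 => y1 y1J -> ; case/imsetP: s2J m2 => y2 y2J -> m2 s12 m1.
  have [y1c xy1] := JP y1 y1J; have [y2c xy2] := JP y2 y2J.
  have y1X : y1 \notin X by rewrite -(e_bip xy1).
  have y2X : y2 \notin X by rewrite -(e_bip xy2).
  apply: nc; apply: (@extendable_cross _ _ uc cc xX xc y1 y2 y') => //.
  by apply: contraNneq s12 => ->.
have := cardsID (missed y') nJ; rewrite setIC (card_imset _ (next_inj uc)).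
by move: #|_ :\: _| #|_ :&: _| #|J| => a b d; clear; lia.
Qed.

Lemma cross_missed_prev c x y' (J : {set T}) : uniq c -> cycle e c ->
    x \in X -> x \notin c -> ~ extendable x c -> y' \notin X -> y' \notin c ->
    {in J, forall y, y \in c /\ e x y} ->
  #|J| <= #|missed y' :&: [set prev c y | y in J]|.+1.
Proof.
move=> uc cc xX xc nc y'X y'c JP.
have -> : [set prev c y | y in J] = [set next (rev c) y | y in J].
  by apply: eq_imset => y; rewrite next_rev.
apply: (@cross_missed (rev c) x); rewrite ?rev_uniq ?mem_rev //.
- exact: cycle_rev.
- by move/extendable_rev.
- by move=> y /JP; rewrite mem_rev.
Qed.

(** The two images have equal size, hence coincide. So [J] together with its successors is closed
    under [next], since the successor of a predecessor of [J] is back in [J], and it fills the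
    cycle. *)
Lemma next_prev_full c (J : {set T}) : uniq c -> cycle e c -> J != set0 ->
    {in J, forall y, y \in c /\ y \notin X} ->
    [set prev c y | y in J] \subset [set next c y | y in J] ->
  [set v | (v \in c) && (v \notin X)] \subset J.
Proof.
move=> uc cc /set0Pn[y0 y0J] JP sub_pn.
have eq_pn : [set prev c y | y in J] = [set next c y | y in J].
  apply/eqP; rewrite eqEcard sub_pn (card_imset _ (next_inj uc)).
  by rewrite (card_imset _ (prev_inj uc)) leqnn.
pose B := fun v => (v \in J) || (v \in [set next c y | y in J]).
have Ball v : v \in c -> B v.
  apply: (@closed_next c B y0 uc); first by case: (JP y0 y0J).
    by rewrite /B y0J.
  move=> {}v vc /orP[vJ|]; first by apply/orP; right; apply: imset_f.
  rewrite -eq_pn => /imsetP[y yJ ->]; rewrite next_prev //.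
  by rewrite /B yJ.
apply/subsetP => v; rewrite inE => /andP[vc vX]; have /orP[//|] := Ball v vc.
case/imsetP=> y /JP[yc yX] vE; have := e_bip (next_cycle cc yc).
by rewrite -vE vX (negPf yX).
Qed.

(** Suppose that insertion fails, and let [J] be the neighbours of [x] on the cycle. If [x] also has
    neighbours off the cycle, either a replacement is immediate or the non-neighbours of two of them
    are too many. Otherwise crossings make all estimates tight, and this rigid structure contradicts
    double Hall. *)
Lemma extendable_dense c x : uniq c -> cycle e c -> x \in X -> x \notin c ->
    k < #|[set y | e x y]| -> k < #|[set v | (v \in c) && (v \in X)]| ->
    k.*2 <= #|[set v | (v \in c) && (v \in X)]|.+1 ->
  extendable x c.
Proof.
move=> uc cc xX xc degx kj k2j; apply: NNPP => nc.
have cs := card_cycle_sides uc cc.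
set Xc := [set v | (v \in c) && (v \in X)] in kj k2j cs.
set Yc := [set v | (v \in c) && (v \notin X)] in cs.
pose J := [set y | e x y && (y \in c)].
have xe y : e x y -> y \notin X by move=> xy; rewrite -(e_bip xy).
have JP : {in J, forall y, y \in c /\ e x y} by move=> y; rewrite inE => /andP[].
have JP' : {in J, forall y, y \in c /\ y \notin X}.
  by move=> y /JP[yc xy]; split=> //; apply: xe.
have nJ := card_imset J (next_inj uc); have pJ := card_imset J (prev_inj uc).
have nX y : y \in Yc -> next c y \in X.
  rewrite inE => /andP[yc yX]; have := e_bip (next_cycle cc yc).
  by rewrite (negPf yX) => /esym/negbFE.
have pX y : y \in Yc -> prev c y \in X.
  rewrite inE => /andP[yc yX]; have := e_bip (prev_cycle cc yc).
  by rewrite yX.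
have x_ne v : v \in c -> x != v by move=> vc; apply: contraNneq xc => ->.
have JYc : J \subset Yc by apply/subsetP => y /JP'[yc yX]; rewrite inE yc.
have ltX : #|Xc| < #|X|.
  apply: proper_card; apply/properP; split; first by apply/subsetP => v; rewrite inE => /andP[].
  by exists x; rewrite // inE (negPf xc).
(* There are at least [|X|] vertices outside [X], while the cycle uses as many of them as of [X],
   hence fewer since [x] is missing. *)
have [y0 y0X y0c] : exists2 y0, y0 \notin X & y0 \notin c.
  have /subsetPn[y0] : ~~ (~: X \subset Yc).
    apply: contraL (ltX) => /subset_leq_card; rewrite cs -leqNgt; apply: leq_trans.
    by apply: card_other_side; apply: leq_ltn_trans ltX; apply: leq_ltn_trans kj.
  by rewrite !inE => y0X; rewrite y0X andbT => y0c; exists y0.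
have mix y y' : y \in J -> y' \notin c -> e x y' -> ~~ e y' (next c y).
  move=> /JP[yc xy] y'c xy'; apply/negP => y'n; apply: nc.
  exact: (extendable_mix uc cc xX xc yc (xe _ xy') y'c).
have mixp y y' : y \in J -> y' \notin c -> e x y' -> ~~ e y' (prev c y).
  move=> /JP[yc xy] y'c xy'; apply/negP => y'n; apply/nc/extendable_rev.
  apply: (@extendable_mix (rev c) x _ _ _ _ y y'); rewrite ?rev_uniq ?mem_rev ?next_rev //.
  - exact: cycle_rev.
  - exact: xe.
have replace y y' y'' : y \in Yc -> y' \notin c -> y'' \notin c -> y' != y'' ->
    e x y' -> e x y'' -> e y' (prev c y) -> e y'' (next c y) -> False.
  rewrite inE => /andP[yc yX] y'c y''c y'y'' xy' xy'' y'p y''n; apply: nc.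
  exact: (extendable_replace uc cc xX xc yc yX (xe _ xy') y'c (xe _ xy'') y''c y'y'').
have [/existsP[y' /andP[xy' y'c]]|nofree] := boolP [exists y', e x y' && (y' \notin c)].
  (* With [J] empty, any outside vertex of the cycle can be replaced: its two neighbours on the
     cycle each share two vertices with [x], all off the cycle, and two distinct ones can be
     chosen. *)
  have [J0|Jn0] := eqVneq J set0.
    have free y : e x y -> y \notin c.
      move=> xy; apply/negP => yc.
      have : y \in J by rewrite inE xy yc.
      by rewrite J0 inE.
    have /card_gt0P[y yYc] : 0 < #|Yc| by rewrite cs; apply: leq_ltn_trans kj.
    have yc : y \in c by move: yYc; rewrite inE => /andP[].
    have /ltnW/card_gt0P[y1] := common_nbrs xX (pX y yYc) (x_ne _ (etrans (mem_prev c y) yc)).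
    rewrite inE => /andP[xy1 y1p].
    have : 0 < #|[set z | e x z && e (next c y) z] :\ y1|.
      have := common_nbrs xX (nX y yYc) (x_ne _ (etrans (mem_next c y) yc)).
      by rewrite (cardsD1 y1); case: (y1 \in _) => //= /ltnW.
    case/card_gt0P=> y2; rewrite !inE => /and3P[y21 xy2 y2n].
    by apply: (replace y y1 y2); rewrite ?free // 1?[y1 == _]eq_sym // e_sym.
  have le_nbr y1 : y1 \notin c -> e x y1 ->
      [set next c y | y in J] :|: [set prev c y | y in J] \subset missed y1.
    move=> y1c xy1; apply/subsetP => v; rewrite inE => /orP[] /imsetP[y yJ ->]; rewrite inE.
      by rewrite nX ?(subsetP JYc) //= mix.
    by rewrite pX ?(subsetP JYc) //= mixp.
  (* An off-cycle neighbour of [x] misses all successors and predecessors of [J]. These outnumber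
     [J], unless [J] is the whole outside part of the cycle, which has more than [k] vertices. *)
  have ltJ : #|J| < k.
    have le_k := leq_trans (subset_leq_card (le_nbr y' y'c xy')) (missed_le (xe _ xy')).
    apply: leq_trans le_k; rewrite -nJ; apply: proper_card; apply/properP.
    split; first exact: subsetUl.
    have [sub_pn|/subsetPn[v vp vn]] :=
        boolP ([set prev c y | y in J] \subset [set next c y | y in J]); last first.
      by exists v; rewrite // inE vp orbT.
    have := subset_leq_card (next_prev_full uc cc Jn0 JP' sub_pn).
    rewrite -/Yc cs => leJ; have := leq_trans kj leJ; rewrite ltnNge => /negP[].
    rewrite -nJ; apply: leq_trans (missed_le (xe _ xy')); apply: subset_leq_card.
    exact: subset_trans (subsetUl _ _) (le_nbr y' y'c xy').
  have : 1 < #|[set y | e x y] :\: J|.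
    have := cardsID J [set y | e x y]; have := subset_leq_card (subsetIr [set y | e x y] J).
    move: degx ltJ; move: #|_ :\: _| #|_ :&: _| #|J| #|[set y | e x y]| => a b d f.
    by clear; lia.
  case/card_gt1P=> y1 [y2 []]; rewrite !inE !negb_and.
  move=> /andP[/orP[/negPf->//|y1c] xy1] /andP[/orP[/negPf->//|y2c] xy2] y12.
  (* Take [y] in [J]. The at least two common neighbours of [x] and the successor of [y] must lie on
     the cycle, hence in [J]. *)
  have J2 : 1 < #|J|.
    have [y yJ] := set0Pn _ Jn0; have yYc := subsetP JYc y yJ.
    have yc : y \in c by case: (JP y yJ).
    apply: leq_trans (common_nbrs xX (nX y yYc) (x_ne _ (etrans (mem_next c y) yc))) _.
    apply: subset_leq_card; apply/subsetP => z; rewrite !inE => /andP[xz nz]; rewrite xz /=.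
    by apply: contraLR nz => zc; rewrite e_sym mix.
  (* Each set has at most [k] elements. They cover [Yc], or else a replacement applies, and both
     contain [J]. Thus [|Yc| + 2 <= 2k], against the size hypothesis. *)
  pose B1 := [set y in Yc | ~~ e y1 (prev c y)].
  pose B2 := [set y in Yc | ~~ e y2 (next c y)].
  have B1k : #|B1| <= k.
    apply: leq_trans (missed_le (xe _ xy1)); rewrite -(card_imset _ (prev_inj uc)).
    apply: subset_leq_card; apply/subsetP => _ /imsetP[y /setIdP[yYc ny] ->].
    by rewrite inE pX.
  have B2k : #|B2| <= k.
    apply: leq_trans (missed_le (xe _ xy2)); rewrite -(card_imset _ (next_inj uc)).
    apply: subset_leq_card; apply/subsetP => _ /imsetP[y /setIdP[yYc ny] ->].
    by rewrite inE nX.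
  have YB : #|Yc| <= #|B1 :|: B2|.
    apply: subset_leq_card; apply/subsetP => y yYc; rewrite inE inE [y \in B2]inE yYc /=.
    by rewrite -negb_and; apply/negP => /andP[p1 p2]; apply: (replace y y1 y2).
  have JB : #|J| <= #|B1 :&: B2|.
    apply: subset_leq_card; apply/subsetP => y yJ; rewrite inE inE [y \in B2]inE.
    by rewrite (subsetP JYc) //= mix // mixp.
  have := cardsUI B1 B2; move: YB JB J2 B1k B2k k2j; rewrite cs.
  move: #|_ :|: _| #|_ :&: _| #|J| #|B1| #|B2| #|Xc| => a b d f g h.
  by clear; lia.
have NxJ : [set y | e x y] = J.
  apply/setP => y; rewrite !inE; case xy: (e x y) => //=.
  move: nofree; rewrite negb_exists => /forallP/(_ y); rewrite xy negbK.
  by move->.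
rewrite NxJ in degx.
(* Now [|J| > k], while crossings bound [|J|] by one more than the missed vertices among the
   successors, that is by [k + 1]; so equality holds throughout, and likewise for predecessors. *)
have missJ y' : y' \notin X -> y' \notin c -> [/\ #|J| = k.+1, #|missed y'| = k,
    missed y' \subset [set next c y | y in J] & missed y' \subset [set prev c y | y in J]].
  move=> y'X y'c; have le1 := cross_missed uc cc xX xc nc y'X y'c JP.
  have le2 := cross_missed_prev uc cc xX xc nc y'X y'c JP.
  have lek := missed_le y'X.
  have sub1 := subsetIl (missed y') [set next c y | y in J].
  have sub2 := subsetIl (missed y') [set prev c y | y in J].
  have c1 := subset_leq_card sub1; have c2 := subset_leq_card sub2.
  have [cJ cm ci1 ci2] : [/\ #|J| = k.+1, #|missed y'| = k,
     #|missed y' :&: [set next c y | y in J]| = k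
     & #|missed y' :&: [set prev c y | y in J]| = k].
    move: degx le1 le2 lek c1 c2.
    move: #|missed y' :&: [set next c y | y in J]|.
    move: #|missed y' :&: [set prev c y | y in J]| #|J| #|missed y'| => a b d f.
    by clear => *; split; lia.
  split=> //.
    by apply/setIidPl/eqP; rewrite eqEcard sub1 ci1 cm leqnn.
  by apply/setIidPl/eqP; rewrite eqEcard sub2 ci2 cm leqnn.
have [cJ cm0 m0n m0p] := missJ y0 y0X y0c.
have Jn0 : J != set0 by rewrite -card_gt0 cJ.
have [sub_pn|/subsetPn[v0 v0p v0n]] :=
    boolP ([set prev c y | y in J] \subset [set next c y | y in J]).
  (* Here the cycle has just [k + 1] vertices of [X]. An off-cycle vertex sees only one of them and
     does not see [x], so [Lambda2] of these with [x] has at most [k + 1] elements for a set of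
     [k + 2]. *)
  have YJ : Yc = J.
    by apply/eqP; rewrite eqEsubset JYc andbT; apply: next_prev_full.
  have sub2 : x |: Xc \subset X.
    by rewrite subUset sub1set xX; apply/subsetP => v; rewrite inE => /andP[].
  have xXc : x \notin Xc by rewrite inE (negPf xc).
  have cXc : #|Xc| = k.+1 by rewrite -cs YJ.
  have := hallX sub2; rewrite cardsU1 xXc cXc => /(_ isT).
  rewrite leqNgt ltnS => /negP; apply; rewrite -cXc -cs; apply: subset_leq_card.
  apply/subsetP => v; rewrite !inE => two.
  have /card_gt0P[u] := ltnW two; rewrite inE => /andP[uA vu].
  have vX : v \notin X by rewrite (e_bip vu) negbK (subsetP sub2).
  rewrite vX andbT; apply: contraLR two => vc; rewrite -leqNgt.
  have [_ cm mn _] := missJ v vX vc.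
  have nx : ~~ e x v by apply: contra nofree => xv; apply/existsP; exists v; rewrite xv.
  apply: (@leq_trans #|Xc :\: missed v|).
    apply: subset_leq_card; apply/subsetP => w; rewrite !inE => /andP[wA vw].
    case/orP: wA => [/eqP wx|/andP[wc wX]]; last by rewrite wc wX vw.
    by rewrite wx e_sym (negPf nx) in vw.
  have missXc : missed v \subset Xc.
    apply: subset_trans mn _; apply/subsetP => _ /imsetP[y yJ ->].
    by rewrite inE mem_next nX ?(subsetP JYc) // andbT; case: (JP y yJ).
  by rewrite cardsD (setIidPr missXc) cm cXc subSnn.
(* As the two images differ, [M] has at most [k] elements, so every outside vertex off the cycle
   misses exactly [M]. *)
pose M := [set next c y | y in J] :&: [set prev c y | y in J].
have cM : #|M| <= k.
  rewrite -ltnS -cJ -pJ; apply: proper_card; apply/properP; split; first exact: subsetIr.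
  by exists v0; rewrite // inE negb_and v0n.
have missM y' : y' \notin X -> #|missed y'| = k ->
    missed y' \subset [set next c y | y in J] ->
    missed y' \subset [set prev c y | y in J] -> missed y' = M.
  move=> y'X cm mn mp; apply/eqP; rewrite eqEcard cm cM andbT.
  by rewrite subsetI mn.
have m0M := missM y0 y0X cm0 m0n m0p.
have MX : M \subset X by rewrite -m0M; apply/subsetP => v; rewrite inE => /andP[].
have xM : x \notin M.
  by apply/negP; rewrite inE => /andP[/imsetP[y /JP[yc _] xn] _]; rewrite xn mem_next yc in xc.
have cxM : #|x |: M| = k.+1 by rewrite cardsU1 xM -m0M cm0.
(* The set [x |: M] has [k + 1 = |J|] elements and so more neighbours than [J] holds. A neighbour
   outside [J] sees [M], hence must be on the cycle. *)
have [y yN yJ] : exists2 y, y \in nbrs e (x |: M) & y \notin J.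
  have lt : #|x |: M| < #|nbrs e (x |: M)|.
    apply: nbrs_gt; rewrite ?cxM //; first by rewrite subUset sub1set xX.
    exact: leq_ltn_trans kj ltX.
  have /subsetPn[y yN yJ] : ~~ (nbrs e (x |: M) \subset J).
    by apply: contraL lt => /subset_leq_card; rewrite cxM -cJ -leqNgt.
  by exists y.
have xy : ~~ e x y by move: yJ; rewrite -NxJ inE.
have [m mM ym] : exists2 m, m \in M & e m y.
  move: yN; rewrite inE => /exists_inP[u]; rewrite in_setU1 => /orP[/eqP->|uM uy].
    by rewrite (negPf xy).
  by exists u.
have yX : y \notin X by rewrite -(e_bip ym) (subsetP MX).
have yc : y \in c.
  apply/negPn/negP => yc; have [_ cm mn mp] := missJ y yX yc.
  by move: mM; rewrite -(missM y) // inE e_sym ym andbF.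
have yYc : y \in Yc by rewrite inE yc.
(* Exchanging [y] for the unused [y0] keeps the cycle and frees [y], which misses
   fewer vertices of [M] than an unused vertex may. *)
pose f := tperm y y0; pose c2 := map f c.
have fX v : v \in X -> f v = v.
  by move=> vX; rewrite /f tpermD //; [apply: contraNneq yX => -> | apply: contraNneq y0X => ->].
have fJ v : v \in J -> f v = v.
  move=> vJ; rewrite /f tpermD //; first by apply: contraNneq yJ => ->.
  by apply: contraNneq y0c => ->; case: (JP v vJ).
have memc2 v : (v \in c2) = (f v \in c).
  by rewrite -[v in LHS](tpermK y y0) mem_map //; apply: perm_inj.
have uc2 : uniq c2 by rewrite map_inj_uniq //; apply: perm_inj.
have y0e v : v \in X -> v \notin M -> e y0 v.
  by move=> vX; apply: contraNT => nv; rewrite -m0M inE vX.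
have next2 v : next c2 (f v) = f (next c v) by apply: next_map => //; apply: perm_inj.
have prev2 v : prev c2 (f v) = f (prev c v) by apply: prev_map => //; apply: perm_inj.
(* If a neighbour of [y] on the cycle were in [M], injectivity of [next] or [prev] would put [y] in
   [J]. So [y0], which misses only [M], can take the place of [y]. *)
have nyM : next c y \notin M.
  apply: contra yJ; rewrite inE => /andP[/imsetP[z zJ /(next_inj uc) ->] _].
  exact: zJ.
have pyM : prev c y \notin M.
  apply: contra yJ; rewrite inE => /andP[_ /imsetP[z zJ /(prev_inj uc) ->]].
  exact: zJ.
have cc2 : cycle e c2.
  apply: cycle_from_next => // _ /mapP[v vc ->]; rewrite next2.
  have [->|vy] := eqVneq v y; first by rewrite (fX (next c y)) ?nX // /f tpermL y0e ?nX.
  have fv : f v = v.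
    by apply: tpermD; [rewrite eq_sym | apply: contraNneq y0c => ->].
  have [ny|ny] := eqVneq (next c v) y.
    rewrite fv ny /f tpermL e_sym.
    by have := y0e (prev c y) (pX y yYc) pyM; rewrite -ny prev_next.
  rewrite fv (_ : f _ = next c v); first exact: next_cycle.
  apply: tpermD; first by rewrite eq_sym.
  by apply: contraNneq y0c => ->; rewrite mem_next.
have nc2 : ~ extendable x c2.
  case=> c' [uc' cc' cov]; apply: nc; exists c'; split=> // v vX.
  by rewrite cov // memc2 fX.
have xc2 : x \notin c2 by rewrite memc2 fX.
have yc2 : y \notin c2 by rewrite memc2 /f tpermL.
have JP2 : {in J, forall z, z \in c2 /\ e x z}.
  by move=> z zJ; have [zc xz] := JP z zJ; rewrite memc2 fJ.
have nJ2 : [set next c2 z | z in J] = [set next c z | z in J].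
  apply: eq_in_imset => z zJ; rewrite -{1}(fJ z zJ) next2 fX //.
  by rewrite nX // (subsetP JYc).
have pJ2 : [set prev c2 z | z in J] = [set prev c z | z in J].
  apply: eq_in_imset => z zJ; rewrite -{1}(fJ z zJ) prev2 fX //.
  by rewrite pX // (subsetP JYc).
have := cross_missed_prev uc2 cc2 xX xc2 nc2 yX yc2 JP2.
have := cross_missed uc2 cc2 xX xc2 nc2 yX yc2 JP2; rewrite nJ2 pJ2 cJ !ltnS.
have sub1 := subsetIl (missed y) [set next c y | y in J].
have sub2 := subsetIl (missed y) [set prev c y | y in J].
have c1 := subset_leq_card sub1; have c2' := subset_leq_card sub2.
have lek := missed_le yX; move=> le1 le2.
have ck : #|missed y| = k by apply/eqP; rewrite eqn_leq lek (leq_trans le1).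
have sn : missed y \subset [set next c y | y in J].
  by apply/setIidPl/eqP; rewrite eqEcard sub1 ck.
have sp : missed y \subset [set prev c y | y in J].
  by apply/setIidPl/eqP; rewrite eqEcard sub2 ck.
by move: mM; rewrite -(missM y) // inE e_sym ym andbF.
Qed.

(** * Joining, extending and closing paths *)

Lemma common_nbr y1 y2 (U : {set T}) : y1 \notin X -> y2 \notin X -> U \subset X ->
  k.*2 < #|U| -> exists2 x, x \in U & e y1 x && e y2 x.
Proof.
move=> y1X y2X UX ltU; suff /subsetPn[x xU] : ~~ (U \subset missed y1 :|: missed y2).
  by rewrite !inE (subsetP UX) //= negb_or !negbK => xy; exists x.
apply: contraL ltU => /subset_leq_card leU; rewrite -leqNgt; apply: leq_trans leU _.
rewrite cardsU -addnn; apply: leq_trans (leq_subr _ _) _.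
by rewrite leq_add // missed_le.
Qed.

Definition uncovered (p : seq T) := [set v in X | v \notin p].

Lemma uncovered_sub p : uncovered p \subset X.
Proof. by apply/subsetP => v; rewrite inE => /andP[]. Qed.

Lemma card_uncovered p :
  #|uncovered p| + #|[set v | (v \in p) && (v \in X)]| = #|X|.
Proof.
rewrite addnC -(cardsID [set v in p] X); congr (_ + _); apply: eq_card => v; rewrite !inE.
  by rewrite andbC.
by rewrite andbC.
Qed.

Lemma ypath_join y p z q x : ypath e inX (y :: p) -> ypath e inX (z :: q) ->
  e (last y p) x -> e z x -> ypath e inX ((y :: p) ++ x :: z :: q).
Proof.
move=> /and3P[/= yX _ yp] /and3P[/= _ lX zq] yx zx.
by rewrite yX last_cat /= lX cat_path yp /= yx e_sym zx.
Qed.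

Lemma ypath_last_out y p : ypath e inX (y :: p) -> last y p \notin X.
Proof. by case/and3P. Qed.

(** Each of the [size ps] junctions uses up one uncovered vertex of [X], and more than [2k] must be
    available whenever a common neighbour is sought. *)
Lemma join_paths ps p : uniq (flatten (p :: ps)) -> all (ypath e inX) (p :: ps) ->
    k.*2 + size ps < #|uncovered (flatten (p :: ps))| ->
  exists p', [/\ uniq p', ypath e inX p',
    {subset flatten (p :: ps) <= p'} & k.*2 < #|uncovered p'|].
Proof.
elim: ps p => [|p2 ps IH] p up.
  rewrite /= andbT cats0 addn0 in up * => yp ltU; exists p; split=> //.
case/and3P=> yp yp2 yps ltU; case: p p2 => [|y p] [|z q] // in up yp yp2 ltU *.
have yl := ypath_last_out yp; have zX : z \notin X by case/and3P: yp2.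
have [|x xU /andP[lx zx]] := common_nbr yl zX (uncovered_sub (flatten [:: y :: p, z :: q & ps])).
  by apply: leq_ltn_trans ltU; apply: leq_addr.
have [xX x_fl] : x \in X /\ x \notin flatten [:: y :: p, z :: q & ps].
  by apply/andP; rewrite inE in xU.
pose p1 := (y :: p) ++ x :: z :: q.
have perm1 : perm_eq (flatten (p1 :: ps)) (x :: flatten [:: y :: p, z :: q & ps]).
  have -> : flatten (p1 :: ps) = (y :: p) ++ [:: x] ++ flatten ((z :: q) :: ps).
    by rewrite /p1 [LHS]/= -catA.
  by rewrite perm_catCA.
have [||| p' [up' yp' sub' ltU']] := IH p1.
- by rewrite (perm_uniq perm1) cons_uniq x_fl.
- by apply/andP; split=> //; apply: ypath_join.
- have subU : uncovered (flatten (p1 :: ps)) = uncovered (flatten [:: y :: p, z :: q & ps]) :\ x.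
    apply/setP => v; rewrite in_setD1 [in LHS]inE [in RHS]inE (perm_mem perm1) inE negb_or.
    by rewrite andbCA.
  by move: ltU; rewrite subU (cardsD1 x) xU /= addnS ltnS.
exists p'; split=> // v v_fl; apply: sub'; rewrite (perm_mem perm1).
by rewrite inE v_fl orbT.
Qed.

Hypothesis X2 : 1 < #|X|.

(** The path grows by a vertex of [X] and a fresh outside vertex until [2k + 1] vertices of [X] are
    uncovered, the least number that still guarantees a common neighbour of the two ends; that
    neighbour closes the cycle. *)
Lemma close_path p : uniq p -> ypath e inX p -> k.*2 < #|uncovered p| ->
  exists c, [/\ uniq c, cycle e c, {in X, forall v, v \in p -> v \in c}
    & #|uncovered c| = k.*2].
Proof.
have [n] := ubnP #|uncovered p|; elim: n p => // n IH [//|y p] ltn up yp ltU.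
have yl := ypath_last_out yp; have yX : y \notin X by case/and3P: yp.
have step x : uncovered (x :: y :: p) = uncovered (y :: p) :\ x.
  by apply/setP => v; rewrite !inE !negb_or andbCA.
have [eqU|neqU] := eqVneq #|uncovered (y :: p)| k.*2.+1.
  have [x xU /andP[yx lx]] := common_nbr yX yl (uncovered_sub (y :: p)) ltU.
  have [xX xp] : x \in X /\ x \notin y :: p by apply/andP; rewrite inE in xU.
  exists (x :: y :: p); split.
  - by rewrite cons_uniq xp.
  - by case/and3P: yp => _ _ yp; rewrite /= e_sym yx rcons_path yp.
  - by move=> v _ vp; rewrite inE vp orbT.
  - by have := cardsD1 x (uncovered (y :: p)); rewrite xU eqU step => -[].
have {ltU neqU} ltU : k.*2.+1 < #|uncovered (y :: p)| by rewrite ltn_neqAle eq_sym neqU.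
(* The path has one more vertex outside [X] than inside. At least two vertices of [X] are uncovered,
   and at least [|X|] vertices lie outside [X]. *)
have [y' y'X y'p] : exists2 y', y' \notin X & y' \notin y :: p.
  have /subsetPn[y'] : ~~ (~: X \subset [set v | (v \in y :: p) && (v \notin X)]); last first.
    by rewrite !inE => y'X; rewrite y'X andbT => y'p; exists y'.
  apply/negP => /subset_leq_card leY; have := leq_trans (card_other_side X2) leY.
  have : #|[set v | (v \in y :: p) && (v \notin X)]|
       + #|[set v | (v \in y :: p) && (v \in X)]| = size (y :: p).
    rewrite -(card_uniqP up) -[RHS]cardsE -[RHS](cardsID (~: X)).
    by congr (_ + _); apply: eq_card => v; rewrite !inE ?negbK // andbC.
  have : #|[set v | (v \in y :: p) && (v \in X)]| = (size (y :: p))./2.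
    have -> : (size (y :: p))./2 = count inX (y :: p).
      have := count_alternation false (size (y :: p)).
      by rewrite -(ypath_alternation e_bip yp) count_map => <-.
    rewrite -size_filter -(card_uniqP (filter_uniq _ up)); apply: eq_card => v.
    by rewrite inE mem_filter andbC.
  have := ypath_size e_bip yp; have := card_uncovered (y :: p); move: ltU.
  move: #|uncovered _| #|[set v | (v \in _) && (v \in X)]|.
  move: #|[set v | _ && (v \notin X)]| #|X| (size (y :: p)).
  by clear => a b c d f; lia.
have [|x xU /andP[lx y'x]] := common_nbr yl y'X (uncovered_sub (y :: p)); first exact: ltnW.
have [xX xp] : x \in X /\ x \notin y :: p by apply/andP; rewrite inE in xU.
have perm1 : perm_eq ((y :: p) ++ [:: x; y']) (x :: y' :: y :: p) by rewrite perm_catC.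
have unc : uncovered ((y :: p) ++ [:: x; y']) = uncovered (y :: p) :\ x.
  apply/setP => v; rewrite in_setD1 [in LHS]inE [in RHS]inE (perm_mem perm1) !inE !negb_or.
  case vX: (v \in X) => //=; last by rewrite andbF.
  by rewrite (_ : v != y') //; apply: contraTneq vX => ->.
have cD := cardsD1 x (uncovered (y :: p)); rewrite xU -unc in cD.
have [||||c [uc cc cov cU]] := IH ((y :: p) ++ [:: x; y']).
- by move: ltn; rewrite cD.
- rewrite (perm_uniq perm1) /= inE negb_or xp y'p -/(uniq (y :: p)) up !andbT.
  by apply: contraNneq y'X => <-.
- by apply: ypath_join => //=; rewrite y'X.
- by move: ltU; rewrite cD.
exists c; split=> // v vX vp; apply: cov => //.
by rewrite (perm_mem perm1) !inE -in_cons vp !orbT.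
Qed.

Lemma absorb c : uniq c -> cycle e c ->
    {in uncovered c, forall x, k < #|[set y | e x y]|} ->
    k < #|[set v | (v \in c) && (v \in X)]| ->
    k.*2 <= #|[set v | (v \in c) && (v \in X)]|.+1 ->
  exists c', [/\ uniq c', cycle e c' & {subset X <= c'}].
Proof.
have [n] := ubnP #|uncovered c|; elim: n c => // n IH c ltn uc cc degU kj k2j.
have [U0|[x xU]] := set_0Vmem (uncovered c).
  exists c; split=> // v vX; apply/negPn/negP => vc.
  by have := in_set0 v; rewrite -U0 inE vX vc.
have [xX xc] : x \in X /\ x \notin c by apply/andP; rewrite inE in xU.
have [c' [uc' cc' cov]] := extendable_dense uc cc xX xc (degU x xU) kj k2j.
have sub_c : [set v | (v \in c) && (v \in X)] \subset [set v | (v \in c') && (v \in X)].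
  by apply/subsetP => v; rewrite !inE => /andP[vc vX]; rewrite vX cov // vc orbT.
have subU : uncovered c' \subset uncovered c :\ x.
  by apply/subsetP => v; rewrite !inE => /andP[vX]; rewrite cov // negb_or vX.
apply: (IH c') => //.
- apply: leq_ltn_trans (subset_leq_card subU) _.
  by move: ltn; rewrite (cardsD1 x) xU.
- by move=> v /(subsetP subU); rewrite in_setD1 => /andP[_ /degU].
- exact: leq_trans kj (subset_leq_card sub_c).
- by apply: leq_trans k2j _; rewrite ltnS subset_leq_card.
Qed.

(** Covers two vertices by one path without spending a third vertex of [X] on a junction. The pair
    has two common neighbours [a] and [b], and a third neighbour [d] of either one, which becomes an
    end. *)
Lemma pair_path s1 s2 : s1 \in X -> s2 \in X -> s1 != s2 -> 2 < #|X| ->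
  exists p, [/\ uniq p, ypath e inX p, s1 \in p, s2 \in p
    & #|uncovered p| = #|X| - 2].
Proof.
move=> s1X s2X s12 X3.
have /card_gt1P[a [b [aC bC ab]]] := common_nbrs s1X s2X s12.
have sub2 : [set s1; s2] \subset X by rewrite subUset !sub1set s1X.
have : #|[set s1; s2]| < #|nbrs e [set s1; s2]| by apply: nbrs_gt; rewrite ?cards2 ?s12.
rewrite cards2 s12 => lt3.
have /subsetPn[d dN] : ~~ (nbrs e [set s1; s2] \subset [set a; b]).
  by apply: contraL lt3 => /subset_leq_card; rewrite cards2 ab -leqNgt.
rewrite !inE negb_or in aC bC * => /andP[da db].
case/andP: aC => a1 a2; case/andP: bC => b1 b2.
have out s y : s \in X -> e s y -> y \notin X by move=> sX /e_bip <-.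
have aX := out _ _ s1X a1; have bX := out _ _ s1X b1.
have build u w : u \in X -> w \in X -> u != w -> e u a -> e w a -> e w b -> e u d ->
    exists p, [/\ uniq p, ypath e inX p, u \in p, w \in p & #|uncovered p| = #|X| - 2].
  move=> uX wX uw ua wa wb ud; have dX := out _ _ uX ud.
  have neX v y : v \in X -> y \notin X -> (v == y) = false.
    by move=> vX; apply: contraNF => /eqP <-.
  exists [:: d; u; a; w; b]; split.
  - rewrite /= !inE !negb_or da db ab uw ![d == _]eq_sym ![a == w]eq_sym.
    by rewrite (neX u d) // (neX w d) // (neX u a) // (neX u b) // (neX w a) // (neX w b).
  - by rewrite /= dX bX [e d u]e_sym ud ua e_sym wa wb.
  - by rewrite !inE eqxx orbT.
  - by rewrite !inE eqxx !orbT.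
  - have -> : uncovered [:: d; u; a; w; b] = X :\: [set u; w].
      apply/setP => v; rewrite !inE !negb_or; case vX: (v \in X); rewrite ?andbF //=.
      by rewrite (neX v d) // (neX v a) // (neX v b) //= !andbT.
    rewrite cardsD (setIidPr _) ?cards2 ?uw //.
    by rewrite subUset !sub1set uX.
move: dN; rewrite inE => /exists_inP[u]; rewrite !inE.
case/orP=> /eqP-> ud; first exact: build.
have [|p [? ? ? ? ?]] := build s2 s1 s2X s1X _ a2 a1 b1 ud; first by rewrite eq_sym.
by exists p.
Qed.

(** With [m] vertices outside [X], the non-edges at [low] number at least [|low| (m - k)] and at
    most [m k]. If [|low| > k], this forces [m <= k (k + 1)]. *)
Lemma card_low_degree : k * k.+1 < #|~: X| ->
  #|[set x in X | #|[set y | e x y]| <= k]| <= k.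
Proof.
set low := [set x in X | _] => ltm.
have cnt (B : {set T}) (P : pred T) : #|[set y in B | P y]| = \sum_(y in B) (P y : nat).
  rewrite -sum1_card (eq_bigl (fun y => (y \in B) && P y)); last by move=> y; rewrite inE.
  by rewrite big_mkcondr; apply: eq_bigr => y _; case: (P y).
have ge : #|low| * (#|~: X| - k) <= \sum_(x in low) #|[set y in ~: X | ~~ e x y]|.
  rewrite -sum_nat_const; apply: leq_sum => x; rewrite inE => /andP[xX degx].
  have -> : [set y in ~: X | ~~ e x y] = ~: X :\: [set y | e x y].
    by apply/setP => y; rewrite !inE andbC.
  rewrite cardsD; apply: leq_sub2l; apply: leq_trans degx.
  by apply: subset_leq_card; apply: subsetIr.
have le : \sum_(x in low) #|[set y in ~: X | ~~ e x y]| <= #|~: X| * k.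
  under eq_bigr do rewrite cnt.
  rewrite exchange_big -sum_nat_const; apply: leq_sum => y; rewrite inE => yX.
  apply: leq_trans (missed_le yX); rewrite -cnt; apply: subset_leq_card.
  by apply/subsetP => x; rewrite !inE e_sym => /andP[/andP[-> _] ->].
have := leq_trans ge le; move: ltm; move: #|low| #|~: X| => a m.
by clear; nia.
Qed.

End Dense.

End Covering.

(** * Numerical conditions, choice of the initial path, and conclusion *)

Theorem theorem1p8 (k : nat) (T : finType) (e : rel T) (X Y : {set T}) (n : nat)
    (hk : k <= 7)
    (hG : bipartite_graph e X Y)
    (hHall : double_Hall e X)
    (hX : #|X| = n)
    (hn : maxn (2 * k + 1) (k * (k + 1)) < n)
    (hdeg : forall y : T, y \in Y -> n - k <= degree e y) :
  exists c : seq T, graph_cycle e c /\ {subset X <= c}.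
Proof.
case: hG => -[e_sym _] [XY_T XY_dis e_XY]; case: hHall => X2 hallX.
have YE v : (v \in Y) = (v \notin X).
  have := in_setT v; rewrite -XY_T inE; have [vX _|_ //] := boolP (v \in X).
  exact: (disjointFr XY_dis vX).
have e_bip u v : e u v -> (u \in X) = (v \notin X).
  by move/e_XY; rewrite !YE; case: (u \in X) (v \in X) => [] [].
have [n2k nk2] : 2 * k + 1 < n /\ k * (k + 1) < n by apply/andP; rewrite -gtn_max.
(* With [n - 2k] vertices of [X] on the first cycle, these are the two size conditions of [absorb].
   The second is an equality for [k = 2], [n = 7]. *)
have [n3k n4k] : 3 * k < n /\ 4 * k <= n.+1 by clear -n2k nk2; split; nia.
have missed_le y : y \notin X -> #|missed e X y| <= k.
  move=> yX; have := hdeg y; rewrite YE => /(_ yX).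
  have -> : missed e X y = X :\: [set u | e y u].
    by apply/setP => u; rewrite !inE andbC.
  rewrite cardsD hX /degree (setIidPr _); first by clear -n2k; lia.
  by apply/subsetP => u; rewrite inE => /e_bip; rewrite (negPf yX) => /esym/negbFE.
have cardY := card_other_side e_bip hallX X2.
pose low := [set x in X | #|[set y | e x y]| <= k].
have lowX : low \subset X by apply/subsetP => x; rewrite inE => /andP[].
have low_le : #|low| <= k.
  apply: (card_low_degree e_sym missed_le); apply: leq_trans cardY.
  by rewrite hX -(addn1 k).
have hall_low (A : {set T}) : A \subset low -> 1 < #|A| -> #|A| <= #|Lambda2 e A|.
  by move=> Al; apply: hallX; apply: subset_trans lowX.
have nbr_low (A : {set T}) : A \subset low -> 0 < #|A| -> #|A| < #|nbrs e A|.
  move=> Al A0; apply: (nbrs_gt e_sym hallX) => //; first exact: subset_trans lowX.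
  have := subset_leq_card Al; rewrite hX; move: low_le A0 n2k.
  by move: #|A| #|low|; clear => a b; lia.
have [p [up yp lowp ltU]] : exists p, [/\ uniq p, ypath e (fun v => v \in X) p,
    {in low, forall x, x \in p} & k.*2 < #|uncovered X p|].
  (* If no vertex has low degree, a single vertex outside [X] serves as the initial path. *)
  have [low0|[s0 s0_low]] := set_0Vmem low.
    have /card_gt0P[y yX] : 0 < #|~: X| by apply: leq_trans cardY; apply: ltnW.
    rewrite inE in yX; exists [:: y]; split=> //=; rewrite ?yX //.
      by move=> x; rewrite low0 inE.
    rewrite (_ : uncovered X [:: y] = X) ?hX; first by clear -n2k; lia.
    apply/setP => v; rewrite !inE; case vX: (v \in X) => //=.
    by apply: contraNneq yX => <-.
  (* The second alternative pays for joining: [|low|] vertices are covered, at most [|low| - 1]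
     junctions are needed, and more than [2k] vertices must remain. For [k >= 3] it follows from
     [4k <= k (k + 1) < n]. *)
  have [[k2 low2]|not22] : (k = 2 /\ #|low| = 2) \/ (#|low|.*2 + k.*2 <= n).
    by clear -low_le n2k nk2 n4k; move: #|low| low_le => a; nia.
    have /cards2P[s1 [s2 [s12 lowE]]] : #|low| == 2 by apply/eqP.
    have [s1X s2X] : s1 \in X /\ s2 \in X.
      by split; apply: (subsetP lowX); rewrite lowE !inE eqxx ?orbT.
    have [|p [up yp s1p s2p cU]] := pair_path e_sym e_bip hallX s1X s2X s12.
      by rewrite hX; clear -n2k k2; lia.
    exists p; split=> //; last by rewrite cU hX; clear -nk2 k2; lia.
    by move=> x; rewrite lowE !inE => /orP[] /eqP ->.
  have [ps [tf sz_ps]] :=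
    linear_forest_exists e_sym e_bip lowX (leq_trans low_le hk) hall_low nbr_low.
  have cl := two_factor_card e_bip lowX tf; case: tf => /and3P[u_ps _ yps] cov.
  have sz_le : size ps <= #|low|.
    rewrite cl /= add0n; move: sz_ps yps; clear; elim: ps => //= p ps IH.
    move=> /andP[p1 /IH{}IH] /andP[_ /IH]; move: p1; case: (size p) => [|[|z]] //= _.
    by lia.
  case: ps => [|p ps] in u_ps yps cov cl sz_ps sz_le *.
    by move: (cov s0 (subsetP lowX s0 s0_low)); rewrite s0_low.
  have [|p' [up' yp' sub' ltU']] := join_paths e_sym missed_le u_ps yps.
    have -> : uncovered X (flatten (p :: ps)) = X :\: low.
      apply/setP => v; rewrite in_setD [in LHS]inE; case vX: (v \in X); rewrite ?andbF //=.
      by rewrite andbT (cov v vX).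
    rewrite cardsD hX (setIidPr lowX); move: sz_le not22 => /=.
    by move: (size ps) #|low|; clear => a b; lia.
  exists p'; split=> // x x_low; apply: sub'.
  by rewrite (cov x (subsetP lowX x x_low)).
have [c [uc cc cov cU]] := close_path e_sym e_bip hallX missed_le X2 up yp ltU.
have cX := card_uncovered X c; rewrite cU hX in cX.
have [|||c' [uc' cc' covX]] := absorb e_sym e_bip hallX missed_le uc cc.
- move=> x; rewrite inE => /andP[xX xc]; rewrite ltnNge; apply: contra xc => degx.
  by apply: cov => //; apply: lowp; rewrite inE xX.
- by move: cX n3k; move: #|_|; clear => a; lia.
- by move: cX n4k; move: #|_|; clear => a; lia.
exists c'; split=> //; split; last by rewrite /ucycle cc' uc'.
(* The cycle has as many vertices outside [X] as inside, hence [2|X| >= 4] in all, which settles the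
   size bound of [graph_cycle]. *)
have cX' : [set v | (v \in c') && (v \in X)] = X.
  by apply/setP => v; rewrite inE; case vX: (v \in X); rewrite ?andbF // covX.
have := card_cycle_sides e_bip uc' cc'; rewrite cX' => cY.
rewrite -(card_uniqP uc') -cardsE -(cardsID X).
have -> : [set v in c'] :&: X = X by rewrite -[RHS]cX'; apply/setP => v; rewrite !inE.
have -> : [set v in c'] :\: X = [set v | (v \in c') && (v \notin X)].
  by apply/setP => v; rewrite !inE andbC.
by rewrite cY; move: X2; move: #|X|; clear => a; lia.
Qed.
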